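(* Consider Banach spaces either as metric structures in unbounded continuous logic, or as bounded metric structures in continuous first order logic via their closed unit balls. Then (in either approach) the theory of the class of Banach spaces is inductive, and admits a model completion $T^*$ which is moreover complete and $\aleph_0$-categorical. When the entire Banach space is viewed as a structure, the types (in the sense of $T^*$) in variables indexed by a set $I$ over a subspace $E$ are exactly the members of $S_I(E)$, the type of a tuple $\bar a = (a_i)_{i \in I}$ over $E$ being $\mathrm{tp}(\bar a/E)$. If one only considers the unit ball, then the space of $I$-types over $B(E)$ is $S_I^{\leq 1}(E) = \bigl\{ \xi \in S_I(E) : \|x_i\|^\xi \leq 1 \text{ for all } i \in I \bigr\}$.
   Context: All Banach spaces are real; $B(E)$ is the closed unit ball of $E$. As a bounded metric structure, $B(E)$ is equipped with the vector-space operations restricted to the ball, such as $0$, $x \mapsto -x$, $(x,y) \mapsto \frac{x+y}{2}$, and the norm as a predicate/distance; the whole space as an unbounded structure and its unit ball are bi-interpretable. A theory is inductive if its class of models is closed under (completed) unions of increasing chains. A model completion of an inductive theory $T$ is a companion $T^*$ of $T$ (every model of either theory embeds in a model of the other) that eliminates quantifiers. For a Banach space $E$ and an index set $I$, let $E(I) = E \oplus \bigoplus_{i \in I} \mathbb{R} x_i$, with formal variables $x_i$. $S_I(E)$ is the set of all semi-norms on $E(I)$ extending the norm of $E$; the semi-norm corresponding to $\xi$ is written $\|\cdot\|^\xi$, and $S_I(E)$ is given the least topology making $\xi \mapsto \|x\|^\xi$ continuous for every $x \in E(I)$. If $E \subseteq F$ are Banach spaces and $\bar a \in F^I$, then $\mathrm{tp}(\bar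 a/E) \in S_I(E)$ is the semi-norm $b + \sum \lambda_i x_i \mapsto \| b + \sum \lambda_i a_i \|$. *)

(* Defs.v *)
From HB Require Import structures.
From mathcomp Require Import all_boot all_order all_algebra.
From mathcomp Require Import all_classical all_reals topology normedtype.
From mathcomp Require Import freeg.

Set Implicit Arguments.
Unset Strict Implicit.
Unset Printing Implicit Defensive.

Import Order.TTheory GRing.Theory Num.Theory numFieldNormedType.Exports.

Local Open Scope classical_set_scope.
Local Open Scope ring_scope.

(* Complete uniform spaces are pointed in the library, hence nonempty. *)
#[short(type="completeMetricType")]
HB.structure Definition CompleteMetric (K : numFieldType) :=
  {M of Metric K M & Complete M}.

(* Real-valued continuous first-order logic, one-sorted.  The signature carries
   a gauge: every bound and every modulus of uniform continuity is required
   only on the sets {gauge <= r}, and may depend on r; this is continuous logic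
   for unbounded metric structures.  When [trivial_gauge] is set the gauge is
   identically 0; the sets {gauge <= r}, r >= 0, are then the whole structure
   and one recovers continuous logic for bounded metric structures (see
   [eval_sup_trivial] and [eval_inf_trivial] for the quantifiers). *)
Record signature (R : realType) := Signature {
  trivial_gauge : bool ;
  fsym : Type ;
  far : fsym -> nat ;
  psym : Type ;
  par : psym -> nat ;
  diam_bound : R -> R ;
  fbound : fsym -> R -> R ;
  fmodulus : fsym -> R -> R -> R ;
  pbound : psym -> R -> R ;
  pmodulus : psym -> R -> R -> R ;
  fmodulus_gt0 : forall f r e, 0 < e -> 0 < fmodulus f r e ;
  pmodulus_gt0 : forall P r e, 0 < e -> 0 < pmodulus P r e }.

Record structure (R : realType) (L : signature R) := Structure {
  carrier :> completeMetricType R ;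
  gauge : carrier -> R ;
  finterp : forall f : fsym L, ('I_(far f) -> carrier) -> carrier ;
  pinterp : forall P : psym L, ('I_(par P) -> carrier) -> R ;
  gauge_ge0 : forall x, 0 <= gauge x ;
  gauge_lip : forall x y, `|gauge x - gauge y| <= mdist x y ;
  gauge_triv : trivial_gauge L -> forall x, gauge x = 0 ;
  mdist_bounded : forall r x y,
    gauge x <= r -> gauge y <= r -> mdist x y <= diam_bound L r ;
  finterp_bounded : forall f r x,
    (forall i, gauge (x i) <= r) -> gauge (@finterp f x) <= fbound f r ;
  finterp_ucont : forall f r e x y, 0 < e ->
    (forall i, gauge (x i) <= r) -> (forall i, gauge (y i) <= r) ->
    (forall i, mdist (x i) (y i) < fmodulus f r e) ->
    mdist (@finterp f x) (finterp y) <= e ;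
  pinterp_bounded : forall P r x,
    (forall i, gauge (x i) <= r) -> `|@pinterp P x| <= pbound P r ;
  pinterp_ucont : forall P r e x y, 0 < e ->
    (forall i, gauge (x i) <= r) -> (forall i, gauge (y i) <= r) ->
    (forall i, mdist (x i) (y i) < pmodulus P r e) ->
    `|@pinterp P x - pinterp y| <= e }.

Section Syntax.
Context (R : realType) (L : signature R).

(* [term n] and [formula n] have their free variables among n ones, indexed by
   'I_n; a quantifier binds variable 0 of its body. *)
Inductive term (n : nat) : Type :=
| TVar of 'I_n
| TApp (f : fsym L) of ('I_(far f) -> term n).

Inductive formula : nat -> Type :=
| FPred n (P : psym L) of ('I_(par P) -> term n) : formula n
| FDist n of term n & term n : formula n
| FGauge n of term n : formula n
| FConn n k (u : 'rV[R]_k -> R) of continuous u & ('I_k -> formula n) :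
    formula n
| FSup n of nat & formula n.+1 : formula n
| FInf n of nat & formula n.+1 : formula n.

Fixpoint quantifier_free n (phi : formula n) : Prop :=
  match phi with
  | FPred _ _ _ | FDist _ _ _ | FGauge _ _ => True
  | FConn _ _ _ _ phis => forall i, quantifier_free (phis i)
  | FSup _ _ _ | FInf _ _ _ => False
  end.

Definition theory := set (formula 0).

End Syntax.

Arguments TVar {R L n}.
Arguments TApp {R L n}.

(* Equal to 1 for t <= r and to 0 for t >= r + 1. *)
Definition cutoff (R : realType) (r : nat) (t : R) : R :=
  Num.min 1 (Num.max 0 (r.+1%:R - t)).

Definition vnil (T : Type) : 'I_0 -> T :=
  fun i => False_rect T (notF (ltn_ord i)).

Definition vcons (T : Type) n (x : T) (v : 'I_n -> T) : 'I_n.+1 -> T :=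
  fun i => oapp v x (unlift ord0 i).

Section Semantics.
Context (R : realType) (L : signature R).
Implicit Types (M N : structure L) (T : theory L).

Fixpoint teval M n (t : term L n) (v : 'I_n -> M) : M :=
  match t with
  | TVar i => v i
  | TApp f ts => finterp (fun i => teval (ts i) v)
  end.

(* In unbounded logic only formulas that eventually vanish in the quantified
   variable may be quantified: the body is multiplied by a cutoff of the
   gauge of that variable, so that it vanishes once the gauge is >= r + 1. *)
Fixpoint eval M n (phi : formula L n) : ('I_n -> M) -> R :=
  match phi in formula _ n return ('I_n -> M) -> R with
  | FPred _ P ts => fun v => pinterp (fun i => teval (ts i) v)
  | FDist _ t u => fun v => mdist (teval t v) (teval u v)
  | FGauge _ t => fun v => gauge (teval t v)
  | FConn _ _ u _ phis => fun v => u (\row_i eval (phis i) v)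
  | FSup _ r psi => fun v =>
      sup (range (fun x : M => cutoff r (gauge x) * eval psi (vcons x v)))
  | FInf _ r psi => fun v =>
      inf (range (fun x : M => cutoff r (gauge x) * eval psi (vcons x v)))
  end.

(* A sentence phi in a theory stands for the condition phi = 0. *)
Definition model M T := forall phi, T phi -> eval phi (@vnil M) = 0.

Definition theory_of (C : structure L -> Prop) : theory L :=
  [set phi | forall M, C M -> eval phi (@vnil M) = 0].

Definition embedding M N (h : M -> N) : Prop :=
  [/\ forall x y, mdist (h x) (h y) = mdist x y,
      forall x, gauge (h x) = gauge x,
      forall (f : fsym L) x, h (@finterp _ _ _ f x) = finterp (h \o x)
    & forall (P : psym L) x, @pinterp _ _ _ P (h \o x) = pinterp x].

Definition isomorphic M N : Prop :=
  exists h : M -> N, embedding h /\ range h = setT.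

(* An increasing chain is given together with its completed union N: a family
   of substructures of N, pairwise comparable for inclusion, whose union is
   dense in N. *)
Definition inductive_theory T : Prop :=
  forall (J : Type) (M : J -> structure L) (N : structure L)
    (g : forall j, M j -> N),
    inhabited J ->
    (forall j, model (M j) T) ->
    (forall j, embedding (g j)) ->
    (forall i j, range (g i) `<=` range (g j) \/
                 range (g j) `<=` range (g i)) ->
    dense (\bigcup_(j in [set: J]) range (g j)) ->
    model N T.

Definition embeds_in_model M T : Prop :=
  exists N (h : M -> N), model N T /\ embedding h.

Definition companion T T' : Prop :=
  (forall M, model M T -> embeds_in_model M T') /\
  (forall M, model M T' -> embeds_in_model M T).

(* Modulo T, every formula is, uniformly on each set {gauge <= r}, a limit of
   quantifier-free formulas. *)
Definition quantifier_elimination T : Prop :=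
  forall n (phi : formula L n) (r e : R), 0 < e ->
    exists psi : formula L n, quantifier_free psi /\
      forall M (v : 'I_n -> M), model M T -> (forall i, gauge (v i) <= r) ->
        `|eval phi v - eval psi v| <= e.

Definition model_completion T T' : Prop :=
  companion T T' /\ quantifier_elimination T'.

Definition complete_theory T : Prop :=
  (exists M, model M T) /\
  forall M N (phi : formula L 0), model M T -> model N T ->
    eval phi (@vnil M) = eval phi (@vnil N).

Definition density_character_aleph0 M : Prop :=
  (exists2 D : set M, countable D & dense D) /\
  (forall D : set M, finite_set D -> ~ dense D).

Definition aleph0_categorical T : Prop :=
  (exists M, model M T /\ density_character_aleph0 M) /\
  forall M N, model M T -> model N T ->
    density_character_aleph0 M -> density_character_aleph0 N ->
    isomorphic M N.

(* Formulas with parameters in A and free variables in I, presented as a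
   formula together with a substitution for its free variables. *)
Definition pformula (A I : Type) : Type :=
  {n : nat & (formula L n * ('I_n -> I + A))%type}.

Definition elementary_type (A I : Type) (N : structure L)
    (j : A -> N) (a : I -> N) : {ptws pformula A I -> R} :=
  fun p => eval (projT2 p).1
    (fun i => match (projT2 p).2 i with inl k => a k | inr b => j b end).

(* The I-types over A, in the sense of T: the types of I-tuples in models of T
   extending A.  As a subspace of the product space it carries the logic
   topology, the least one making the value of every formula continuous. *)
Definition type_space T (A : structure L) (I : Type) :
    set {ptws pformula A I -> R} :=
  [set p | exists (N : structure L) (j : A -> N) (a : I -> N),
     [/\ model N T, embedding j & p = elementary_type j a]].

Lemma eval_sup_trivial M n r (psi : formula L n.+1) (v : 'I_n -> M) :
  trivial_gauge L ->
  eval (FSup r psi) v = sup (range (fun x : M => eval psi (vcons x v))).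
Proof.
move=> tL /=; apply: (congr1 (fun f : M -> R => sup (range f))).
apply/funext => x.
rewrite (@gauge_triv _ _ M tL) /cutoff subr0 max_r ?ler0n//.
by rewrite min_l ?mul1r ?ler1n.
Qed.

Lemma eval_inf_trivial M n r (psi : formula L n.+1) (v : 'I_n -> M) :
  trivial_gauge L ->
  eval (FInf r psi) v = inf (range (fun x : M => eval psi (vcons x v))).
Proof.
move=> tL /=; apply: (congr1 (fun f : M -> R => inf (range f))).
apply/funext => x.
rewrite (@gauge_triv _ _ M tL) /cutoff subr0 max_r ?ler0n//.
by rewrite min_l ?mul1r ?ler1n.
Qed.

End Semantics.

Arguments type_space {R L}.

Definition homeomorphism (X Y : topologicalType) (h : X -> Y) : Prop :=
  continuous h /\
  exists g : Y -> X, [/\ continuous g, cancel h g & cancel g h].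

Section Seminorms.
Context (R : realType).
Implicit Types (E F : completeNormedModType R) (I : choiceType).

(* E(I) = E (+) (+)_(i in I) R x_i; the formal variable x_i is (0, <<i>>). *)
Definition adjoin E I : lmodType R := (E * {freeg I / R})%type.

(* S_I(E), topologized as a subspace of the product space. *)
Definition seminorm_space E I : set {ptws adjoin E I -> R} :=
  [set xi | [/\ forall x y, xi (x + y) <= xi x + xi y,
                forall c x, xi (c *: x) = `|c| * xi x
              & forall b : E, xi (b, 0) = `|b|]].

Definition seminorm_space_le1 E I : set {ptws adjoin E I -> R} :=
  [set xi | seminorm_space xi /\ forall i : I, xi (0, << i >>) <= 1].

(* tp(a/E), for E identified with a subspace of F along j. *)
Definition norm_type E F I (j : E -> F) (a : I -> F) : {ptws adjoin E I -> R} :=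
  fun x => `|j x.1 + fglift a x.2|.

End Seminorms.

Arguments seminorm_space {R}.
Arguments seminorm_space_le1 {R}.

Section WholeSpace.
Context (R : realType).

Inductive banach_fsym : Type := BZero | BAdd | BScale of R.

Definition banach_far (f : banach_fsym) : nat :=
  match f with BZero => 0 | BAdd => 2 | BScale _ => 1 end.

Definition banach_fbound (f : banach_fsym) (r : R) : R :=
  match f with BZero => 0 | BAdd => r + r | BScale c => `|c| * r end.

Definition banach_fmodulus (f : banach_fsym) (r e : R) : R :=
  match f with BZero => 1 | BAdd => e / 2 | BScale c => e / (`|c| + 1) end.

Lemma banach_fmodulus_gt0 f r e : 0 < e -> 0 < banach_fmodulus f r e.
Proof. by case: f => [||c] e0 //=; rewrite divr_gt0// ltr_wpDl. Qed.

(* The norm is the gauge. *)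
Definition banach_signature : signature R :=
  @Signature R false banach_fsym banach_far void (fun=> 0) (fun r => r + r)
    banach_fbound banach_fmodulus (fun=> id) (fun _ _ => id)
    banach_fmodulus_gt0 (fun _ _ _ => id).

Variable E : completeNormedModType R.

Let dist (x y : E) : R := `|x - y|.

Let dist_ge0 x y : 0 <= dist x y. Proof. exact: normr_ge0. Qed.

Let dist_positivity x y : dist x y = 0 -> x = y.
Proof. by move=> /normr0_eq0/eqP; rewrite subr_eq0 => /eqP. Qed.

Let ballEdist (x : E) d : ball x d = [set y | dist x y < d].
Proof. by rewrite -ball_normE. Qed.

Definition banach_metric : completeMetricType R :=
  HB.pack (E : Type) (CompleteNormedModule.class E)
    (PseudoMetric_isMetric.Build R E dist_ge0 dist_positivity ballEdist).

Definition banach_finterp (f : banach_fsym) :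
    ('I_(banach_far f) -> E) -> E :=
  match f return ('I_(banach_far f) -> E) -> E with
  | BZero => fun=> 0
  | BAdd => fun x => x ord0 + x ord_max
  | BScale c => fun x => c *: x ord0
  end.

Definition banach_structure : structure banach_signature.
Proof.
refine (@Structure R banach_signature banach_metric (fun x : E => `|x|)
  (@banach_finterp) (fun P => match P with end)
  _ _ _ _ _ _ _ _).
- exact: normr_ge0.
- exact: ler_dist_dist.
- by [].
- by move=> r x y xr yr; rewrite (le_trans (ler_normB _ _))// lerD.
- move=> [||c] r x xr /=; rewrite ?normr0//.
    by rewrite (le_trans (ler_normD _ _))// lerD.
  by rewrite normrZ ler_wpM2l.
- move=> [||c] r e x y e0 _ _ xy /=; rewrite /mdist/= /dist.
  + by rewrite subrr normr0 ltW.
  + rewrite opprD addrACA (le_trans (ler_normD _ _))// (splitr e).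
    by rewrite lerD// ltW//; exact: xy.
  + rewrite -scalerBr normrZ.
    have c0 : 0 < `|c| + 1 by rewrite ltr_wpDl.
    have := ltW (xy ord0); rewrite /= /mdist/= /dist ler_pdivlMr// mulrC.
    by apply: le_trans; rewrite ler_wpM2r// lerDl.
- by case.
- by case.
Defined.

End WholeSpace.

Section UnitBall.
Context (R : realType).

Inductive ball_fsym : Type := UZero | UOpp | UMid.

Definition ball_far (f : ball_fsym) : nat :=
  match f with UZero => 0 | UOpp => 1 | UMid => 2 end.

Lemma ball_modulus_gt0 (T : Type) (f : T) (r e : R) : 0 < e -> 0 < e.
Proof. by []. Qed.

(* The unique predicate symbol is the norm. *)
Definition ball_signature : signature R :=
  @Signature R true ball_fsym ball_far unit (fun=> 1) (fun=> 2)
    (fun _ _ => 0) (fun _ _ e => e) (fun _ _ => 1) (fun _ _ e => e)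
    (@ball_modulus_gt0 _) (@ball_modulus_gt0 _).

Variable E : completeNormedModType R.

Definition unit_ball : Type := {x : E | `|x| <= 1}.

HB.instance Definition _ := Choice.on unit_ball.

Let dist (x y : unit_ball) : R := `|val x - val y|.

Let distxx x : dist x x = 0. Proof. by rewrite /dist subrr normr0. Qed.

Let dist_positivity x y : dist x y = 0 -> x = y.
Proof.
by move=> /normr0_eq0/eqP; rewrite subr_eq0 => /eqP xy; exact: val_inj.
Qed.

Let dist_sym x y : dist x y = dist y x. Proof. exact: distrC. Qed.

Let dist_triangle y x z : dist x z <= dist x y + dist y z.
Proof. exact: ler_distD. Qed.

Lemma norm_ball0 : `|0 : E| <= 1. Proof. by rewrite normr0. Qed.

HB.instance Definition _ :=
  isPointed.Build unit_ball (exist _ 0 norm_ball0).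

HB.instance Definition _ := isMetric.Build R unit_ball
  distxx dist_positivity dist_sym dist_triangle.

Let unit_ball_complete (F : set_system unit_ball) :
  ProperFilter F -> cauchy F -> cvg F.
Proof.
move=> FF /cauchy_ballP Fc.
have : cvg (val @ F).
  apply/cauchy_cvgP/cauchy_ballP => e e0.
  have [[A B] /= [FA FB] AB] := Fc _ e0.
  exists (val @` A, val @` B).
    by split; [apply: filterS FA|apply: filterS FB] => x ?; exists x.
  move=> [_ _] [/= [x Ax <-] [y By <-]]; have := AB (x, y) (conj Ax By).
  by rewrite /= ballEmdist -ball_normE.
move=> /cvg_ex[l Fl].
have l1 : `|l| <= 1.
  apply: (closed_cvg (fun y : R => y <= 1) (@closed_le R 1) _ _ (cvg_norm Fl)).
  by apply: nearW => x; exact: (valP (x : {x : E | `|x| <= 1})).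
apply/cvg_ex; exists (exist _ l l1 : unit_ball).
apply/cvg_ballP => e e0; have /cvg_ballP/(_ _ e0) := Fl.
move=> Fle; apply: (@filterS _ F _ _ _ _ Fle) => x.
by rewrite /= ballEmdist -ball_normE.
Qed.

HB.instance Definition _ := Uniform_isComplete.Build unit_ball
  unit_ball_complete.

Lemma norm_ballN (x : unit_ball) : `|- val x| <= 1.
Proof. by rewrite normrN (valP x). Qed.

Lemma norm_ball_mid (x y : unit_ball) : `|2^-1 *: (val x + val y)| <= 1.
Proof.
rewrite normrZ ger0_norm ?invr_ge0// mulrC ler_pdivrMr// mul1r.
by rewrite (le_trans (ler_normD _ _))// (lerD (valP x) (valP y)).
Qed.

Definition ball_finterp (f : ball_fsym) :
    ('I_(ball_far f) -> unit_ball) -> unit_ball :=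
  match f return ('I_(ball_far f) -> unit_ball) -> unit_ball with
  | UZero => fun=> exist _ 0 norm_ball0
  | UOpp => fun x => exist _ (- val (x ord0)) (norm_ballN _)
  | UMid => fun x =>
      exist _ (2^-1 *: (val (x ord0) + val (x ord_max))) (norm_ball_mid _ _)
  end.

Definition ball_structure : structure ball_signature.
Proof.
refine (@Structure R ball_signature unit_ball (fun=> 0) (@ball_finterp)
  (fun _ x => `|val (x ord0)|) _ _ _ _ _ _ _ _).
- by [].
- by move=> x y; rewrite subrr normr0 normr_ge0.
- by [].
- move=> r x y _ _; rewrite (le_trans (ler_normB _ _))//.
  by rewrite (lerD (valP x) (valP y)).
- by [].
- move=> [||] r e x y e0 _ _ xy; rewrite /mdist/= /dist /=.
  + by rewrite subrr normr0 ltW.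
  + by rewrite -opprD normrN ltW//; exact: xy.
  + rewrite -scalerBr opprD addrACA normrZ ger0_norm ?invr_ge0//.
    rewrite mulrC ler_pdivrMr// (le_trans (ler_normD _ _))//.
    by rewrite mulr_natr mulr2n lerD// ltW//; exact: xy.
- by move=> P r x _; rewrite normr_id (valP (x ord0)).
- move=> P r e x y e0 _ _ xy.
  by rewrite (le_trans (ler_dist_dist _ _))// ltW//; exact: xy.
Defined.

End UnitBall.

(* Main.v *)
Require Import Defs.
From HB Require Import structures.
From mathcomp Require Import all_boot all_order all_algebra.
From mathcomp Require Import all_classical all_reals topology normedtype.
From mathcomp Require Import freeg.
From mathcomp Require Import ring lra.

Set Implicit Arguments.
Unset Strict Implicit.
Unset Printing Implicit Defensive.

Import Order.TTheory GRing.Theory Num.Theory numFieldNormedType.Exports.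

Local Open Scope classical_set_scope.
Local Open Scope ring_scope.

(* Unrelated imported notions bear the same names. *)
Local Notation eval := Defs.eval.
Local Notation fsym := Defs.fsym.

(** Both parts of the theorem are instances of [presented_class_theorem].  A
[presentation] collects what the argument uses of a way of making every Banach
space E into a structure: its points are vectors of E, terms are linear
combinations, atomic formulas are norms of linear combinations; conversely,
such norms are, up to small changes of the coefficients, quantifier-free
formulas; and a structure satisfying the uniform forall-exists conditions
common to all Banach spaces comes itself from a Banach space
([whole_presentation], [ball_presentation]).  Conditions of that form pass to
completed unions of chains of models ([chain_ae_closed]), so the theory of
Banach spaces is inductive.

The model completion is the theory of the Gurarij spaces.  Two finite tuples a
and c, possibly from different spaces, are compared through the norms of their
linear combinations ([tpclose]); if these norms differ by at most d times the
sum of the absolute values of the coefficients, both spaces embed in a third one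
where corresponding entries are at distance at most d ([amalgam]).  A space G is
Gurarij if, whenever a tuple of G is compared in this way with a tuple of a space
F, every further point of F is imitated in G up to an arbitrarily small extra
error ([gurarii]).
- Every Banach space embeds in a Gurarij space ([gurarii_embedding]).  The bounded
  functions on the product of the dual ball of E with the real line form one
  space containing E and all its one-point extensions; one iterates and
  completes the union.
- Two separable Gurarij spaces are isometric, by an approximate back-and-forth
  ([gurarii_unique]), and every Gurarij space contains separable ones
  ([gurarii_separable_subspace]).
- The defining property is a family of forall-exists conditions, so the models of
  the theory of Gurarij spaces are, up to isomorphism, the Gurarij spaces
  ([model_gurarii], [model_gurarii_iso]).

Playing the one-point extension game through the quantifiers shows that the value
of any formula at a tuple of a Gurarij space depends, uniformly, continuously on
the norms of its linear combinations ([formula_type_continuous]).  Finitely many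
combinations determine all others up to a small error ([finite_net]), so every
formula is approximated by a continuous function of finitely many quantifier-free
ones: this is quantifier elimination, and for the empty tuple it is completeness.

The same continuity identifies types with semi-norms.  A type over E is realized in
a Gurarij space containing E, where it determines and is determined by the norms of
the combinations of the realizing tuple and of vectors of E; every semi-norm on E(I)
that extends the norm of E arises, because its quotient embeds in a Gurarij space
([seminorm_realized]).  Uniform continuity in one direction, and quantifier-free
definability of the norms in the other, make this bijection a homeomorphism
([type_space_homeomorphism]). *)

(** * Linear maps, semi-norms and the Hahn-Banach theorem *)

Section HahnBanach.
Context (R : realType).

Definition lin (V W : lmodType R) (f : V -> W) :=
  forall a x y, f (a *: x + y) = a *: f x + f y.

Definition linform (V : lmodType R) (f : V -> R) :=
  forall a x y, f (a *: x + y) = a * f x + f y.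

Record seminorm (V : lmodType R) (p : V -> R) : Prop := Seminorm {
  seminormD : forall x y, p (x + y) <= p x + p y ;
  seminormZ : forall c x, p (c *: x) = `|c| * p x }.

Section basics.
Context (V W : lmodType R).
Variables (f : V -> W) (u : V -> R) (p : V -> R).

Lemma lin0 : lin f -> f 0 = 0.
Proof. by move=> fl; have := fl (-1) 0 0; rewrite scaler0 addr0 scaleN1r addNr. Qed.

Lemma linD : lin f -> forall x y, f (x + y) = f x + f y.
Proof. by move=> fl x y; have := fl 1 x y; rewrite !scale1r. Qed.

Lemma linZ : lin f -> forall a x, f (a *: x) = a *: f x.
Proof. by move=> fl a x; have := fl a x 0; rewrite !addr0 lin0// addr0. Qed.

Lemma linB : lin f -> forall x y, f (x - y) = f x - f y.
Proof. by move=> fl x y; rewrite linD// -scaleN1r linZ// scaleN1r. Qed.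

Lemma lin_sum (J : finType) (l : J -> R) (a : J -> V) : lin f ->
  f (\sum_j l j *: a j) = \sum_j l j *: f (a j).
Proof.
move=> fl; elim/big_ind2 : _ => //; first exact: lin0.
- by move=> x x' y y' <- <-; rewrite linD.
- by move=> i _; rewrite linZ.
Qed.

(** Homogeneity follows from the inequality, applied to c and to its inverse. *)
Lemma seminorm_of_le : (forall x y, p (x + y) <= p x + p y) ->
  (forall c x, p (c *: x) <= `|c| * p x) -> seminorm p.
Proof.
move=> pD pZ; split=> // c x; apply/eqP; rewrite eq_le pZ /=.
have [->|c0] := eqVneq c 0.
  rewrite normr0 mul0r scale0r -(lerD2r (p 0)) add0r.
  by have := pD 0 0; rewrite addr0.
have := pZ c^-1 (c *: x); rewrite scalerA mulVf// scale1r normfV.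
by rewrite ler_pdivlMl// normr_gt0.
Qed.

Lemma linform0 : linform u -> u 0 = 0.
Proof.
by move=> ul; have := ul (-1) 0 0; rewrite scaler0 addr0 mulN1r addNr.
Qed.

Lemma linformD : linform u -> forall x y, u (x + y) = u x + u y.
Proof. by move=> ul x y; have := ul 1 x y; rewrite scale1r mul1r. Qed.

Lemma linformZ : linform u -> forall a x, u (a *: x) = a * u x.
Proof. by move=> ul a x; have := ul a x 0; rewrite !addr0 linform0// addr0. Qed.

Lemma seminorm0 : seminorm p -> p 0 = 0.
Proof. by move=> ps; rewrite -(scale0r 0) seminormZ// normr0 mul0r. Qed.

Lemma seminormN : seminorm p -> forall x, p (- x) = p x.
Proof. by move=> ps x; rewrite -scaleN1r seminormZ// normrN1 mul1r. Qed.

Lemma seminorm_ge0 : seminorm p -> forall x, 0 <= p x.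
Proof.
move=> ps x; have := seminormD ps x (- x).
by rewrite subrr seminorm0// seminormN// -mulr2n pmulrn_lge0.
Qed.

End basics.

Variables (V W : lmodType R) (p : V -> R) (i : W -> V) (u : W -> R).
Hypotheses (ps : seminorm p) (il : lin i) (ul : linform u).
Hypothesis up : forall w, u w <= p (i w).

(** Partial extensions of u are linear relations rather than functions on a
subspace: domination by p already makes them single-valued. *)
Let good (A : set (V * R)) :=
  [/\ forall w, A (i w, u w),
      forall a x y, A x -> A y -> A (a *: x.1 + y.1, a * x.2 + y.2)
    & forall x, A x -> x.2 <= p x.1].

(** The one-dimensional step: the supremum of the lower bounds that the elements of
A impose on the value at v is compatible with the upper bounds, by the triangle
inequality. *)
Let ext1 A v : good A -> exists t, forall x l, A x -> x.2 + l * t <= p (x.1 + l *: v).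
Proof.
move=> [AG Alin Ap].
have A0 : A (0, 0) by have := AG 0; rewrite lin0// linform0.
have AZ c x : A x -> A (c *: x.1, c * x.2).
  by move=> Ax; have := Alin c _ _ Ax A0; rewrite /= !addr0.
have key x y : A x -> A y -> x.2 - p (x.1 - v) <= p (y.1 + v) - y.2.
  move=> Ax Ay; rewrite lerBrDr addrAC lerBlDr.
  have := Ap _ (Alin 1 _ _ Ax Ay); rewrite /= scale1r mul1r => /le_trans; apply.
  have -> : x.1 + y.1 = (x.1 - v) + (y.1 + v) by rewrite addrACA addNr addr0.
  by rewrite [leRHS]addrC; exact: (seminormD ps).
pose B := [set x.2 - p (x.1 - v) | x in A].
have B0 : B !=set0 by exists (0 - p (0 - v)), (0, 0).
have Bub y : A y -> ubound B (p (y.1 + v) - y.2).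
  by move=> Ay _ [x Ax <-]; exact: key.
have Bs : has_sup B by split=> //; exists (p (0 + v) - 0); exact: (Bub (0, 0)).
exists (sup B) => x l Ax.
have [->|l0] := eqVneq l 0; first by rewrite mul0r scale0r !addr0 Ap.
have AlZ := AZ l^-1 _ Ax.
have [lp|ln] := ltrP 0 l.
  have -> : p (x.1 + l *: v) = l * p (l^-1 *: x.1 + v).
    rewrite -{2}(gtr0_norm lp) -(seminormZ ps) scalerDr scalerA divff//.
    by rewrite scale1r.
  have := ge_sup B0 (Bub _ AlZ); rewrite /= -(ler_pM2l lp) mulrBr mulrA.
  by rewrite divff// mul1r lerBrDl.
have {}ln : l < 0 by rewrite lt_neqAle l0.
have AlN := AZ (- l^-1) _ Ax.
have : - l^-1 * x.2 - p (- l^-1 *: x.1 - v) <= sup B.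
  by apply: (sup_upper_bound Bs); exists (- l^-1 *: x.1, - l^-1 * x.2).
have -> : p (x.1 + l *: v) = - l * p (- l^-1 *: x.1 - v).
  rewrite -(ltr0_norm ln) -(seminormZ ps) scalerBr scalerA mulrN divff//.
  by rewrite scaleN1r -(seminormN ps) opprD.
have ln' : 0 < - l by rewrite oppr_gt0.
rewrite -(ler_pM2l ln') mulrBr mulrA mulrNN divff// mul1r.
by rewrite lerBlDr mulNr -lerBlDl opprK.
Qed.

Lemma hahn_banach : exists f : V -> R,
  [/\ linform f, forall x, f x <= p x & forall w, f (i w) = u w].
Proof.
(* The empty set is admitted only because it is the union of the empty chain. *)
pose P (A : set (V * R)) := A = set0 \/ good A.
have [F FP Ftot|A [PA Amax]] := @Zorn_bigcup _ P.
  have [F0|/existsNP[A0 /not_implyP[FA0 A0n]]] :=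
      pselect (forall A, F A -> A = set0).
    by left; rewrite -subset0 => x [A FA Ax]; rewrite -(F0 A FA).
  have gd A x : F A -> A x -> good A.
    by move=> /FP[->//|].
  right; have [//|gA0] := FP _ FA0; split.
  - by move=> w; exists A0 => //; case: gA0.
  - move=> a x y [A FA Ax] [B FB By].
    have [AB|BA] := Ftot _ _ FA FB.
      by exists B => //; have [_ + _] := gd _ _ FB By; apply=> //; exact: AB.
    by exists A => //; have [_ + _] := gd _ _ FA Ax; apply=> //; exact: BA.
  - by move=> x [A FA Ax]; have [_ _] := gd _ _ FA Ax; apply.
have gG : good [set x | exists w, x = (i w, u w)].
  split=> [w|a _ _ [x ->] [y ->]|_ [w ->]/=]; last exact: up.
    by exists w.
  by exists (a *: x + y); rewrite /= il ul.
have {PA} gA : good A.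
  case: PA => // A0; exfalso; apply: (Amax [set x | exists w, x = (i w, u w)]).
    split; last by rewrite A0 => /(_ (i 0, u 0)); apply; exists 0.
    by rewrite A0.
  by right.
have [AG Alin Ap] := gA.
have A0 : A (0, 0) by have := AG 0; rewrite lin0// linform0.
have Afun v r s : A (v, r) -> A (v, s) -> r = s.
  move=> Ar As; have le a b : A (v, a) -> A (v, b) -> a <= b.
    move=> Aa Ab; have := Ap _ (Alin (-1) _ _ Ab Aa).
    by rewrite /= scaleN1r addNr seminorm0// mulN1r addrC subr_le0.
  by apply/eqP; rewrite eq_le !le.
have Atot v : exists r, A (v, r).
  apply: contrapT => /forallNP nA; have [t tP] := ext1 v gA.
  pose B := [set z | exists x l, A x /\ z = (x.1 + l *: v, x.2 + l * t)].
  apply: (Amax B).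
    split; last first.
      move=> /(_ (v, t))BA; apply: (nA t); apply: BA.
      by exists (0, 0), 1; split=> //; rewrite /= !add0r scale1r mul1r.
    move=> [x r] Ax; exists (x, r), 0; split=> //.
    by rewrite /= scale0r mul0r !addr0.
  right; split.
  - move=> w; exists (i w, u w), 0; split=> //.
    by rewrite /= scale0r mul0r !addr0.
  - move=> a _ _ [x [l [Ax ->]]] [y [m [Ay ->]]].
    exists (a *: x.1 + y.1, a * x.2 + y.2), (a * l + m); split; first exact: Alin.
    congr pair; first by rewrite /= scalerDr scalerA scalerDl addrACA.
    by rewrite /= mulrDr mulrA mulrDl addrACA.
  - by move=> _ [x [l [Ax ->]]]; exact: tP.
pose f v := sval (cid (Atot v)).
have fA v : A (v, f v) by exact: (svalP (cid (Atot v))).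
exists f; split=> [a x y|x|w]; [|exact: Ap (fA x)|exact: Afun (fA _) (AG w)].
apply: Afun (fA _) _; exact: Alin (fA x) (fA y).
Qed.

End HahnBanach.

Section NormingFunctional.
Context (R : realType).

Definition dualball (V : lmodType R) (p : V -> R) : Type :=
  {f : V -> R | linform f /\ forall x, `|f x| <= p x}.

Lemma linform_le_norm (V : lmodType R) (p f : V -> R) : seminorm p ->
  linform f -> (forall x, f x <= p x) -> forall x, `|f x| <= p x.
Proof.
move=> ps fl fp x; rewrite ler_norml fp andbT lerNl -(seminormN ps).
by rewrite -mulN1r -(linformZ fl) scaleN1r fp.
Qed.

Lemma extend_functional (V W : lmodType R) (p : V -> R) (i : W -> V)
    (u : W -> R) : seminorm p -> lin i -> linform u ->
  (forall w, u w <= p (i w)) ->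
  exists f : dualball p, forall w, sval f (i w) = u w.
Proof.
move=> ps il ul up; have [f [fl fp fu]] := hahn_banach ps il ul up.
by exists (exist _ f (conj fl (linform_le_norm ps fl fp))).
Qed.

(** Hahn-Banach applied to the line through v. *)
Lemma norming_functional (V : lmodType R) (p : V -> R) (v : V) : seminorm p ->
  exists f : dualball p, sval f v = p v.
Proof.
move=> ps; have [|||f fE] := @extend_functional V R^o p (fun c => c *: v)
    (fun c => c * p v) ps.
- by move=> a x y; rewrite scalerDl scalerA.
- by move=> a x y; rewrite mulrDl mulrA.
- move=> w; rewrite seminormZ//; apply: ler_wpM2r; last exact: ler_norm.
  exact: seminorm_ge0.
by exists f; have := fE 1; rewrite scale1r mul1r.
Qed.

End NormingFunctional.

(** * Building Banach spaces *)

Section BanachSpaces.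
Context (R : realType).
Implicit Types E F : completeNormedModType R.

Section mkBanach.
Variables (V : lmodType R) (nrm : V -> R).
Hypotheses (nrms : seminorm nrm) (nrm0 : forall x, nrm x = 0 -> x = 0).
Hypothesis nrm_complete : forall F : set_system V, ProperFilter F ->
  (forall e, 0 < e -> exists x, F [set y | nrm (x - y) < e]) ->
  exists l, forall e, 0 < e -> F [set y | nrm (l - y) < e].

Definition mk_normed : normedModType R :=
  HB.pack (V : Type) (GRing.Lmodule.class V)
    (Lmodule_isNormed.Build R V (seminormD nrms) (seminormZ nrms) nrm0).

Lemma mk_normed_complete (F : set_system mk_normed) :
  ProperFilter F -> cauchy F -> cvg F.
Proof.
move=> FF /cauchyP Fc; have [|l Fl] := @nrm_complete F FF.
  move=> e e0; have [x Fx] := Fc _ e0; exists x.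
  by apply: filterS Fx => y; rewrite -ball_normE.
apply/cvg_ex; exists l; apply/cvg_ballP => e e0.
by apply: filterS (Fl _ e0) => y; rewrite -ball_normE.
Qed.

Definition mk_banach : completeNormedModType R :=
  HB.pack (mk_normed : Type) (NormedModule.class mk_normed)
    (Uniform_isComplete.Build mk_normed mk_normed_complete).

End mkBanach.

Section linf.
Variable X : Type.

Definition bounded_fct : {pred X -> R^o} :=
  [pred f | `[< exists B, forall x, `|f x| <= B >]].

Lemma bounded_fct_submod : submod_closed bounded_fct.
Proof.
split; first by apply/asboolP; exists 0 => x; rewrite normr0.
move=> a f g /asboolP[B fB] /asboolP[C gC]; apply/asboolP.
exists (`|a| * B + C) => x; rewrite (le_trans (ler_normD _ _))// lerD//.
by rewrite normrM ler_wpM2l.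
Qed.

HB.instance Definition _ :=
  GRing.isSubmodClosed.Build R (X -> R^o) bounded_fct bounded_fct_submod.

Record linf_fct := LinfFct { linf_val :> X -> R^o; _ : linf_val \in bounded_fct }.

HB.instance Definition _ := [isSub for linf_val].
HB.instance Definition _ := [Choice of linf_fct by <:].
HB.instance Definition _ := [SubChoice_isSubLmodule of linf_fct by <:].

(** Adjoining 0 gives the supremum its intended value when X is empty. *)
Definition sup_norm (f : linf_fct) : R := sup (range (fun x => `|f x|) `|` [set 0]).

Lemma sup_norm_ub (f : linf_fct) x : `|f x| <= sup_norm f.
Proof.
apply: sup_upper_bound; last by left; exists x.
split; first by exists 0; right.
have /asboolP[B fB] := valP f; exists (Num.max B 0) => _ [[y _ <-]|->].
  by rewrite le_max fB.
by rewrite le_max lexx orbT.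
Qed.

Lemma sup_norm_le (f : linf_fct) B : 0 <= B -> (forall x, `|f x| <= B) ->
  sup_norm f <= B.
Proof.
move=> B0 fB; apply: ge_sup; first by exists 0; right.
by move=> _ [[x _ <-]|->].
Qed.

Lemma sup_norm_ge0 f : 0 <= sup_norm f.
Proof.
apply: sup_upper_bound; last by right.
split; first by exists 0; right.
have /asboolP[B fB] := valP f; exists (Num.max B 0) => _ [[y _ <-]|->].
  by rewrite le_max fB.
by rewrite le_max lexx orbT.
Qed.

Lemma sup_norm_seminorm : seminorm sup_norm.
Proof.
apply: seminorm_of_le => [f g|c f].
  apply: sup_norm_le => [|x]; first by rewrite addr_ge0 ?sup_norm_ge0.
  by rewrite (le_trans (ler_normD _ _))// lerD// sup_norm_ub.
apply: sup_norm_le => [|x]; first by rewrite mulr_ge0 ?sup_norm_ge0.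
by rewrite normrM ler_wpM2l// sup_norm_ub.
Qed.

Lemma sup_norm_eq0 f : sup_norm f = 0 -> f = 0.
Proof.
move=> f0; apply/val_inj/funext => x /=; apply/eqP; rewrite -normr_le0 -f0.
exact: sup_norm_ub.
Qed.

(** The limit is pointwise, and the uniform estimate survives pointwise limits. *)
Lemma sup_norm_complete (F : set_system linf_fct) : ProperFilter F ->
  (forall e, 0 < e -> exists f, F [set g | sup_norm (f - g) < e]) ->
  exists l, forall e, 0 < e -> F [set g | sup_norm (l - g) < e].
Proof.
move=> FF Fc.
have Fcx x : cvg ((fun g : linf_fct => g x) @ F).
  apply/cauchy_cvgP/cauchy_exP => e e0; have [f Ff] := Fc _ e0.
  exists (f x); apply: (@filterS _ F _ _ _ _ Ff) => g /=.
  rewrite -ball_normE /=; exact: le_lt_trans (sup_norm_ub (f - g) x).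
pose l x : R := lim ((fun g : linf_fct => g x) @ F).
have lP f e : F [set g | sup_norm (f - g) < e] -> forall x, `|f x - l x| <= e.
  move=> Ff x; apply: (@closed_cvg _ _ F FF (fun g : linf_fct => g x) (fun y : R => `|f x - y| <= e) _ _ _ (Fcx x)).
    exact: (@closed_closed_ball_ R R^o (f x) e).
  apply: filterS Ff => g /= fg; apply: le_trans (ltW fg).
  exact: (sup_norm_ub (f - g) x).
have lb : l \in bounded_fct.
  have [f Ff] := Fc 1 ltr01; apply/asboolP; exists (sup_norm f + 1) => x.
  rewrite -[l x](subKr (f x)) (le_trans (ler_normB _ _))// lerD ?sup_norm_ub//.
  exact: lP.
exists (LinfFct lb) => e e0; have e20 : 0 < e / 4 by rewrite divr_gt0.
have [f Ff] := Fc _ e20; apply: filterS (Ff) => g /= fg.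
suff le : sup_norm (LinfFct lb - g) <= e / 4 + e / 4.
  by apply: le_lt_trans le _; rewrite -mulrDl; lra.
apply: sup_norm_le => [|x]; first by rewrite addr_ge0 ?ltW.
rewrite -[X in `|X|]/(l x - g x).
have -> : l x - g x = - (f x - l x) + (f x - g x) by rewrite opprB addrA subrK.
rewrite (le_trans (ler_normD _ _))// normrN lerD ?lP//.
exact: le_trans (sup_norm_ub (f - g) x) (ltW fg).
Qed.

Definition linf : completeNormedModType R :=
  mk_banach sup_norm_seminorm sup_norm_eq0 sup_norm_complete.

End linf.

Section closed_subspace.
Variables (E : completeNormedModType R) (S : set E).
Hypothesis Slin : forall a x y, S x -> S y -> S (a *: x + y).
Hypothesis S0 : S 0.
Hypothesis Sclosed : forall x, (forall e, 0 < e -> exists2 y, S y & `|x - y| < e) -> S x.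

Let Spred : {pred E} := [pred x | `[< S x >]].

Let Ssubmod : submod_closed Spred.
Proof.
split; first exact/asboolP.
by move=> a x y /asboolP Sx /asboolP Sy; apply/asboolP/Slin.
Qed.

HB.instance Definition _ :=
  GRing.isSubmodClosed.Build R E Spred Ssubmod.

Record csub := Csub { csub_val : E; csub_pf : csub_val \in Spred }.

HB.instance Definition _ := [isSub for csub_val].
HB.instance Definition _ := [Choice of csub by <:].
HB.instance Definition _ := [SubChoice_isSubLmodule of csub by <:].

Let nrm (x : csub) := `|csub_val x|.

Let nrm_seminorm : seminorm nrm.
Proof. by split=> [x y|c x]; rewrite /nrm ?ler_normD ?normrZ. Qed.

Let nrm_eq0 x : nrm x = 0 -> x = 0.
Proof. by move=> /normr0_eq0 x0; apply: val_inj. Qed.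

Let nrm_complete (F : set_system csub) : ProperFilter F ->
  (forall e, 0 < e -> exists f, F [set g | nrm (f - g) < e]) ->
  exists l, forall e, 0 < e -> F [set g | nrm (l - g) < e].
Proof.
move=> FF Fc.
have : cvg (csub_val @ F).
  apply/cauchy_cvgP/cauchy_exP => e e0; have [f Ff] := Fc _ e0.
  exists (csub_val f); apply: (@filterS _ F _ _ _ _ Ff) => g.
  by rewrite -ball_normE.
move=> /cvg_ex[l /cvg_ballP Fl].
have Sl : l \in Spred.
  apply/asboolP/Sclosed => e e0.
  have [x] := filter_ex (Fl _ e0); rewrite -ball_normE => lx.
  by exists (csub_val x) => //; exact/asboolP/(csub_pf x).
exists (Csub Sl) => e e0.
by apply: (@filterS _ F _ _ _ _ (Fl _ e0)) => g; rewrite -ball_normE.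
Qed.

(** A subspace is replaced by an isometric embedding with that range, which keeps
all spaces in the form of types. *)
Lemma closed_subspace : exists (W : completeNormedModType R) (i : W -> E),
  [/\ lin i, forall x, `|i x| = `|x| & range i = S].
Proof.
exists (mk_banach nrm_seminorm nrm_eq0 nrm_complete), csub_val; split=> //.
apply/seteqP; split=> [_ [x _ <-]|x Sx]; first exact/asboolP/(csub_pf x).
by exists (Csub (asboolT Sx)).
Qed.

End closed_subspace.

End BanachSpaces.

(** * Comparison of tuples and amalgamation *)

Section TypeCloseness.
Context (R : realType).
Implicit Types E F G : completeNormedModType R.

Definition isom E F (f : E -> F) := lin f /\ forall x, `|f x| = `|x|.

(** The tuples a and c, living in possibly different spaces, have quantifier-free
types at distance at most d; by [amalgam] this is exactly the distance at which
they can be placed in a common extension. *)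
Definition tpclose (J : finType) (d : R) E F (a : J -> E) (c : J -> F) :=
  forall l : J -> R,
    `| `|\sum_j l j *: a j| - `|\sum_j l j *: c j| | <= d * \sum_j `|l j|.

Lemma isomB E F (f : E -> F) x y : isom f -> `|f x - f y| = `|x - y|.
Proof. by move=> [fl fi]; rewrite -linB. Qed.

Lemma isom_comb E F (f : E -> F) (J : finType) (l : J -> R) (a : J -> E) :
  isom f -> `|\sum_j l j *: f (a j)| = `|\sum_j l j *: a j|.
Proof. by move=> [fl fi]; rewrite -lin_sum. Qed.

Section tpclose.
Variable J : finType.

Lemma sum_norm_ge0 (l : J -> R) : 0 <= \sum_j `|l j|.
Proof. by apply: sumr_ge0. Qed.

Lemma tpclose_sym d E F (a : J -> E) (c : J -> F) :
  tpclose d a c -> tpclose d c a.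
Proof. by move=> ac l; rewrite distrC. Qed.

Lemma tpclose_trans d d' E F G (a : J -> E) (b : J -> F) (c : J -> G) :
  tpclose d a b -> tpclose d' b c -> tpclose (d + d') a c.
Proof.
move=> ab bc l; rewrite mulrDl (le_trans _ (lerD (ab l) (bc l)))//.
exact: ler_distD.
Qed.

Lemma tpclose_le d d' E F (a : J -> E) (c : J -> F) :
  d <= d' -> tpclose d a c -> tpclose d' a c.
Proof.
by move=> dd' ac l; rewrite (le_trans (ac l))// ler_wpM2r// sum_norm_ge0.
Qed.

Lemma tpclose_isom E F (f : E -> F) (a : J -> E) : isom f ->
  tpclose 0 a (f \o a).
Proof. by move=> fi l; rewrite isom_comb// subrr normr0 mul0r. Qed.

Lemma comb_le E (l : J -> R) (a : J -> E) B : (forall j, `|a j| <= B) ->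
  `|\sum_j l j *: a j| <= B * \sum_j `|l j|.
Proof.
move=> aB; rewrite (le_trans (ler_norm_sum _ _ _))// mulr_sumr ler_sum// => j _.
by rewrite normrZ mulrC ler_wpM2r.
Qed.

Lemma combB E (l : J -> R) (a b : J -> E) :
  \sum_j l j *: a j - \sum_j l j *: b j = \sum_j l j *: (a j - b j).
Proof. by rewrite -sumrB; apply: eq_bigr => j _; rewrite scalerBr. Qed.

Lemma tpclose_near d E (a b : J -> E) : (forall j, `|a j - b j| <= d) ->
  tpclose d a b.
Proof.
move=> ab l; rewrite (le_trans (ler_dist_dist _ _))// combB.
exact: comb_le.
Qed.

Lemma tpclose_scale s d E F (a : J -> E) (c : J -> F) : 0 < s ->
  tpclose (s * d) (fun j => s *: a j) (fun j => s *: c j) -> tpclose d a c.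
Proof.
move=> s0 ac l; rewrite -(ler_pM2l s0) mulrA (le_trans _ (ac l))//.
have sE E' (b : J -> E') : `|\sum_j l j *: (s *: b j)| = s * `|\sum_j l j *: b j|.
  rewrite -{2}(gtr0_norm s0) -normrZ scaler_sumr; congr `|_|.
  by apply: eq_bigr => j _; rewrite !scalerA mulrC.
by rewrite !sE -mulrBr normrM (gtr0_norm s0).
Qed.

Lemma comb1 E (a : J -> E) j : \sum_i (i == j)%:R *: a i = a j.
Proof.
rewrite (bigD1 j)//= eqxx scale1r big1 ?addr0// => i /negPf->.
by rewrite scale0r.
Qed.

Lemma tpclose_norm d E F (a : J -> E) (c : J -> F) j :
  tpclose d a c -> `| `|a j| - `|c j| | <= d.
Proof.
move=> /(_ (fun i => (i == j)%:R)); rewrite !comb1 => /le_trans; apply.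
rewrite (bigD1 j)//= eqxx normr1 big1 ?addr0 ?mulr1// => i /negPf->.
by rewrite normr0.
Qed.

Lemma tpclose_dist d E F (a : J -> E) (c : J -> F) i j : 0 <= d ->
  tpclose d a c -> `| `|a i - a j| - `|c i - c j| | <= d + d.
Proof.
move=> d0 /(_ (fun k => (k == i)%:R - (k == j)%:R)).
have sE E' (b : J -> E') :
    \sum_k ((k == i)%:R - (k == j)%:R) *: b k = b i - b j :> E'.
  rewrite -[b i]comb1 -[b j]comb1 -sumrB; apply: eq_bigr => k _.
  by rewrite scalerBl.
rewrite !sE => /le_trans; apply.
have -> : d + d = d * 2%:R by rewrite mulr_natr mulr2n.
rewrite ler_wpM2l//.
have dE k : \sum_i `|(i == k)%:R : R| = 1.
  rewrite (bigD1 k)//= eqxx normr1 big1 ?addr0// => m /negPf->.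
  by rewrite normr0.
rewrite (_ : 2%:R = \sum_k (`|(k == i)%:R : R| + `|(k == j)%:R : R|)).
  by rewrite ler_sum// => k _; rewrite ler_normB.
by rewrite big_split/= !dE.
Qed.

End tpclose.

Lemma comb_pull (J K : finType) (f : K -> J) E (a : J -> E) (l : K -> R) :
  \sum_k l k *: a (f k) = \sum_j (\sum_(k | f k == j) l k) *: a j.
Proof.
under [RHS]eq_bigr do rewrite scaler_suml.
rewrite (exchange_big_dep predT)//=; apply: eq_bigr => k _.
by rewrite (big_pred1 (f k)).
Qed.

Lemma tpclose_pull (J K : finType) (f : K -> J) d E F (a : J -> E)
    (c : J -> F) : 0 <= d -> tpclose d a c -> tpclose d (a \o f) (c \o f).
Proof.
move=> d0 ac l; rewrite (comb_pull f a) (comb_pull f c) (le_trans (ac _))// ler_wpM2l//.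
have -> : \sum_k `|l k| = \sum_j \sum_(k | f k == j) `|l k|.
  rewrite (exchange_big_dep predT)//=; apply: eq_bigr => k _.
  by rewrite (big_pred1 (f k)).
by rewrite ler_sum// => j _; rewrite ler_norm_sum.
Qed.

Lemma sum_option (J : finType) (V : nmodType) (F : option J -> V) :
  \sum_j F j = F None + \sum_j F (Some j).
Proof.
rewrite (bigD1 None)//=; congr (_ + _).
rewrite (reindex_omap Some id)//=; last by case.
by apply: eq_bigl => j; rewrite eqxx.
Qed.

End TypeCloseness.

Section Realization.
Context (R : realType).

Section seminorm_realization.
Variables (V : lmodType R) (p : V -> R).
Hypothesis ps : seminorm p.

Lemma dual_eval_bounded (v : V) :
  (fun f : dualball p => sval f v : R^o) \in @bounded_fct R (dualball p).
Proof. by apply/asboolP; exists (p v) => f; exact: (proj2 (svalP f)). Qed.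

Definition dual_eval (v : V) : linf R (dualball p) := LinfFct (dual_eval_bounded v).

Lemma dual_eval_lin : lin dual_eval.
Proof.
by move=> a x y; apply/val_inj/funext => f; exact: (proj1 (svalP f)).
Qed.

Lemma dual_eval_norm v : `|dual_eval v| = p v.
Proof.
apply/eqP; rewrite eq_le; apply/andP; split.
  by apply: sup_norm_le => [|f]; [exact: seminorm_ge0|exact: (proj2 (svalP f))].
have [f fv] := norming_functional v ps.
rewrite -fv (le_trans (ler_norm _))//.
exact: (sup_norm_ub (dual_eval v : linf_fct _ _) f).
Qed.

End seminorm_realization.

(** Each vector acts on the functionals dominated by p; enough of them exist for
the supremum norm of this action to be p. *)
Lemma seminorm_realization (V : lmodType R) (p : V -> R) : seminorm p ->
  exists (W : completeNormedModType R) (f : V -> W),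
    lin f /\ forall v, `|f v| = p v.
Proof.
move=> ps; exists (linf R (dualball p)), (@dual_eval V p); split.
  exact: dual_eval_lin.
exact: dual_eval_norm.
Qed.

(** The semi-norm of a quotient. *)
Lemma inf_seminorm (V L : lmodType R) (h : V * L -> R) : seminorm h ->
  seminorm (fun v => inf (range (fun l => h (v, l)))).
Proof.
move=> hs; have h0 v : has_inf (range (fun l => h (v, l))).
  split; first by exists (h (v, 0)), 0.
  by exists 0 => _ [l _ <-]; exact: seminorm_ge0.
have lb v l : inf (range (fun l => h (v, l))) <= h (v, l).
  by apply: ge_inf; [exact: (proj2 (h0 v))|exists l].
apply: seminorm_of_le => [x y|c x].
  pose N v := inf (range (fun l => h (v, l))).
  rewrite -!/(N _) leNgt; apply/negP => lt.
  have e0 : 0 < (N (x + y) - (N x + N y)) / 2 by rewrite divr_gt0// subr_gt0.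
  have [_ [l _ <-] hl] := inf_adherent e0 (h0 x).
  have [_ [m _ <-] hm] := inf_adherent e0 (h0 y).
  have := lb (x + y) (l + m); rewrite -/(N _).
  have -> : (x + y, l + m) = (x, l) + (y, m) by [].
  have := seminormD hs (x, l) (y, m); move: hl hm.
  by rewrite -!/(N _); lra.
have [->|c0] := eqVneq c 0.
  rewrite normr0 mul0r (le_trans (lb _ 0))// scale0r.
  by have := seminorm0 hs => ->.
rewrite -ler_pdivrMl ?normr_gt0//; apply: lb_le_inf.
  by exists (h (x, 0)), 0.
move=> _ [l _ <-]; rewrite ler_pdivrMl ?normr_gt0//.
by rewrite -(seminormZ hs) lb.
Qed.

(** The sum of E and F carries the largest semi-norm that extends both norms and
makes a j and c j lie at distance at most d: writing (x, y) through the relations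
(a j, - c j) with coefficients - l j costs d times the sum of the |l j|, and the
infimum over l of the total cost is taken.  The hypothesis says that passing
through the relations never shortens a vector of E or of F. *)
Lemma amalgam (E F : completeNormedModType R) (J : finType) (d : R)
    (a : J -> E) (c : J -> F) : 0 <= d -> tpclose d a c ->
  exists (W : completeNormedModType R) (i : E -> W) (k : F -> W),
    [/\ isom i, isom k & forall j, `|i (a j) - k (c j)| <= d].
Proof.
move=> d0 ac.
pose L : lmodType R := J -> R^o.
pose V : lmodType R := (E * F)%type.
pose h (z : V * L) : R := `|z.1.1 + \sum_j z.2 j *: a j| +
  d * \sum_j `|z.2 j| + `|z.1.2 - \sum_j z.2 j *: c j|.
have sD (G : lmodType R) (b : J -> G) (l m : L) :
    \sum_j (l + m) j *: b j = \sum_j l j *: b j + \sum_j m j *: b j.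
  by rewrite -big_split; apply: eq_bigr => j _; exact: scalerDl.
have sZ (G : lmodType R) (b : J -> G) t (l : L) :
    \sum_j (t *: l) j *: b j = t *: \sum_j l j *: b j.
  by rewrite scaler_sumr; apply: eq_bigr => j _; rewrite scalerA.
have hs : seminorm h.
  split=> [[[x y] l] [[x' y'] l']|t [[x y] l]]; rewrite /h /=.
    rewrite !sD opprD addrACA [y + y' + _]addrACA.
    have A := ler_normD (x + \sum_j l j *: a j) (x' + \sum_j l' j *: a j).
    have B := ler_normD (y - \sum_j l j *: c j) (y' - \sum_j l' j *: c j).
    have C : d * \sum_j `|(l + l') j| <=
             d * \sum_j `|l j| + d * \sum_j `|l' j|.
      rewrite -mulrDr -big_split ler_wpM2l// ler_sum// => j _.
      exact: ler_normD.
    by lra.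
  rewrite !sZ -scalerDr -scalerBr !normrZ.
  have -> : \sum_j `|(t *: l) j| = `|t| * \sum_j `|l j|.
    by rewrite mulr_sumr; apply: eq_bigr => j _; rewrite normrM.
  by rewrite mulrCA !mulrDr.
have := inf_seminorm hs; set N := fun v => _ => Ns.
have Nle v l : N v <= h (v, l).
  apply: ge_inf; last by exists l.
  by exists 0 => _ [m _ <-]; exact: seminorm_ge0.
have Nge v b : (forall l, b <= h (v, l)) -> b <= N v.
  move=> vb; apply: lb_le_inf; first by exists (h (v, 0)), 0.
  by move=> _ [l _ <-].
have c0 (G : lmodType R) (b : J -> G) : \sum_j (0 : L) j *: b j = 0.
  by rewrite big1// => j _; rewrite scale0r.
have n0 : \sum_j `|(0 : L) j| = 0 by rewrite big1// => j _; rewrite normr0.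
have [W [f [fl fN]]] := seminorm_realization Ns.
exists W, (fun x => f (x, 0)), (fun y => f (0, y)); split.
- split=> [t x y|x]; first by rewrite -fl; congr f; rewrite /= -[0 in LHS](addr0 0) -{1}(scaler0 _ t).
  rewrite fN; apply/eqP; rewrite eq_le; apply/andP; split.
    rewrite (le_trans (Nle _ 0))// /h /= !c0 n0 addr0 subr0 normr0 mulr0.
    by rewrite !addr0.
  apply: Nge => l; rewrite /h /= sub0r normrN.
  have := ler_normB (x + \sum_j l j *: a j) (\sum_j l j *: a j).
  rewrite addrK; have := ac l; rewrite ler_norml => /andP[_].
  by lra.
- split=> [t x y|y]; first by rewrite -fl; congr f; rewrite /= -[0 in LHS](addr0 0) -{1}(scaler0 _ t).
  rewrite fN; apply/eqP; rewrite eq_le; apply/andP; split.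
    rewrite (le_trans (Nle _ 0))// /h /= !c0 n0 addr0 subr0 normr0 mulr0.
    by rewrite !add0r.
  apply: Nge => l; rewrite /h /= add0r.
  have := ler_normD (y - \sum_j l j *: c j) (\sum_j l j *: c j).
  rewrite subrK; have := ac l; rewrite ler_norml => /andP[+ _].
  by lra.
- move=> j; rewrite -linB// fN.
  pose l : L := fun i => - (i == j)%:R.
  have lE (G : lmodType R) (b : J -> G) : \sum_i l i *: b i = - b j.
    rewrite (bigD1 j)//= /l eqxx scaleN1r big1 ?addr0// => i /negPf->.
    by rewrite oppr0 scale0r.
  rewrite (le_trans (Nle _ l))// /h /= !lE.
  rewrite subr0 subrr sub0r opprK addNr !normr0 add0r addr0.
  rewrite (bigD1 j)//= /l eqxx normrN1 big1 ?addr0 ?mulr1// => i /negPf->.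
  by rewrite oppr0 normr0.
Qed.

End Realization.

(** * Construction of Gurarij spaces *)

Section OnePointExtensions.
Context (R : realType).
Implicit Types E F : completeNormedModType R.

Definition unit_functional E : Type := dualball (fun x : E => `|x|).

(** The space E embeds by x |-> ((f, t) |-> f x).  The real coordinate t is a
possible value, at a new point, of an extension of the functional f. *)
Definition ext_space E : completeNormedModType R :=
  linf R (unit_functional E * R).

Lemma norm_seminorm E : seminorm (fun x : E => `|x|).
Proof. by split; [exact: ler_normD|exact: normrZ]. Qed.

Lemma ext_emb_bounded E (x : E) :
  (fun z : unit_functional E * R => sval z.1 x : R^o)
    \in @bounded_fct R (unit_functional E * R).
Proof. by apply/asboolP; exists `|x| => z; exact: (proj2 (svalP z.1)). Qed.

Definition ext_emb E (x : E) : ext_space E := LinfFct (ext_emb_bounded x).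

Lemma ext_emb_isom E : isom (@ext_emb E).
Proof.
split=> [a x y|x].
  by apply/val_inj/funext => z; exact: (proj1 (svalP z.1)).
apply/eqP; rewrite eq_le; apply/andP; split.
  by apply: sup_norm_le => // z; exact: (proj2 (svalP z.1)).
have [f fx] := norming_functional x (norm_seminorm E).
rewrite -[leLHS]fx (le_trans (ler_norm _))//.
exact: (sup_norm_ub (ext_emb x : linf_fct _ _) (f, 0)).
Qed.

(** In the dual picture the extension of E by a point z is the set of pairs (f, t)
such that the functional equal to f on E and to t at z has norm at most 1.  The new
point b is the coordinate t on this set; elsewhere its value is that of some
admissible pair with the same f, which does not change the norms. *)
Lemma ext_space_realizes E F (k : E -> F) (z : F) : isom k ->
  exists b : ext_space E, forall x (m : R),
    `|ext_emb x + m *: b| = `|k x + m *: z|.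
Proof.
move=> [kl ki]; pose V : lmodType R := (E * R^o)%type.
pose N (v : V) : R := `|k v.1 + v.2 *: z|.
have Ns : seminorm N.
  split=> [[x s] [y t]|c [x s]]; rewrite /N /=.
    by rewrite (linD kl) scalerDl addrACA ler_normD.
  by rewrite (linZ kl) -scalerA -scalerDr normrZ.
pose adm (f : unit_functional E) (t : R) :=
  forall x s, `|sval f x + s * t| <= N (x, s).
have adm_ex f : exists t, adm f t.
  have [|||g gf] := @extend_functional R V E N (fun x => (x, 0)) (sval f) Ns.
  - by move=> c x y; congr pair; rewrite /= scaler0 addr0.
  - exact: (proj1 (svalP f)).
  - move=> x; rewrite /N /= scale0r addr0 ki.
    exact: le_trans (ler_norm _) (proj2 (svalP f) x).
  exists (sval g (0, 1)) => x s; have [gl gN] := svalP g.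
  rewrite -gf -(linformZ gl) -(linformD gl) (le_trans (gN _))//.
  have -> : (x, 0) + s *: (0, 1) = (x, s) :> V.
    by congr pair; rewrite /= ?scaler0 ?addr0// add0r; exact: mulr1.
  by [].
pose t0 f := sval (cid (adm_ex f)).
pose bf (w : unit_functional E * R) : R^o :=
  if `[< adm w.1 w.2 >] then w.2 else t0 w.1.
have bfP w : adm w.1 (bf w).
  by rewrite /bf; case: asboolP => // _; exact: (svalP (cid (adm_ex w.1))).
have bfb : bf \in @bounded_fct R (unit_functional E * R).
  apply/asboolP; exists (N (0, 1)) => w.
  have := bfP w 0 1; have [fl _] := svalP w.1.
  by rewrite linform0// add0r mul1r.
exists (LinfFct bfb : ext_space E) => x m; rewrite -[RHS]/(N (x, m)).
apply/eqP; rewrite eq_le; apply/andP; split.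
  by apply: sup_norm_le => [|w]; [exact: seminorm_ge0|exact: bfP].
have [g gE] := norming_functional (x, m) Ns; have [gl gN] := svalP g.
pose f0 (y : E) := sval g (y, 0).
have f0P : linform f0 /\ forall y, `|f0 y| <= `|y|.
  split=> [c y y'|y]; last first.
    by rewrite (le_trans (gN _))// /N /= scale0r addr0 ki.
  rewrite /f0 -gl; congr (sval g (_, _)); by rewrite /= scaler0 addr0.
pose f : unit_functional E := exist _ f0 f0P.
pose w : R := sval g (0, 1).
have gD y s : sval g (y, s) = f0 y + s * w.
  rewrite /f0 /w -(linformZ gl) -(linformD gl); congr (sval g (_, _)).
    by rewrite /= scaler0 addr0.
  by rewrite /= add0r; exact/esym/mulr1.
have fw : adm f w by move=> y s; rewrite -[sval f y]/(f0 y) -gD gN.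
rewrite -gE (le_trans (ler_norm _))//.
have := sup_norm_ub (ext_emb x + m *: (LinfFct bfb : ext_space E) : linf_fct _ _) (f, w).
rewrite -[X in `|X| <= _ -> _]/(f0 x + m * bf (f, w)) /bf /= (asboolT fw).
by rewrite -gD.
Qed.

End OnePointExtensions.

Section ChainLimit.
Context (R : realType).

Definition coherent (E : nat -> completeNormedModType R)
    (i : forall n, E n -> E n.+1) (f : forall n, E n -> R) :=
  forall n, [/\ linform (f n), forall x, `|f n x| <= `|x|
              & forall x, f n.+1 (i n x) = f n x].

(** A norming functional at stage k is extended upwards by Hahn-Banach and restricted
downwards; induction on k shifts the chain so that k = 0. *)
Lemma coherent_norming k : forall (E : nat -> completeNormedModType R)
    (i : forall n, E n -> E n.+1), (forall n, isom (i n)) ->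
  forall x : E k, exists f, coherent i f /\ f k x = `|x|.
Proof.
elim: k => [|k IH] E i ii x.
  have ext n (u : unit_functional (E n)) : {v : unit_functional (E n.+1) |
      forall y, sval v (i n y) = sval u y}.
    apply: cid; apply: extend_functional.
    - exact: norm_seminorm.
    - by have [] := ii n.
    - by have [] := svalP u.
    - move=> y; have [_ ->] := ii n.
      exact: le_trans (ler_norm _) (proj2 (svalP u) y).
  have [u0 u0x] := norming_functional x (norm_seminorm (E 0%N)).
  pose u := nat_rect (fun n => unit_functional (E n)) u0
    (fun n un => sval (ext n un)).
  exists (fun n => sval (u n)); split=> // n; have [ul un] := svalP (u n).
  by split=> // y; exact: (svalP (ext n (u n))).
have [f [fc fx]] := IH (fun n => E n.+1) (fun n => i n.+1) (fun n => ii n.+1) x.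
exists (fun n => match n return E n -> R with
  | 0%N => fun y => f 0%N (i 0%N y) | m.+1 => f m end).
split=> // -[|n]; last exact: fc.
have [fl fn _] := fc 0%N; have [il in_] := ii 0%N; split=> //.
- by move=> a y z; rewrite il fl.
- by move=> y; rewrite (le_trans (fn _))// in_.
Qed.

(** The union is realized inside the bounded functions on coherent families of
functionals, where each stage embeds isometrically by [coherent_norming]. *)
Lemma chain_limit (E : nat -> completeNormedModType R)
    (i : forall n, E n -> E n.+1) : (forall n, isom (i n)) ->
  exists (G : completeNormedModType R) (g : forall n, E n -> G),
    [/\ forall n, isom (g n), forall n x, g n.+1 (i n x) = g n x
      & forall y e, 0 < e -> exists n x, `|y - g n x| < e].
Proof.
move=> ii; pose D : Type := {f | coherent i f}.
have hb n (x : E n) : (fun f : D => sval f n x : R^o) \in @bounded_fct R D.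
  by apply/asboolP; exists `|x| => f; have [_ + _] := svalP f n; exact.
pose h n (x : E n) : linf R D := LinfFct (hb n x).
have hi n : isom (h n).
  split=> [a x y|x].
    by apply/val_inj/funext => f; have [fl _ _] := svalP f n; exact: fl.
  apply/eqP; rewrite eq_le; apply/andP; split.
    by apply: sup_norm_le => // f; have [_ fn _] := svalP f n; exact: fn.
  have [f [fc fx]] := coherent_norming ii x.
  rewrite -fx (le_trans (ler_norm _))//.
  exact: (sup_norm_ub (h n x : linf_fct _ _) (exist _ f fc)).
have hS n (x : E n) : h n.+1 (i n x) = h n x.
  by apply/val_inj/funext => f; have [_ _ fi] := svalP f n; exact: fi.
have hD n m (x : E n) : exists x' : E (m + n)%N, h _ x' = h n x.
  elim: m => [|m [x' hx']]; first by exists x.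
  by exists (i _ x'); rewrite -hx'; exact: hS.
have hM n m (x : E n) (y : E m) :
    exists l (x' y' : E l), h l x' = h n x /\ h l y' = h m y.
  have [x' hx] := hD n m x; have [y' hy] := hD m n y.
  by exists (m + n)%N, x'; move: y' hy; rewrite addnC => y' hy; exists y'.
pose S : set (linf R D) :=
  [set y | forall e, 0 < e -> exists n x, `|y - h n x| < e].
have hSS n x : S (h n x) by move=> e e0; exists n, x; rewrite subrr normr0.
have [|||G [j [jl jn jS]]] := @closed_subspace R (linf R D) S.
- move=> a x y Sx Sy e e0.
  have e1 : 0 < e / 2 / (`|a| + 1) by rewrite !divr_gt0// ltr_wpDl.
  have e2 : 0 < e / 2 by rewrite divr_gt0.
  have [n [x' xx']] := Sx _ e1; have [m [y' yy']] := Sy _ e2.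
  have [l [u [v [hu hv]]]] := hM _ _ x' y'.
  exists l, (a *: u + v); have [hl _] := hi l; rewrite hl hu hv.
  rewrite opprD addrACA -scalerBr (le_lt_trans (ler_normD _ _))// (splitr e).
  rewrite ler_ltD// normrZ.
  rewrite (le_trans (_ : _ <= (`|a| + 1) * `|x - h n x'|)) ?ler_wpM2r ?lerDl//.
  by rewrite mulrC -ler_pdivlMr ?ltr_wpDl// ltW.
- by rewrite -(lin0 (proj1 (hi 0%N))).
- move=> x Sx e e0; have e2 : 0 < e / 2 by rewrite divr_gt0.
  have [y Sy xy] := Sx _ e2; have [n [z yz]] := Sy _ e2.
  exists n, z; rewrite (le_lt_trans (ler_distD y _ _))// (splitr e).
  exact: ltrD.
have hj n x : exists y, j y = h n x by have := hSS n x; rewrite -jS => -[y _ <-]; exists y.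
pose g n x := sval (cid (hj n x)).
have gE n x : j (g n x) = h n x by exact: (svalP (cid (hj n x))).
have jinj x y : j x = j y -> x = y.
  by move=> /eqP; rewrite -subr_eq0 -linB// -normr_eq0 jn normr_eq0 subr_eq0 => /eqP.
exists G, g; split.
- move=> n; have [hl hn] := hi n; split=> [a x y|x]; last by rewrite -jn gE.
  by apply: jinj; rewrite jl !gE.
- by move=> n x; apply: jinj; rewrite !gE.
- move=> y e e0; have : S (j y) by rewrite -jS; exists y.
  by move=> /(_ _ e0)[n [x yx]]; exists n, x; rewrite -jn linB// gE.
Qed.

End ChainLimit.

Section GurariiSpaces.
Context (R : realType).
Implicit Types E F G H : completeNormedModType R.

(** The case d = 0 implies the others ([gurarii_exact]); an initial error d is allowed
because the tuples met in a back-and-forth agree only approximately. *)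
Definition gurarii G := forall (J : finType) (a : J -> G) F (c : J -> F) (z : F)
    (d : R), 0 <= d -> tpclose d a c ->
  forall e, 0 < e -> exists b : G,
    tpclose (d + e) (oapp a b) (oapp c z).

Lemma comb_option E (J : finType) (l : option J -> R) (a : J -> E) (b : E) :
  \sum_j l j *: oapp a b j = \sum_j l (Some j) *: a j + l None *: b.
Proof. by rewrite sum_option /= addrC. Qed.

(** An inexact comparison becomes exact after amalgamating G with F: the tuple a is
compared with itself and c is moved onto a. *)
Lemma gurarii_exact G :
  (forall (J : finType) (a : J -> G) F (c : J -> F) (z : F), tpclose 0 a c ->
    forall e, 0 < e -> exists b : G, tpclose e (oapp a b) (oapp c z)) ->
  gurarii G.
Proof.
move=> G0 J a F c z d d0 ac e e0.
have [W [i [k [ii ki ik]]]] := amalgam d0 ac.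
have [b hb] := G0 J a W (i \o a) (k z) (tpclose_isom _ ii) e e0.
exists b; rewrite addrC; apply: tpclose_trans hb _.
rewrite -[d]addr0; apply: (@tpclose_trans _ _ _ _ _ _ _ _ (oapp (k \o c) (k z))).
  by apply: tpclose_near => -[j|] /=; rewrite ?subrr ?normr0// ik.
have -> : oapp (k \o c) (k z) = k \o oapp c z by apply/funext; case.
exact/tpclose_sym/tpclose_isom.
Qed.

(** The limit of the iterated extension spaces is Gurarij: a finite tuple is close to
one at a finite stage, whose one-point extensions are realized at the next stage. *)
Lemma gurarii_embedding E : exists G (i : E -> G), isom i /\ gurarii G.
Proof.
pose En := fix En n := if n is m.+1 then ext_space (En m) else E.
pose i n : En n -> En n.+1 := @ext_emb R (En n).
have ii n : isom (i n) by exact: ext_emb_isom.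
have [G [g [gi gS gd]]] := chain_limit ii.
exists G, (g 0%N); split; first exact: (gi 0%N).
have gD n m (x : En n) : exists x' : En (m + n)%N, g _ x' = g n x.
  elim: m => [|m [x' hx']]; first by exists x.
  by exists (i _ x'); rewrite -hx'; exact: gS.
apply: gurarii_exact => J a F c z ac e e0.
have e2 : 0 < e / 2 by rewrite divr_gt0.
have [N [a' aa']] : exists N (a' : J -> En N), forall j, `|a j - g N (a' j)| < e / 2.
  have /choice[n nP] j : exists n, exists x : En n, `|a j - g n x| < e / 2.
    exact: gd.
  pose N := \max_j n j; exists N.
  suff /choice[a' a'P] j : exists x : En N, `|a j - g N x| < e / 2 by exists a'.
  have [x ax] := nP j; have [x' x'E] := gD _ (N - n j)%N x.
  move: x' x'E; rewrite subnK ?(leq_bigmax j)// => x' x'E.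
  by exists x'; rewrite x'E.
have a'c : tpclose (e / 2) a' c.
  rewrite -[e / 2]addr0; apply: tpclose_trans ac.
  rewrite -[e / 2]add0r; apply: (@tpclose_trans _ _ _ _ _ _ _ _ (g N \o a')).
    exact: tpclose_isom.
  by apply: tpclose_near => j /=; rewrite distrC ltW.
have [W [h [k [hi ki hk]]]] := amalgam (ltW e2) a'c.
have [b hb] := ext_space_realizes (k z) hi.
exists (g N.+1 b).
have -> : e = e / 2 + ((0 + 0) + (e / 2 + 0)) by lra.
apply: (@tpclose_trans _ _ _ _ _ _ _ _ (oapp (g N \o a') (g N.+1 b))).
  by apply: tpclose_near => -[j|] /=; rewrite ?subrr ?normr0 ltW.
apply: (@tpclose_trans _ _ _ _ _ _ _ _ (oapp (h \o a') (k z))).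
  apply: (@tpclose_trans _ _ _ _ _ _ _ _ (oapp (i N \o a') b)).
    have -> : oapp (g N \o a') (g N.+1 b) = g N.+1 \o oapp (i N \o a') b.
      by apply/funext => -[j|] //=; rewrite gS.
    exact/tpclose_sym/tpclose_isom.
  move=> l; rewrite !comb_option -(lin_sum _ _ (proj1 (ii N))).
  by rewrite -(lin_sum _ _ (proj1 hi)) hb subrr normr0 mul0r.
apply: (@tpclose_trans _ _ _ _ _ _ _ _ (oapp (k \o c) (k z))).
  by apply: tpclose_near => -[j|] /=; rewrite ?hk// subrr normr0 ltW.
have -> : oapp (k \o c) (k z) = k \o oapp c z by apply/funext; case.
exact/tpclose_sym/tpclose_isom.
Qed.

End GurariiSpaces.

(** * Finite nets and extension of isometries by density *)

Section FiniteNets.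
Context (R : realType).
Implicit Types E F G H : completeNormedModType R.

Lemma comb_diff_le E (J : finType) (l m : J -> R) (a : J -> E) (r t : R) :
  (forall j, `|a j| <= r) -> (forall j, `|l j - m j| <= t) ->
  `| `|\sum_j l j *: a j| - `|\sum_j m j *: a j| | <= r * (t *+ #|J|).
Proof.
move=> ar lm; rewrite (le_trans (ler_dist_dist _ _))// -sumrB.
under eq_bigr do rewrite -scalerBl.
have [j0|noJ] := pickP J; last first.
  by rewrite big_pred0// normr0 eq_card0 ?mulr0n ?mulr0// => i; have := noJ i.
have r0 : 0 <= r by exact: le_trans (normr_ge0 _) (ar j0).
rewrite (le_trans (comb_le _ ar))// ler_wpM2l//.
by rewrite -sumr_const ler_sum.
Qed.

Lemma grid_approx (m : nat) (x : R) : (0 < m)%N -> `|x| <= 1 ->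
  exists k : 'I_(m + m).+1, `|x - (k%:R - m%:R) / m%:R| <= m%:R^-1.
Proof.
move=> m0 x1; have m0R : 0 < m%:R :> R by rewrite ltr0n.
have y0 : 0 <= (x + 1) * m%:R.
  by rewrite mulr_ge0 ?ler0n// -lerBlDr sub0r; move: x1; rewrite ler_norml => /andP[].
have [k0 k1] := andP (truncn_itv y0); set k := Num.truncn _ in k0 k1.
have km : (k < (m + m).+1)%N.
  rewrite ltnS -(ler_nat R) (le_trans k0)// natrD mulrDl mul1r lerD2r.
  by rewrite ler_piMl ?ler0n// (le_trans (ler_norm x)).
exists (Ordinal km) => /=.
have -> : x - (k%:R - m%:R) / m%:R = (x * m%:R - (k%:R - m%:R)) / m%:R.
  by rewrite [in RHS]mulrBl mulfK// gt_eqF.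
rewrite normrM normfV (gtr0_norm m0R) ler_pdivrMr// mulVf ?gt_eqF// ler_norml.
move: k0 k1; rewrite -natr1 mulrDl mul1r => k0 k1.
by apply/andP; split; lra.
Qed.

(** By homogeneity only coefficients with sum of absolute values 1 matter, and these
are approximated by a finite grid.  The conclusion is stable under perturbing the grid
because formulas may define only approximations of the prescribed combinations. *)
Lemma finite_net (J : finType) (r d : R) : 0 < d ->
  exists (K : finType) (L : K -> J -> R) (e : R), 0 < e /\
    forall L' : K -> J -> R, (forall k j, `|L' k j - L k j| <= e) ->
    forall E F (v : J -> E) (w : J -> F),
      (forall j, `|v j| <= r) -> (forall j, `|w j| <= r) ->
      (forall k, `| `|\sum_j L' k j *: v j| - `|\sum_j L' k j *: w j| | <= e) ->
      tpclose d v w.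
Proof.
(* The constant C bounds the effect on a norm of a unit error in the coefficients. *)
move=> d0; pose C := (`|r| + 1) * (#|J|%:R + 1).
have C0 : 0 < C by rewrite mulr_gt0// ltr_wpDl ?ler0n.
have [m] : exists m : nat, (4 * C + 1) / d < m.+1%:R.
  exists (Num.truncn ((4 * C + 1) / d)).
  have : 0 <= (4 * C + 1) / d by rewrite divr_ge0 ?(ltW d0)// addr_ge0// mulr_ge0// ltW.
  by move=> /truncn_itv/andP[].
set M : R := m.+1%:R => mP; have M0 : 0 < M by rewrite ltr0n.
pose K : finType := {ffun J -> 'I_(m.+1 + m.+1).+1}.
pose L (k : K) j : R := ((k j : nat)%:R - M) / M.
exists K, L, M^-1; split; first by rewrite invr_gt0.
move=> L' L'L E F v w vr wr vw l.
pose s := \sum_j `|l j|; have s_ge0 : 0 <= s by exact: sum_norm_ge0.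
have [s0|sn0] := eqVneq s 0.
  have l0 j : l j = 0.
    apply/eqP; rewrite -normr_eq0 eq_le normr_ge0 andbT.
    by rewrite -s0 /s (bigD1 j)//= lerDl sumr_ge0.
  have z (V : lmodType R) (u : J -> V) : \sum_j l j *: u j = 0.
    by rewrite big1// => j _; rewrite l0 scale0r.
  by rewrite !z !normr0 subrr normr0 -/s s0 mulr0.
have {sn0} sp : 0 < s by rewrite lt_neqAle eq_sym sn0.
pose l1 j := l j / s.
have l11 j : `|l1 j| <= 1.
  rewrite normrM normfV (gtr0_norm sp) ler_pdivrMr// mul1r /s (bigD1 j)//=.
  by rewrite lerDl sumr_ge0.
have /choice[k kP] j : exists k : 'I_(m.+1 + m.+1).+1,
    `|l1 j - ((k : nat)%:R - M) / M| <= M^-1.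
  exact: (@grid_approx m.+1 (l1 j)).
pose kk : K := [ffun j => k j].
have lL j : `|l1 j - L' kk j| <= 2 * M^-1.
  rewrite (le_trans (ler_distD (L kk j) _ _))// mulr_natl mulr2n lerD//.
    by rewrite /L ffunE.
  by rewrite distrC.
have rC (t : R) : 0 <= t -> r * (t *+ #|J|) <= C * t.
  move=> t0; rewrite -mulr_natl mulrA ler_wpM2r//.
  rewrite /C (le_trans (_ : _ <= (`|r| + 1) * #|J|%:R))//.
    by rewrite ler_wpM2r ?ler0n// (le_trans (ler_norm r))// lerDl.
  by rewrite ler_wpM2l// ?lerDl// addr_ge0.
have t0 : 0 <= 2 * M^-1 by rewrite mulr_ge0// invr_ge0 ltW.
have A := le_trans (comb_diff_le vr lL) (rC _ t0).
have B := le_trans (comb_diff_le wr lL) (rC _ t0).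
have D := vw kk.
have lE G (u : J -> G) : \sum_j l j *: u j = s *: \sum_j l1 j *: u j.
  rewrite scaler_sumr; apply: eq_bigr => j _; rewrite scalerA /l1 mulrC divfK//.
  by rewrite gt_eqF.
rewrite !lE !normrZ (gtr0_norm sp) -mulrBr normrM (gtr0_norm sp) mulrC.
rewrite ler_wpM2r//.
have h : 4 * C * M^-1 + M^-1 <= d.
  rewrite -[X in _ + X]mul1r -mulrDl ler_pdivrMr// -ler_pdivrMl//.
  by rewrite [leLHS]mulrC ltW.
apply: le_trans h; rewrite -mulrA; rewrite mulrCA in A; rewrite mulrCA in B.
set p := C * M^-1 in A B *; set q := M^-1 in D *.
move: A B D; rewrite !ler_norml => /andP[? ?] /andP[? ?] /andP[? ?].
by apply/andP; split; lra.
Qed.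

End FiniteNets.

Section Limits.
Context (R : realType).
Implicit Types E F G H : completeNormedModType R.

Lemma cauchy_seq_lim E (u : nat -> E) :
  (forall e, 0 < e -> exists N, forall m, (N <= m)%N -> `|u N - u m| < e) ->
  exists l, forall e, 0 < e -> exists N, forall m, (N <= m)%N -> `|l - u m| < e.
Proof.
move=> uc; have : cvg (u @ \oo).
  apply/cauchy_cvgP/cauchyP => e e0; have [N uN] := uc _ e0.
  exists (u N); exists N => // m /= Nm; rewrite -ball_normE; exact: uN.
move=> /cvg_ex[l /cvg_ballP ul]; exists l => e e0.
have [N _ uN] := ul _ e0; exists N => m Nm.
by have := uN m Nm; rewrite -ball_normE.
Qed.

Lemma small_pow2 (e : R) : 0 < e -> exists N, forall m, (N <= m)%N -> (2^-1) ^+ m < e.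
Proof.
move=> e0; have [N] : exists N : nat, e^-1 < N.+1%:R.
  exists (Num.truncn e^-1).
  by have /truncn_itv/andP[] : 0 <= e^-1 by rewrite invr_ge0 ltW.
move=> Ne; exists N => m Nm; rewrite exprVn invf_plt ?posrE ?exprn_gt0//.
rewrite (lt_le_trans Ne)// -natrX ler_nat (leq_trans _ (ltn_expl m (ltnSn 1)))//.
Qed.

Lemma le0_pow2 (x C : R) : (forall k, x <= C * (2^-1) ^+ k) -> x <= 0.
Proof.
move=> xC; rewrite leNgt; apply/negP => x0.
have c0 : 0 < `|C| + 1 by rewrite ltr_wpDl.
have [N /(_ N (leqnn N))] := small_pow2 (divr_gt0 x0 c0).
rewrite ltr_pdivlMr// ltNge => /negP; apply.
rewrite (le_trans (xC N))// mulrC ler_wpM2l//.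
  by rewrite exprn_ge0// invr_ge0.
by rewrite (le_trans (ler_norm C))// lerDl.
Qed.

Section extend_isometry.
Variables (G H : completeNormedModType R) (K : Type) (a : K -> G) (b : K -> H).
Hypothesis ab : forall n (f : 'I_n -> K), tpclose 0 (a \o f) (b \o f).

(** The closure of the graph of a k |-> b k; the isometry is shown to be this relation. *)
Let rel x y := forall e, 0 < e -> exists k, `|x - a k| < e /\ `|y - b k| < e.

(** Three-term combinations suffice both for linearity and for isometry. *)
Let ab3 s t k1 k2 k3 :
  `|s *: a k1 + t *: a k2 - a k3| = `|s *: b k1 + t *: b k2 - b k3|.
Proof.
have := ab (fun i : 'I_3 => nth k1 [:: k1; k2; k3] i) (fun i => [:: s; t; -1]`_i).
rewrite mul0r normr_le0 subr_eq0 => /eqP.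
by rewrite !big_ord_recl !big_ord0 /= !scaleN1r !addr0 !addrA.
Qed.

Let rel_lin s x1 x2 x3 y1 y2 y3 : rel x1 y1 -> rel x2 y2 -> rel x3 y3 ->
  `|s *: x1 + x2 - x3| = `|s *: y1 + y2 - y3|.
Proof.
move=> r1 r2 r3; apply/eqP; rewrite -subr_eq0 -normr_le0.
pose C := `|s| + 1 + 1; have C0 : 0 < C by rewrite !ltr_wpDl ?addr_ge0.
suff h e : 0 < e -> `| `|s *: x1 + x2 - x3| - `|s *: y1 + y2 - y3| | <= C * e + C * e.
  apply/ler_addgt0Pr => e e0; rewrite add0r.
  have e1 : 0 < e / (2 * C) by rewrite divr_gt0// mulr_gt0.
  apply: le_trans (h _ e1) _.
  have -> : C * (e / (2 * C)) = e / 2 by rewrite invfM mulrCA [C * _]mulrCA divff ?mulr1 ?gt_eqF.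
  by rewrite -splitr.
move=> e0; have [k1 [A1 B1]] := r1 _ e0.
have [k2 [A2 B2]] := r2 _ e0; have [k3 [A3 B3]] := r3 _ e0.
have close (V : completeNormedModType R) (u1 u2 u3 v1 v2 v3 : V) :
    `|u1 - v1| < e -> `|u2 - v2| < e -> `|u3 - v3| < e ->
    `| `|s *: u1 + u2 - u3| - `|s *: v1 + 1 *: v2 - v3| | <= C * e.
  move=> h1 h2 h3; rewrite scale1r (le_trans (ler_dist_dist _ _))//.
  have -> : s *: u1 + u2 - u3 - (s *: v1 + v2 - v3) =
            s *: (u1 - v1) + (u2 - v2) - (u3 - v3).
    by rewrite scalerBr !opprD !opprK addrACA; congr (_ + _); rewrite addrACA.
  rewrite (le_trans (ler_normB _ _))// /C mulrDl mul1r lerD ?(ltW h3)//.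
  rewrite (le_trans (ler_normD _ _))// mulrDl mul1r lerD ?(ltW h2)//.
  by rewrite normrZ ler_wpM2l// ltW.
have hG := close _ _ _ _ _ _ _ A1 A2 A3.
have hH := close _ _ _ _ _ _ _ B1 B2 B3.
rewrite ab3 in hG; rewrite distrC in hH.
exact: le_trans (ler_distD _ _ _) (lerD hG hH).
Qed.

Let rel_ex x : (forall x e, 0 < e -> exists k, `|x - a k| < e) ->
  exists y, rel x y.
Proof.
move=> ad; have p0 m : 0 < (2^-1 : R) ^+ m by rewrite exprn_gt0 ?invr_gt0.
have /choice[k kP] m : exists k, `|x - a k| < (2^-1) ^+ m by exact: ad.
have ba i j : `|b (k i) - b (k j)| = `|a (k i) - a (k j)|.
  by have := ab3 1 0 (k i) (k i) (k j); rewrite !scale1r !scale0r !addr0 => ->.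
have [e e0|y yP] := @cauchy_seq_lim H (b \o k).
  have e2 : 0 < e / 2 by rewrite divr_gt0.
  have [N NP] := small_pow2 e2; exists N => m Nm /=.
  rewrite ba (le_lt_trans (ler_distD x _ _))// (splitr e) ltrD//.
    by rewrite distrC (lt_trans (kP _))// NP.
  by rewrite (lt_trans (kP _))// NP.
exists y => e e0; have [N NP] := small_pow2 e0; have [M MP] := yP _ e0.
exists (k (maxn N M)); split; last by apply: MP; exact: leq_maxr.
by rewrite (lt_trans (kP _))// NP// leq_maxl.
Qed.

(** The last conclusion identifies the map with the closed relation, so that exchanging
a and b gives the inverse in [extend_isometry_onto]. *)
Lemma extend_isometry : (forall x e, 0 < e -> exists k, `|x - a k| < e) ->
  exists f : G -> H, [/\ isom f, forall k, f (a k) = b k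
    & forall x y, (forall e, 0 < e ->
        exists k, `|x - a k| < e /\ `|y - b k| < e) -> f x = y].
Proof.
move=> ad; have /choice[f fP] x : exists y, rel x y by exact: rel_ex.
have uniq x y : rel x y -> f x = y.
  move=> xy; have := rel_lin 0 (fP x) (fP x) xy.
  rewrite !scale0r !add0r subrr normr0 => /esym/normr0_eq0/eqP.
  by rewrite subr_eq0 => /eqP.
exists f; split=> [||x y]; last exact: uniq.
  split=> [s x y|x].
    have := rel_lin s (fP x) (fP y) (fP (s *: x + y)).
    by rewrite subrr normr0 => /esym/normr0_eq0/eqP; rewrite subr_eq0 => /eqP.
  have := rel_lin 0 (fP x) (fP 0) (fP x).
  have := rel_lin 1 (fP 0) (fP 0) (fP 0).
  rewrite !scale1r !addr0 subrr normr0 addrK => /esym/normr0_eq0 f0.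
  by rewrite !scale0r f0 !add0r !normrN.
by move=> k; apply: uniq => e e0; exists k; rewrite !subrr !normr0.
Qed.

End extend_isometry.

Lemma extend_isometry_onto G H (K : Type) (a : K -> G) (b : K -> H) :
  (forall n (f : 'I_n -> K), tpclose 0 (a \o f) (b \o f)) ->
  (forall x e, 0 < e -> exists k, `|x - a k| < e) ->
  (forall y e, 0 < e -> exists k, `|y - b k| < e) ->
  exists f : G -> H, isom f /\ range f = setT.
Proof.
move=> ab ad bd; have [f [fi fa frel]] := extend_isometry ab ad.
have [g [gi gb grel]] := extend_isometry (fun n h => tpclose_sym (ab n h)) bd.
exists f; split=> //; apply/seteqP; split=> // y _; exists (g y) => //.
apply: frel => e e0; have [k yk] := bd y _ e0; exists k; split=> //.
by rewrite -gb isomB.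
Qed.

End Limits.

(** * Separable Gurarij subspaces and the back-and-forth step *)

Section SeparableGurarii.
Context (R : realType).
Implicit Types E F G H : completeNormedModType R.

Lemma gurarii_nontrivial G : gurarii G -> exists b : G, b != 0.
Proof.
move=> gG; have e2 : 0 < 2^-1 :> R by rewrite invr_gt0.
have [|b] := gG _ (fun i : 'I_0 => 0) R^o (fun i => 0) 1 0 (lexx _) _ _ e2.
  by move=> l; rewrite !big_ord0 !normr0 subrr normr0 mulr0.
move=> /(tpclose_norm None) /=; rewrite add0r normr1 => b1; exists b.
by apply: contraTneq b1 => ->; rewrite normr0 sub0r normrN normr1 -ltNge invf_lt1// ltr1n.
Qed.

(** A point x is described, for each precision m and each bound r, by the rounded
norms of the finitely many combinations of s and x given by [finite_net].  There
are countably many descriptions, and d lists one point for each that occurs. *)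
Lemma countable_witnesses G (s : seq G) : exists d : nat -> G,
  forall x e, 0 < e -> exists k,
    tpclose e (oapp (fun i : 'I_(size s) => s`_i) x)
              (oapp (fun i : 'I_(size s) => s`_i) (d k)).
Proof.
have close (q b x y : R) : q <= x -> x < q + b -> q <= y -> y < q + b ->
    `|x - y| <= b.
  by move=> *; rewrite ler_norml; apply/andP; split; lra.
pose t (x : G) := oapp (fun i : 'I_(size s) => s`_i) x.
have netP (m r : nat) := cid (@finite_net R (option 'I_(size s)) r%:R m.+1%:R^-1
  (ltac:(by rewrite invr_gt0 ltr0n))).
pose K m r := sval (netP m r).
have LP m r := cid (svalP (netP m r)).
pose L m r : K m r -> option 'I_(size s) -> R := sval (LP m r).
have eP m r := cid (svalP (LP m r)).
pose e m r : R := sval (eP m r).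
pose code m r x : seq nat :=
  [seq Num.truncn (`|\sum_j L m r k j *: t x j| / e m r) | k <- enum (K m r)].
pose good (c : nat * nat * seq nat) x :=
  (forall j, `|t x j| <= c.1.2%:R) /\ code c.1.1 c.1.2 x = c.2.
pose pick c := if pselect (exists x, good c x) is left h then sval (cid h) else 0.
have pickP c x : good c x -> good c (pick c).
  move=> gx; rewrite /pick; case: pselect => [h|[]]; last by exists x.
  exact: (svalP (cid h)).
exists (fun k => pick (odflt (0%N, 0%N, [::]) (unpickle k))) => x d d0.
have [m md] : exists m : nat, m.+1%:R^-1 <= d.
  exists (Num.truncn d^-1).
  have /truncn_itv/andP[_ h] : 0 <= d^-1 by rewrite invr_ge0 ltW.
  by rewrite invf_ple ?posrE ?ltr0n// ltW.
have [r rP] : exists r : nat, forall j, `|t x j| <= r%:R.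
  exists (Num.truncn (\sum_j `|t x j|)).+1 => j.
  have /truncn_itv/andP[_ /ltW] : 0 <= \sum_j `|t x j| by apply: sumr_ge0.
  by apply: le_trans; rewrite (bigD1 j)//= lerDl sumr_ge0.
pose c := (m, r, code m r x); exists (pickle c); rewrite pickleK /=.
have [cr cc] := pickP c x (conj rP erefl); set y := pick c in cr cc *.
apply: tpclose_le md _; have [e0 eE] := svalP (eP m r).
apply: (eE (L m r)) => // [k j|k]; first by rewrite subrr normr0 ltW.
have {}cc : code m r y = code m r x := cc.
have /eq_in_map/(_ k) := cc; rewrite mem_enum.
set u := `|\sum_j _ j *: t x j|; set v := `|\sum_j _ j *: t y j| => /(_ isT) uv.
have h (z : R) : 0 <= z -> (Num.truncn (z / e m r))%:R * e m r <= z /\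
    z < (Num.truncn (z / e m r))%:R * e m r + e m r.
  move=> z0; have : 0 <= z / e m r by rewrite divr_ge0 ?(ltW e0).
  move=> /truncn_itv/andP[]; rewrite ler_pdivlMr// ltr_pdivrMr//.
  by rewrite -natr1 mulrDl mul1r.
have [h1 h2] := h v (normr_ge0 _); have := h u (normr_ge0 _); rewrite -uv.
by move=> [h3 h4]; exact: close h3 h4 h1 h2.
Qed.

(** A downward Loewenheim-Skolem argument.  Finite trees are names: a node with label k
denotes the k-th witness for the tuple denoted by its children.  The closure of the
set of named points is closed under linear combinations, because a witness imitating a
combination of named points lies close to it, and it inherits the extension property,
because it contains the witnesses of G. *)
Lemma gurarii_separable_subspace G : gurarii G ->
  exists H (d : nat -> H),
    gurarii H /\ forall y e, 0 < e -> exists k, `|y - d k| < e.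
Proof.
move=> gG; have /choice[w wP] := @countable_witnesses G.
pose itp := fix itp (t : GenTree.tree nat) : G :=
  if t is GenTree.Node k ts then w (map itp ts) k else 0.
pose S : set G := [set y | forall e, 0 < e -> exists t, `|y - itp t| < e].
have witness n (u : 'I_n -> GenTree.tree nat) x e : 0 < e -> exists t,
    tpclose e (oapp (fun i => itp (u i)) x) (oapp (fun i => itp (u i)) (itp t)).
  move=> e0; pose s := map itp (map u (enum 'I_n)).
  have sn : size s = n by rewrite /s 2!size_map size_enum_ord.
  have [k] := wP s x e e0.
  move=> /(tpclose_pull (omap (cast_ord (esym sn))) (ltW e0)) h.
  exists (GenTree.Node k (map u (enum 'I_n))).
  have sE y : oapp (fun i : 'I_n => itp (u i)) y =
      oapp (fun i : 'I_(size s) => s`_i) y \o omap (cast_ord (esym sn)).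
    apply/funext => -[i|] //=; rewrite /s -map_comp (nth_map i) ?size_enum_ord//=.
    by rewrite nth_ord_enum.
  by rewrite !sE.
have witness_fin (J : finType) (u : J -> GenTree.tree nat) x e : 0 < e ->
    exists t, tpclose e (oapp (fun j => itp (u j)) x) (oapp (fun j => itp (u j)) (itp t)).
  move=> e0; have [t] := @witness _ (fun r : 'I_#|J| => u (enum_val r)) x e e0.
  move=> /(tpclose_pull (omap enum_rank) (ltW e0)) h; exists t.
  have sE y : oapp (fun j => itp (u j)) y =
      oapp (fun r => itp (u (enum_val r))) y \o omap (enum_rank : J -> _).
    by apply/funext => -[j|] //=; rewrite enum_rankK.
  by rewrite !sE.
have itpS t : S (itp t) by move=> e e0; exists t; rewrite subrr normr0.
have [|||H [i [il iN iS]]] := @closed_subspace R G S.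
- move=> a x y Sx Sy e e0.
  pose C := `|a| + 1 + 1; have C0 : 0 < C by rewrite !ltr_wpDl ?addr_ge0.
  have e1 : 0 < e / 2 / C by rewrite !divr_gt0.
  have [t1 xt] := Sx _ e1; have [t2 yt] := Sy _ e1.
  pose u (k : 'I_2) := if k == ord0 then t1 else t2.
  have [t tP] := @witness 2 u (a *: itp t1 + itp t2) _ e1; exists t.
  (* The combination a *: x + y - z vanishes at the imitated point z. *)
  have := tP (oapp (fun k : 'I_2 => if k == ord0 then a else 1) (-1)).
  rewrite !sum_option !big_ord_recl !big_ord0 /= !addr0 !scaleN1r !scale1r.
  rewrite addNr normr0 sub0r normrN normr_id normrN1 normr1.
  rewrite [1 + _]addrC -/C divfK ?gt_eqF// => h.
  have {}h : `|a *: itp t1 + itp t2 - itp t| <= e / 2 by rewrite addrC.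
  rewrite (le_lt_trans (ler_distD (a *: itp t1 + itp t2) _ _))//.
  rewrite (splitr e) ltr_leD// opprD addrACA -scalerBr.
  rewrite (le_lt_trans (ler_normD _ _))// normrZ.
  rewrite (@lt_le_trans _ _ (`|a| * (e / 2 / C) + e / 2 / C))//.
    by apply: ler_ltD yt; rewrite ler_wpM2l// ltW.
  have : C * (e / 2 / C) = e / 2 by rewrite mulrC divfK ?gt_eqF.
  by move: e1; move: (e / 2 / C) => q q0; rewrite /C !mulrDl mul1r; lra.
- by move=> e e0; exists (GenTree.Leaf 0%N); rewrite subrr normr0.
- move=> x Sx e e0; have e2 : 0 < e / 2 by rewrite divr_gt0.
  have [y Sy xy] := Sx _ e2; have [t yt] := Sy _ e2.
  exists t; rewrite (le_lt_trans (ler_distD y _ _))// (splitr e).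
  exact: ltrD.
have ii : isom i by [].
have /choice[it itE] t : exists h, i h = itp t.
  by have := itpS t; rewrite -iS => -[h _ <-]; exists h.
exists H, (fun k => it (odflt (GenTree.Leaf 0%N) (unpickle k))); split; last first.
  move=> y e e0; have : S (i y) by rewrite -iS; exists y.
  move=> /(_ _ e0)[t yt]; exists (pickle t).
  by rewrite pickleK /= -iN linB// itE.
apply: gurarii_exact => J a F c z ac e e0; have e4 : 0 < e / 4 by rewrite divr_gt0.
have /choice[u uP] j : exists t, `|i (a j) - itp t| < e / 4.
  by apply: (_ : S (i (a j))) => //; rewrite -iS; exists (a j).
have uc : tpclose (e / 4) (fun j => itp (u j)) c.
  rewrite -[e / 4]addr0; apply: tpclose_trans ac.
  rewrite -[e / 4]addr0; apply: (@tpclose_trans _ _ _ _ _ _ _ _ (i \o a)).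
    by apply: tpclose_near => j /=; rewrite distrC ltW.
  exact/tpclose_sym/tpclose_isom.
have [b bP] := gG _ _ _ _ z _ (ltW e4) uc _ e4.
have [t tP] := witness_fin J u b _ e4.
exists (it t); have -> : e = (0 + e / 4) + (e / 4 + (e / 4 + e / 4)) by lra.
apply: (@tpclose_trans _ _ _ _ _ _ _ _ (oapp (fun j => itp (u j)) (itp t))).
  apply: (@tpclose_trans _ _ _ _ _ _ _ _ (i \o oapp a (it t))).
    exact: tpclose_isom.
  by apply: tpclose_near => -[j|] /=; rewrite ?itE ?subrr ?normr0 ltW.
by apply: tpclose_trans bP; exact: tpclose_sym.
Qed.

End SeparableGurarii.

Section BackAndForth.
Context (R : realType).
Implicit Types E F G H : completeNormedModType R.

Definition sumf (J K : Type) E (a : J -> E) (b : K -> E) (s : J + K) : E :=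
  match s with inl j => a j | inr k => b k end.

Lemma gurarii_multi H : gurarii H -> forall n (J : finType) (a : J -> H) F
    (c : J -> F) (z : 'I_n -> F) d, 0 <= d -> tpclose d a c ->
  forall e, 0 < e -> exists b : 'I_n -> H, tpclose (d + e) (sumf a b) (sumf c z).
Proof.
move=> gH; elim=> [|n IH] J a F c z d d0 ac e e0.
  pose f (s : J + 'I_0) : J :=
    match s with inl j => j | inr k => False_rect J (notF (ltn_ord k)) end.
  exists (fun=> 0); have fE E (x : J -> E) y : sumf x y = x \o f.
    by apply/funext => -[j|[]].
  rewrite !fE; apply: tpclose_pull; first by rewrite addr_ge0// ltW.
  by apply: tpclose_le ac; rewrite lerDl ltW.
have e2 : 0 < e / 2 by rewrite divr_gt0.
have [b0 b0P] := gH _ _ _ _ (z ord0) _ d0 ac _ e2.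
have de : 0 <= d + e / 2 by rewrite addr_ge0// ltW.
have [b bP] := IH _ _ _ _ (z \o fintype.lift ord0) _ de b0P _ e2.
pose f (s : J + 'I_n.+1) : option J + 'I_n := match s with
  | inl j => inl (Some j)
  | inr k => if unlift ord0 k is Some k' then inr k' else inl None end.
exists (fun k => oapp b b0 (unlift ord0 k)).
have -> : d + e = d + e / 2 + e / 2 by lra.
have -> : sumf a (fun k => oapp b b0 (unlift ord0 k)) = sumf (oapp a b0) b \o f.
  by apply/funext => -[j|k] //=; case: (unlift ord0 k).
have -> : sumf c z = sumf (oapp c (z ord0)) (z \o fintype.lift ord0) \o f.
  by apply/funext => -[j|k] //=; case: (unliftP ord0 k) => [k'|] ->.
by apply: tpclose_pull => //; rewrite addr_ge0// ltW.
Qed.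

(** In the amalgam of H with G the copy of a lies near b, so imitating it in H over b
gives a tuple near b, while a stays in place. *)
Lemma gurarii_perturb H G (J : finType) (b : J -> H) (a : J -> G) d :
  gurarii H -> 0 <= d -> tpclose d b a -> forall e, 0 < e ->
  exists b' : J -> H, (forall j, `|b j - b' j| <= d + e) /\ tpclose e b' a.
Proof.
move=> gH d0 ba e e0; have e2 : 0 < e / 2 by rewrite divr_gt0.
have [W [i [k [ii ki ik]]]] := amalgam d0 ba.
have [b'' b''P] := gurarii_multi gH (fun r : 'I_#|J| => k (a (enum_val r)))
  (lexx 0) (tpclose_isom b ii) e2.
rewrite add0r in b''P; exists (b'' \o enum_rank); split=> [j|].
  have := tpclose_dist (inl j) (inr (enum_rank j)) (ltW e2) b''P.
  rewrite /= enum_rankK -splitr => h.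
  by have := ik j; move: h; rewrite ler_norml => /andP[_ h1] h2; lra.
have := tpclose_pull (fun j : J => inr J (enum_rank j) : J + 'I_#|J|) (ltW e2) b''P.
move=> h; have -> : e = e / 2 + (0 + e / 2) by lra.
apply: (tpclose_trans h); apply: tpclose_le (_ : 0 <= _) _.
  by rewrite add0r ltW.
have -> : sumf (i \o b) (fun r => k (a (enum_val r))) \o
   (fun j : J => inr J (enum_rank j)) = k \o a.
  by apply/funext => j /=; rewrite enum_rankK.
exact/tpclose_sym/tpclose_isom.
Qed.

(** The map sending 0, ..., n - 1 to the old entries, n to the first new one and n + 1
to the second, for tuples extended twice by [oapp]. *)
Definition initial (n i : nat) : option (option 'I_n) :=
  if insub i is Some j then Some (Some j) else if i == n then Some None else None.

(** The point g is added to a and imitated in H, then h is added to b and imitated in G,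
and finally the tuple of H alone is moved to reduce the error from about d to e.  Since
the G side is never moved, only the b's need a convergence argument. *)
Lemma back_and_forth_step G H n (a : nat -> G) (b : nat -> H) d (g : G) (h : H) :
  gurarii G -> gurarii H -> 0 < d ->
  tpclose d (fun i : 'I_n => a i) (fun i : 'I_n => b i) ->
  forall e, 0 < e -> exists (a' : nat -> G) (b' : nat -> H),
    [/\ tpclose e (fun i : 'I_n.+2 => a' i) (fun i : 'I_n.+2 => b' i),
        forall i, (i < n)%N -> a' i = a i /\ `|b i - b' i| <= d + e,
        a' n = g & `|b' n.+1 - h| <= d + e].
Proof.
move=> gG gH d0 ab e e0; have e3 : 0 < e / 3 by rewrite divr_gt0.
have [y yP] := gH _ _ _ _ g _ (ltW d0) (tpclose_sym ab) _ e3.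
have d1 : 0 <= d + e / 3 by rewrite addr_ge0// ltW.
have [x xP] := gG _ _ _ _ h _ d1 (tpclose_sym yP) _ e3.
have d2 : 0 <= d + e / 3 + e / 3 by rewrite addr_ge0// ltW.
have [b' [b'1 b'2]] := gurarii_perturb gH d2 (tpclose_sym xP) e3.
have {}b'1 j : `|oapp (oapp (fun i : 'I_n => b i) y) h j - b' j| <= d + e.
  by rewrite (le_trans (b'1 j))//; lra.
exists (oapp (oapp (fun i : 'I_n => a i) g) x \o initial n), (b' \o initial n).
have ini i (i_n : (i < n)%N) : initial n i = Some (Some (Ordinal i_n)).
  by rewrite /initial insubT.
have inn : initial n n = Some None by rewrite /initial insubF ?ltnn// eqxx.
have inS : initial n n.+1 = None.
  by rewrite /initial insubF ?gtn_eqF//; rewrite ltnNge leqnSn.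
split=> [|i i_n| |] /=.
- have := tpclose_pull (fun i : 'I_n.+2 => initial n i) (ltW e3) (tpclose_sym b'2).
  by apply: tpclose_le; lra.
- by rewrite ini; split=> //; exact: b'1 (Some (Some (Ordinal i_n))).
- by rewrite inn.
- by rewrite inS distrC; exact: b'1 None.
Qed.

End BackAndForth.

(** * Uniqueness of the separable Gurarij space *)

Section Uniqueness.
Context (R : realType).
Implicit Types E F G H : completeNormedModType R.

Lemma dependent_choice_step (S : Type) (P : nat -> S -> Prop)
    (Q : nat -> S -> S -> Prop) s0 : P 0%N s0 ->
  (forall k s, P k s -> exists s', P k.+1 s' /\ Q k s s') ->
  exists f : nat -> S, forall k, P k (f k) /\ Q k (f k) (f k.+1).
Proof.
move=> Ps0 step.
have st k (s : {s | P k s}) : {s' : {s | P k.+1 s} | Q k (sval s) (sval s')}.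
  have [s' Ps'] := cid (step k (sval s) (svalP s)).
  by exists (exist _ s' (proj1 Ps')); exact: (proj2 Ps').
pose f := nat_rect (fun k => {s | P k s}) (exist _ s0 Ps0)
  (fun k s => sval (st k s)).
exists (fun k => sval (f k)) => k; split; first exact: (svalP (f k)).
exact: (svalP (st k (f k))).
Qed.

Lemma geometric_lim E (u : nat -> E) (C : R) N :
  (forall k, (N <= k)%N -> `|u k - u k.+1| <= C * 2^-1 ^+ k) ->
  exists l, forall k, (N <= k)%N -> `|l - u k| <= 2 * C * 2^-1 ^+ k.
Proof.
move=> uC.
have C0 : 0 <= C.
  have := le_trans (normr_ge0 _) (uC N (leqnn N)).
  by rewrite pmulr_lge0// exprn_gt0 ?invr_gt0.
have uD k m : (N <= k)%N -> `|u k - u (k + m)%N| <=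
    2 * C * (2^-1 ^+ k - 2^-1 ^+ (k + m)).
  move=> Nk; elim: m => [|m IH]; first by rewrite addn0 !subrr normr0 mulr0.
  rewrite (le_trans (ler_distD (u (k + m)%N) _ _))// addnS.
  have := uC _ (leq_trans Nk (leq_addr m k)); rewrite exprS; move: IH.
  set a := 2^-1 ^+ (k + m); set b := 2^-1 ^+ k => IH h.
  by apply: le_trans (lerD IH h) _; lra.
have uT k m : (N <= k)%N -> (k <= m)%N -> `|u k - u m| <= 2 * C * 2^-1 ^+ k.
  move=> Nk km; have := uD k (m - k)%N Nk; rewrite subnKC// => /le_trans; apply.
  by rewrite ler_wpM2l ?mulr_ge0// gerBl exprn_ge0 ?invr_ge0.
have [e e0|l lP] := @cauchy_seq_lim R E u.
  have c0 : 0 < e / (2 * C + 1) by rewrite divr_gt0// ltr_wpDl// mulr_ge0.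
  have [M MP] := small_pow2 c0; exists (maxn N M) => m Mm.
  rewrite (le_lt_trans (uT _ _ (leq_maxl _ _) Mm))//.
  have := MP _ (leq_maxr N M); rewrite ltr_pdivlMr; last by rewrite ltr_wpDl// mulr_ge0.
  apply: le_lt_trans; rewrite mulrC ler_wpM2l ?lerDl// exprn_ge0 ?invr_ge0//.
exists l => k Nk; apply/ler_addgt0Pr => e e0; have [M MP] := lP _ e0.
rewrite (le_trans (ler_distD (u (maxn k M)) _ _))// addrC lerD//.
  by rewrite distrC uT// leq_maxl.
by rewrite ltW// MP// leq_maxr.
Qed.

(** The 2-adic valuation of k + 1 takes every value infinitely often. *)
Lemma recurrent_enumeration : exists phi : nat -> nat,
  forall j N, exists2 k, (N <= k)%N & phi k = j.
Proof.
exists (fun k => logn 2 k.+1) => j N.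
have p0 : (0 < 2 ^ j * N.*2.+1)%N by rewrite muln_gt0 expn_gt0.
exists (2 ^ j * N.*2.+1).-1; last first.
  rewrite prednK// lognM ?expn_gt0// pfactorK//.
  by rewrite lognE dvdn2 /= odd_double addn0.
rewrite -ltnS prednK// (leq_trans (_ : _ <= N.*2.+1)%N)//.
  by rewrite ltnS -addnn leq_addr.
by rewrite leq_pmull// expn_gt0.
Qed.

(** At step k the error is 2^-k, the k-th point of the dense sequence of G is added
exactly, and the point h (phi k) is added approximately.  Entries in H
move by a summable amount, so they converge; as every h j is approximated again at
arbitrarily late steps, the limits are dense although each h j is hit only
approximately. *)
Lemma gurarii_unique G H (g : nat -> G) (h : nat -> H) :
  gurarii G -> gurarii H ->
  (forall x e, 0 < e -> exists k, `|x - g k| < e) ->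
  (forall y e, 0 < e -> exists k, `|y - h k| < e) ->
  exists f : G -> H, isom f /\ range f = setT.
Proof.
move=> gG gH gd hd; have [phi phiP] := recurrent_enumeration.
pose p k : R := 2^-1 ^+ k.
have p0 k : 0 < p k by rewrite exprn_gt0 ?invr_gt0.
have pS k : p k.+1 = 2^-1 * p k by exact: exprS.
pose P k (s : (nat -> G) * (nat -> H)) :=
  tpclose (p k) (fun i : 'I_k.*2 => s.1 i) (fun i : 'I_k.*2 => s.2 i).
pose Q k (s s' : (nat -> G) * (nat -> H)) :=
  [/\ forall i, (i < k.*2)%N -> s'.1 i = s.1 i /\ `|s.2 i - s'.2 i| <= 2 * p k,
      s'.1 k.*2 = g k & `|s'.2 k.*2.+1 - h (phi k)| <= 2 * p k].
have [||f fP] := @dependent_choice_step _ P Q (fun=> 0, fun=> 0).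
- by move=> l; rewrite !big_ord0 !normr0 subrr normr0 mulr0.
- move=> k [a b] ab.
  have [a' [b' [h1 h2 h3 h4]]] :=
    back_and_forth_step (g k) (h (phi k)) gG gH (p0 k) ab (p0 k.+1).
  have le2 : p k + p k.+1 <= 2 * p k by rewrite pS; have := p0 k; lra.
  exists (a', b'); split=> //; split=> //=; last exact: le_trans h4 le2.
  by move=> i ik; have [-> /le_trans->] := h2 i ik.
(* Entries on the G side are fixed once chosen, so any late enough step gives them. *)
pose a i := (f i.+1).1 i.
have aE k i : (i < k.*2)%N -> (f k).1 i = a i.
  have st m n : (i < m.*2)%N -> (f (n + m)%N).1 i = (f m).1 i.
    move=> im; elim: n => // n <-; have [_ [+ _ _]] := fP (n + m)%N.
    move=> /(_ i); case=> //; rewrite (leq_trans im)// doubleD leq_addl.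
    by [].
  move=> ik; rewrite /a; have iS : (i < i.+1.*2)%N by rewrite -addnn ltnS leq_addr.
  by rewrite -(st _ i.+1 ik) -(st _ k iS) addnC.
have /choice[b bP] i : exists l, forall k, (i < k.*2)%N ->
    `|l - (f k).2 i| <= 4 * p k.
  have [k ik|l lP] := @geometric_lim H (fun k => (f k).2 i) 2 i./2.+1.
    by have [_ [+ _ _]] := fP k; move=> /(_ i) []//; rewrite -ltn_half_double.
  exists l => k; rewrite -ltn_half_double => ik.
  by rewrite (le_trans (lP _ ik))// -mulrA; rewrite /p; lra.
apply: (@extend_isometry_onto R G H nat a b).
- move=> n u l; rewrite mul0r.
  pose s := \sum_j `|l j|; apply: (@le0_pow2 _ _ (5 * s + 5 * s)) => k0.
  pose N := (\max_j (u j).+1)%N; pose k := maxn k0 N.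
  have uk j : ((u j).+1 <= k)%N.
    by rewrite leq_max (leq_bigmax_cond (F := fun j => (u j).+1)) ?orbT.
  have k2 : (k <= k.*2)%N by rewrite -addnn leq_addr.
  have abk : tpclose (5 * p k) (a \o u) (b \o u).
    have uk2 j : (u j < k.*2)%N by exact: leq_trans (uk j) k2.
    have [fk _] := fP k.
    have := tpclose_pull (fun j => Ordinal (uk2 j)) (ltW (p0 k)) fk.
    have -> : (fun i : 'I_k.*2 => (f k).1 i) \o (fun j => Ordinal (uk2 j)) = a \o u.
      by apply/funext => j /=; exact: aE.
    move=> h1; have -> : 5 * p k = p k + 4 * p k by lra.
    apply: (tpclose_trans h1); apply: tpclose_near => j /=.
    by rewrite distrC bP.
  have pk : p k <= p k0.
    by rewrite /p ler_wiXn2l ?invr_ge0 ?invf_le1 ?ler1n ?leq_maxl.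
  rewrite (le_trans (abk l))// -/s -/(p k0).
  have s0 : 0 <= s by exact: sum_norm_ge0.
  have := ler_wpM2l s0 pk; have := mulr_ge0 s0 (ltW (p0 k0)).
  by rewrite !mulrDl -!mulrA [p k * s]mulrC; lra.
- move=> x e e0; have [k xk] := gd x e e0; exists k.*2.
  by have [_ [_ gk _]] := fP k; rewrite -(aE k.+1) ?doubleS// gk.
- move=> y e e0; have e2 : 0 < e / 2 by rewrite divr_gt0.
  have [j yj] := hd y _ e2.
  have e12 : 0 < e / 12 by rewrite divr_gt0.
  have [N NP] := small_pow2 e12; have [k Nk kj] := phiP j N.
  exists k.*2.+1; have [_ [_ _]] := fP k; rewrite kj => h1.
  have h2 := bP k.*2.+1 k.+1; rewrite doubleS ltnS leqnn pS in h2.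
  have {}h2 := h2 isT; have pk : p k < e / 12 by exact: NP.
  rewrite (le_lt_trans (ler_distD (h j) _ _))//.
  rewrite (le_lt_trans (lerD (lexx _) (ler_distD ((f k.+1).2 k.*2.+1) _ _)))//.
  rewrite distrC in h1; rewrite distrC in h2.
  have := p0 k; lra.
Qed.

End Uniqueness.

(** * Continuous connectives, cutoffs and suprema *)

Section Connectives.
Context (R : realType).

Lemma box_compact k (B : R) :
  compact [set x : 'rV[R]_k | forall i, `|x ord0 i| <= B].
Proof.
have -> : [set x : 'rV[R]_k | forall i, `|x ord0 i| <= B] =
    [set x | forall i, `[- B, B]%classic (x ord0 i)].
  by apply/seteqP; split=> x xB i; have := xB i; rewrite set_itvcc /= ler_norml.
by apply: (@rV_compact R k (fun=> `[- B, B]%classic)) => i; exact: segment_compact.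
Qed.

Lemma ball_rV k (x y : 'rV[R]_k) d : 0 < d ->
  (forall i, `|x ord0 i - y ord0 i| < d) -> ball x d y.
Proof. by move=> d0 xy; split=> // i j; rewrite ord1 -ball_normE; exact: xy. Qed.

Lemma box_bounded k (u : 'rV[R]_k -> R) (B : R) : continuous u ->
  exists C, forall x : 'rV[R]_k, (forall i, `|x ord0 i| <= B) -> `|u x| <= C.
Proof.
move=> uc; have /compact_near_coveringP cov := @box_compact k B.
have [x xB|N _ NP] := cov nat \oo (fun n x => `|u x| <= n%:R).
  have /cvgrPdist_lt/(_ 1 ltr01) h := uc x.
  have [N _ NP] : \forall n \near \oo, `|u x| + 1 <= n%:R.
    exists (Num.truncn (`|u x| + 1)).+1 => // n /= Nn.
    have /truncn_itv/andP[_ /ltW h1] : 0 <= `|u x| + 1 by rewrite addr_ge0.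
    by rewrite (le_trans h1)// ler_nat.
  exists ([set y | `|u x - u y| < 1], [set n | `|u x| + 1 <= n%:R]).
    by split=> //; exists N.
  move=> [y n] /= [uy un]; apply: le_trans un.
  by rewrite -[u y](subKr (u x)) (le_trans (ler_normB _ _))// lerD2l ltW.
by exists N%:R => x xB; apply: (NP N) => //=.
Qed.

Lemma box_unif k (u : 'rV[R]_k -> R) (B e : R) : continuous u -> 0 < e ->
  exists d, 0 < d /\ forall x y : 'rV[R]_k, (forall i, `|x ord0 i| <= B) ->
    (forall i, `|x ord0 i - y ord0 i| <= d) -> `|u x - u y| <= e.
Proof.
move=> uc e0; have /compact_near_coveringP cov := @box_compact k B.
have [x xB|N _ NP] := cov nat \oo (fun n (x : 'rV[R]_k) => forall y : 'rV[R]_k,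
    (forall i, `|x ord0 i - y ord0 i| <= 2^-1 ^+ n) -> `|u x - u y| <= e).
  have e2 : 0 < e / 2 by rewrite divr_gt0.
  have /cvgrPdist_lt/(_ _ e2)/nbhs_ballP[d /= d0 dP] := uc x.
  have d2 : 0 < d / 2 by rewrite divr_gt0.
  have [N NP] := small_pow2 d2.
  exists (ball x (d / 2), [set n | (N <= n)%N]).
    by split; [exact: nbhsx_ballx|exists N].
  move=> [y n] /= [[_ xy] Nn] z yz.
  have h1 : `|u x - u y| < e / 2.
    apply: dP; apply: ball_rV => // i; have := xy ord0 i.
    by rewrite -ball_normE /= => /lt_trans; apply; rewrite ltr_pdivrMr// ltr_pMr// ltr1n.
  have h2 : `|u x - u z| < e / 2.
    apply: dP; apply: ball_rV => // i; have := xy ord0 i; rewrite -ball_normE /=.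
    move=> h; rewrite (le_lt_trans (ler_distD (y ord0 i) _ _))// (splitr d).
    by rewrite ltrD// (le_lt_trans (yz i))// NP.
  rewrite (le_trans (ler_distD (u x) _ _))// (splitr e) lerD ?(ltW h2)//.
  by rewrite distrC ltW.
exists (2^-1 ^+ N); split; first by rewrite exprn_gt0 ?invr_gt0.
by move=> x y xB; apply: (NP N) => //=.
Qed.

Lemma finite_upper_bound (J : finType) (f : J -> R) : exists B, forall j, f j <= B.
Proof.
exists (\sum_j `|f j|) => j; rewrite (le_trans (ler_norm _))//.
by rewrite (bigD1 j)//= lerDl sumr_ge0.
Qed.

Lemma finite_lower_bound (J : finType) (f : J -> R) : (forall j, 0 < f j) ->
  exists d, 0 < d /\ forall j, d <= f j.
Proof.
move=> f0; have [B BP] := finite_upper_bound (fun j => (f j)^-1).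
exists (`|B| + 1)^-1; split; first by rewrite invr_gt0 ltr_wpDl.
move=> j; rewrite invf_ple ?posrE ?ltr_wpDl//.
by rewrite (le_trans (BP j))// (le_trans (ler_norm B))// lerDl.
Qed.

Lemma cutoff01 r (t : R) : 0 <= cutoff r t <= 1.
Proof.
by rewrite /cutoff le_min ler01 le_max lexx /= ge_min lexx.
Qed.

Lemma cutoff1 r (t : R) : t <= r%:R -> cutoff r t = 1.
Proof.
move=> tr; rewrite /cutoff min_l// le_max; apply/orP; right.
by rewrite -natr1; lra.
Qed.

Lemma cutoff0 r (t : R) : r.+1%:R <= t -> cutoff r t = 0.
Proof. by move=> tr; rewrite /cutoff max_l ?subr_le0// min_r. Qed.

Lemma cutoff_lip r (s t : R) : `|cutoff r s - cutoff r t| <= `|s - t|.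
Proof.
rewrite /cutoff; set x := _ - s; set y := _ - t.
have -> : `|s - t| = `|x - y|.
  have -> : x - y = t - s by rewrite /x /y opprB addrC addrA subrK.
  by rewrite distrC.
have ge_dist (a b : R) : a - b <= `|a - b| /\ b - a <= `|a - b| by split; last rewrite distrC; exact: ler_norm.
have lip_max : `|Num.max 0 x - Num.max 0 y| <= `|x - y|.
  have [h1 h2] := ge_dist x y; have := normr_ge0 (x - y).
  case: (lerP 0 x) => hx; case: (lerP 0 y) => hy h0; rewrite ler_norml;
  by apply/andP; split; lra.
apply: le_trans lip_max; move: (Num.max 0 x) (Num.max 0 y) => a b.
have [h1 h2] := ge_dist a b; have := normr_ge0 (a - b).
case: (lerP 1 a) => ha; case: (lerP 1 b) => hb h0; rewrite ler_norml;
by apply/andP; split; lra.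
Qed.

Section sup_range.
Variables (T : Type) (x0 : T).
Implicit Types f g : T -> R.

Lemma has_sup_range f B : (forall x, f x <= B) -> has_sup (range f).
Proof. by move=> fB; split; [exists (f x0), x0|exists B => _ [x _ <-]]. Qed.

Lemma le_sup_range f B x : (forall x, f x <= B) -> f x <= sup (range f).
Proof. by move=> fB; apply: (sup_upper_bound (has_sup_range fB)); exists x. Qed.

Lemma sup_range_le f B : (forall x, f x <= B) -> sup (range f) <= B.
Proof. by move=> fB; apply: ge_sup; [exists (f x0), x0|move=> _ [x _ <-]]. Qed.

Lemma sup_range_norm f B : (forall x, `|f x| <= B) -> `|sup (range f)| <= B.
Proof.
move=> fB; have fB' x : f x <= B by exact: le_trans (ler_norm _) (fB x).
rewrite ler_norml sup_range_le// andbT (le_trans _ (le_sup_range x0 fB'))//.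
by have := fB x0; rewrite ler_norml => /andP[].
Qed.

Lemma inf_rangeN f : inf (range f) = - sup (range (fun x => - f x)).
Proof.
rewrite /inf; congr (- sup _); apply/seteqP; split=> [_ [_ [x _ <-] <-]|_ [x _ <-]].
  by exists x.
by exists (f x) => //; exists x.
Qed.

End sup_range.

Lemma sup_range_close (S T : Type) (x0 : S) (y0 : T) (f : S -> R) (g : T -> R) B e :
  (forall x, f x <= B) -> (forall y, g y <= B) ->
  (forall x, exists y, `|f x - g y| <= e) ->
  (forall y, exists x, `|f x - g y| <= e) ->
  `|sup (range f) - sup (range g)| <= e.
Proof.
move=> fB gB fg gf; rewrite ler_distl; apply/andP; split.
  rewrite lerBlDr; apply: (sup_range_le y0) => y; have [x] := gf y.
  by have := le_sup_range x0 x fB; rewrite ler_norml => h /andP[]; lra.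
apply: (sup_range_le x0) => x; have [y] := fg x.
by have := le_sup_range y0 y gB; rewrite ler_norml => h /andP[]; lra.
Qed.

End Connectives.

(** * Semantics of formulas *)

Section FormulaSemantics.
Context (R : realType) (L : signature R).
Implicit Types (M N : structure L) (T : theory L).

Lemma common_gauge_bound M n (v : 'I_n -> M) : exists r : nat, forall i, gauge (v i) <= r%:R.
Proof.
have [B BP] := finite_upper_bound (fun i => gauge (v i)).
exists (Num.truncn `|B|).+1 => i; rewrite (le_trans (BP i))// (le_trans (ler_norm B))//.
by have /truncn_itv/andP[_ /ltW] := normr_ge0 B.
Qed.

Lemma vcons_gauge M n (x : M) (v : 'I_n -> M) (r : R) : gauge x <= r ->
  (forall i, gauge (v i) <= r) -> forall i, gauge (vcons x v i) <= r.
Proof. by move=> xr vr i; rewrite /vcons; case: (unlift ord0 i) => [j|] /=. Qed.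

Lemma term_bounded n (t : term L n) (r : R) : exists B, forall M (v : 'I_n -> M),
  (forall i, gauge (v i) <= r) -> gauge (teval t v) <= B.
Proof.
elim: t => [i|f ts IH]; first by exists r => M v vr; exact: vr.
have /choice[b bP] := IH; have [B BP] := finite_upper_bound b.
exists (fbound f B) => M v vr; apply: finterp_bounded => i.
exact: le_trans (bP i M v vr) (BP i).
Qed.

(** The cutoff confines the quantified variable to a ball, which is why quantifying
preserves boundedness. *)
Lemma cutoff_mul_bounded M r (B : R) (F : M -> R) :
  (forall x, gauge x <= r.+1%:R -> `|F x| <= B) ->
  forall x, `|cutoff r (gauge x) * F x| <= `|B|.
Proof.
move=> FB x; have [xr|/ltW xr] := lerP (gauge x) r.+1%:R; last first.
  by rewrite cutoff0// mul0r normr0.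
have /andP[c0 c1] := cutoff01 r (gauge x).
rewrite normrM (ger0_norm c0) (le_trans _ (le_trans (FB x xr) (ler_norm B)))//.
by rewrite ler_piMl.
Qed.

Lemma eval_bounded n (phi : formula L n) (r : R) : exists B, forall M (v : 'I_n -> M),
  (forall i, gauge (v i) <= r) -> `|eval phi v| <= B.
Proof.
elim: phi r => {n} [n P ts|n t u|n t|n k u uc phis IH|n r' psi IH|n r' psi IH] r.
- have /choice[b bP] i := term_bounded (ts i) r; have [B BP] := finite_upper_bound b.
  exists (pbound P B) => M v vr; apply: pinterp_bounded => i.
  exact: le_trans (bP i M v vr) (BP i).
- have [B BP] := term_bounded t r; have [C CP] := term_bounded u r.
  exists (diam_bound L (Num.max B C)) => M v vr /=.
  rewrite ger0_norm ?mdist_ge0//; apply: mdist_bounded; rewrite le_max.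
    by rewrite BP.
  by rewrite CP ?orbT.
- have [B BP] := term_bounded t r; exists B => M v vr /=.
  by rewrite ger0_norm ?gauge_ge0// BP.
- have /choice[b bP] i := IH i r; have [B BP] := finite_upper_bound b.
  have [C CP] := box_bounded B uc.
  exists C => M v vr /=; apply: CP => i; rewrite mxE.
  exact: le_trans (bP i M v vr) (BP i).
- have [B BP] := IH (Num.max r r'.+1%:R); exists `|B| => M v vr /=.
  apply: (sup_range_norm point); apply: (cutoff_mul_bounded (F := fun y => eval psi (vcons y v))) => x xr.
  apply: BP; apply: vcons_gauge; first by rewrite le_max xr orbT.
  by move=> i; rewrite le_max vr.
- have [B BP] := IH (Num.max r r'.+1%:R); exists `|B| => M v vr /=.
  rewrite inf_rangeN normrN; apply: (sup_range_norm point) => x; rewrite normrN.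
  apply: (cutoff_mul_bounded (F := fun y => eval psi (vcons y v))) => {}x xr.
  apply: BP; apply: vcons_gauge; first by rewrite le_max xr orbT.
  by move=> i; rewrite le_max vr.
Qed.

Lemma quantified_bounded M n (psi : formula L n.+1) r (v : 'I_n -> M) :
  exists B, forall x, `|cutoff r (gauge x) * eval psi (vcons x v)| <= B.
Proof.
have [s vs] := common_gauge_bound v.
have [B BP] := eval_bounded psi (Num.max s%:R r.+1%:R); exists `|B|.
apply: (cutoff_mul_bounded (F := fun y => eval psi (vcons y v))) => x xr.
apply: BP; apply: vcons_gauge; first by rewrite le_max xr orbT.
by move=> i; rewrite le_max vs.
Qed.

Lemma le_eval_sup M n (psi : formula L n.+1) r (v : 'I_n -> M) x :
  cutoff r (gauge x) * eval psi (vcons x v) <= eval (FSup r psi) v.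
Proof.
have [B BP] := quantified_bounded psi r v.
by apply: (le_sup_range point x) => y; exact: le_trans (ler_norm _) (BP y).
Qed.

Lemma eval_sup_le M n (psi : formula L n.+1) r (v : 'I_n -> M) (B : R) :
  (forall x, cutoff r (gauge x) * eval psi (vcons x v) <= B) ->
  eval (FSup r psi) v <= B.
Proof. by move=> h; exact: (sup_range_le (point : M) h). Qed.

Lemma eval_inf_le M n (psi : formula L n.+1) r (v : 'I_n -> M) x :
  eval (FInf r psi) v <= cutoff r (gauge x) * eval psi (vcons x v).
Proof.
have [B BP] := quantified_bounded psi r v.
rewrite /= inf_rangeN lerNl; apply: (@le_sup_range _ _ point _ B x) => y.
by rewrite lerNl; have := BP y; rewrite ler_norml => /andP[].
Qed.

Lemma eval_inf_lt M n (psi : formula L n.+1) r (v : 'I_n -> M) (B : R) :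
  eval (FInf r psi) v < B ->
  exists x, cutoff r (gauge x) * eval psi (vcons x v) < B.
Proof.
move=> lt; apply/not_existsP => h; move: lt; rewrite ltNge => /negP; apply.
rewrite /= inf_rangeN lerNr; apply: (sup_range_le point) => x.
by rewrite lerN2 leNgt; apply/negP/h.
Qed.

Definition rlift n m (s : 'I_n -> 'I_m) (i : 'I_n.+1) : 'I_m.+1 :=
  oapp (fun j => fintype.lift ord0 (s j)) ord0 (unlift ord0 i).

Fixpoint trename n m (s : 'I_n -> 'I_m) (t : term L n) : term L m :=
  match t with
  | TVar i => TVar (s i)
  | TApp f ts => TApp f (fun i => trename s (ts i))
  end.

Fixpoint frename n (phi : formula L n) : forall m, ('I_n -> 'I_m) -> formula L m :=
  match phi in formula _ n return forall m, ('I_n -> 'I_m) -> formula L m with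
  | FPred _ P ts => fun m s => @FPred R L m P (fun i => trename s (ts i))
  | FDist _ t u => fun m s => FDist (trename s t) (trename s u)
  | FGauge _ t => fun m s => FGauge (trename s t)
  | FConn _ _ u uc phis => fun m s => FConn uc (fun i => frename (phis i) s)
  | FSup _ r psi => fun m s => FSup r (frename psi (rlift s))
  | FInf _ r psi => fun m s => FInf r (frename psi (rlift s))
  end.

Lemma teval_rename M n m (s : 'I_n -> 'I_m) (t : term L n) (v : 'I_m -> M) :
  teval (trename s t) v = teval t (v \o s).
Proof.
by elim: t => [i|f ts IH] //=; congr finterp; apply/funext => i; exact: IH.
Qed.

Lemma vcons_rlift (X : Type) n m (s : 'I_n -> 'I_m) (x : X) (v : 'I_m -> X) :
  vcons x v \o rlift s = vcons x (v \o s).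
Proof.
apply/funext => i; rewrite /vcons /rlift /=.
by case: (unliftP ord0 i) => [j|] _ /=; rewrite ?liftK ?unlift_none.
Qed.

Lemma eval_rename M n (phi : formula L n) : forall m (s : 'I_n -> 'I_m)
    (v : 'I_m -> M), eval (frename phi s) v = eval phi (v \o s).
Proof.
elim: phi => {n} [n P ts|n t u|n t|n k u uc phis IH|n r psi IH|n r psi IH] m s v /=.
- by congr pinterp; apply/funext => i; rewrite teval_rename.
- by rewrite !teval_rename.
- by rewrite teval_rename.
- by congr u; apply/rowP => i; rewrite !mxE IH.
- congr (sup _); apply/seteqP; split=> [_ [x _ <-]|_ [x _ <-]]; exists x => //; by rewrite IH vcons_rlift.
- congr (inf _); apply/seteqP; split=> [_ [x _ <-]|_ [x _ <-]]; exists x => //; by rewrite IH vcons_rlift.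
Qed.

Lemma rename_qf n (phi : formula L n) : forall m (s : 'I_n -> 'I_m),
  quantifier_free phi -> quantifier_free (frename phi s).
Proof. by elim: phi => //= *; auto. Qed.

Section embeddings.
Variables (M N : structure L) (h : M -> N).

Lemma teval_embedding n (t : term L n) (v : 'I_n -> M) : embedding h ->
  teval t (h \o v) = h (teval t v).
Proof.
move=> [_ _ hf _]; elim: t => [i|f ts IH] //=.
by rewrite hf; congr finterp; apply/funext => i; rewrite IH.
Qed.

Lemma eval_embedding n (phi : formula L n) (v : 'I_n -> M) : embedding h ->
  quantifier_free phi \/ range h = setT -> eval phi (h \o v) = eval phi v.
Proof.
move=> he; have [hd hg hf hP] := he; have tE n' (t : term L n') := teval_embedding t ^~ he.
elim: phi v => {n} [n P ts|n t u|n t|n k u uc phis IH|n r psi IH|n r psi IH] v /=.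
- move=> _; rewrite -hP; congr pinterp.
  by apply/funext => i; rewrite tE.
- by move=> _; rewrite !tE.
- by move=> _; rewrite tE.
- by move=> qs; congr u; apply/rowP => i; rewrite !mxE IH//; case: qs; auto.
- move=> [//|hT]; congr sup; apply/seteqP; split=> [_ [y _ <-]|_ [x _ <-]].
    have [x _ <-] : range h y by rewrite hT.
    exists x => //; rewrite hg -IH; last by right.
    by congr (_ * eval _ _); apply/funext => i; rewrite /vcons /=; case: (unlift ord0 i).
  exists (h x) => //; rewrite hg -IH; last by right.
  by congr (_ * eval _ _); apply/funext => i; rewrite /vcons /=; case: (unlift ord0 i).
- move=> [//|hT]; congr inf; apply/seteqP; split=> [_ [y _ <-]|_ [x _ <-]].
    have [x _ <-] : range h y by rewrite hT.
    exists x => //; rewrite hg -IH; last by right.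
    by congr (_ * eval _ _); apply/funext => i; rewrite /vcons /=; case: (unlift ord0 i).
  exists (h x) => //; rewrite hg -IH; last by right.
  by congr (_ * eval _ _); apply/funext => i; rewrite /vcons /=; case: (unlift ord0 i).
Qed.

End embeddings.

Lemma embedding_comp M N (P : structure L) (h : M -> N) (k : N -> P) :
  embedding h -> embedding k -> embedding (k \o h).
Proof.
move=> [h1 h2 h3 h4] [k1 k2 k3 k4]; split=> [x y|x|f x|Q x] /=.
- by rewrite k1.
- by rewrite k2.
- by rewrite h3 k3.
- by rewrite -h4 -k4.
Qed.

Lemma isomorphic_model M N T : isomorphic M N -> model M T <-> model N T.
Proof.
move=> [h [he hT]]; have E phi : eval phi (@vnil M) = eval phi (@vnil N).
  rewrite -(eval_embedding (h := h) _ he); last by right.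
  by congr eval; apply/funext => -[].
by split=> mT phi Tphi; rewrite ?E ?mT// -E mT.
Qed.

Lemma isomorphic_sym M N : isomorphic M N ->
  exists (h : M -> N) (k : N -> M), [/\ embedding h, embedding k, cancel h k & cancel k h].
Proof.
move=> [h [he hT]]; have [h1 h2 h3 h4] := he.
have /choice[k hk] y : exists x, h x = y.
  have [x _ <-] : range h y by rewrite hT.
  by exists x.
have kh : cancel h k.
  by move=> x; apply: mdist_positivity; rewrite -h1 hk mdistxx.
exists h, k; split=> //; split=> [x y|y|f y|P y].
- by rewrite -h1 !hk.
- by rewrite -h2 hk.
- rewrite -[RHS]kh h3; congr k; congr finterp; apply/funext => i.
  by rewrite /= hk.
- by rewrite -h4; congr pinterp; apply/funext => i; rewrite /= hk.
Qed.

Lemma term_ucont n (t : term L n) (r e : R) : 0 < e -> exists d, 0 < d /\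
  forall M (v w : 'I_n -> M), (forall i, gauge (v i) <= r) ->
    (forall i, gauge (w i) <= r) -> (forall i, mdist (v i) (w i) < d) ->
    mdist (teval t v) (teval t w) <= e.
Proof.
elim: t e => [i|f ts IH] e e0; first by exists e; split=> // M v w _ _ vw; exact: ltW (vw i).
have /choice[b bP] i := term_bounded (ts i) r; have [B BP] := finite_upper_bound b.
pose m := fmodulus f B e / 2.
have m0 : 0 < m by rewrite divr_gt0 ?fmodulus_gt0.
have /choice[d dP] i := IH i _ m0.
have [d' [d'0 d'd]] := finite_lower_bound (fun i => proj1 (dP i)).
exists d'; split=> // M v w vr wr vw /=; apply: (@finterp_ucont _ _ _ _ B) => // i.
- exact: le_trans (bP i M v vr) (BP i).
- exact: le_trans (bP i M w wr) (BP i).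
apply: (@le_lt_trans _ _ m); last first.
  by rewrite ltr_pdivrMr// ltr_pMr ?fmodulus_gt0// ltr1n.
by apply: (proj2 (dP i)) => // j; exact: lt_le_trans (vw j) (d'd i).
Qed.

Lemma qf_ucont n (phi : formula L n) (r e : R) : quantifier_free phi -> 0 < e ->
  exists d, 0 < d /\
  forall M (v w : 'I_n -> M), (forall i, gauge (v i) <= r) ->
    (forall i, gauge (w i) <= r) -> (forall i, mdist (v i) (w i) < d) ->
    `|eval phi v - eval phi w| <= e.
Proof.
elim: phi e => {n} [n P ts|n t u|n t|n k u uc phis IH|n r' psi IH|n r' psi IH] e //= qf e0.
- have /choice[b bP] i := term_bounded (ts i) r; have [B BP] := finite_upper_bound b.
  pose m := pmodulus P B e / 2.
  have m0 : 0 < m by rewrite divr_gt0 ?pmodulus_gt0.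
  have /choice[d dP] i := term_ucont (ts i) r m0.
  have [d' [d'0 d'd]] := finite_lower_bound (fun i => proj1 (dP i)).
  exists d'; split=> // M v w vr wr vw /=; apply: (@pinterp_ucont _ _ _ _ B) => // i.
  + exact: le_trans (bP i M v vr) (BP i).
  + exact: le_trans (bP i M w wr) (BP i).
  apply: (@le_lt_trans _ _ m); last first.
    by rewrite ltr_pdivrMr// ltr_pMr ?pmodulus_gt0// ltr1n.
  by apply: (proj2 (dP i)) => // j; exact: lt_le_trans (vw j) (d'd i).
- have e2 : 0 < e / 2 by rewrite divr_gt0.
  have [d [d0 dP]] := term_ucont t r e2; have [d' [d'0 d'P]] := term_ucont u r e2.
  exists (Num.min d d'); split; first by rewrite lt_min d0.
  move=> M v w vr wr vw; have h1 : mdist (teval t v) (teval t w) <= e / 2.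
    by apply: dP => // i; have := vw i; rewrite lt_min => /andP[].
  have h2 : mdist (teval u v) (teval u w) <= e / 2.
    by apply: d'P => // i; have := vw i; rewrite lt_min => /andP[].
  rewrite ler_norml; apply/andP; split.
    have := metric_triangle (teval t w) (teval t v) (teval u w).
    have := metric_triangle (teval t v) (teval u v) (teval u w).
    by rewrite (metric_sym (teval t w) (teval t v)) => *; lra.
  have := metric_triangle (teval t v) (teval t w) (teval u v).
  have := metric_triangle (teval t w) (teval u w) (teval u v).
  by rewrite (metric_sym (teval u w) (teval u v)) => *; lra.
- have [d [d0 dP]] := term_ucont t r e0; exists d; split=> // M v w vr wr vw.
  exact: le_trans (gauge_lip _ _) (dP _ _ _ vr wr vw).
- have /choice[b bP] i := eval_bounded (phis i) r; have [B BP] := finite_upper_bound b.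
  have [m [m0 mP]] := box_unif B uc e0.
  have /choice[d dP] i := IH i _ (qf i) m0.
  have [d' [d'0 d'd]] := finite_lower_bound (fun i => proj1 (dP i)).
  exists d'; split=> // M v w vr wr vw; apply: mP => i; rewrite !mxE.
    exact: le_trans (bP i M v vr) (BP i).
  by apply: (proj2 (dP i)) => // j; exact: lt_le_trans (vw j) (d'd i).
Qed.

End FormulaSemantics.

(** * Theories of classes of structures *)

Section Transfer.
Context (R : realType) (L : signature R).
Implicit Types (M N : structure L) (T : theory L).

Lemma lipschitz_continuous k (u : 'rV[R]_k -> R) (C : R) :
  (forall x y, `|u x - u y| <= C * \sum_i `|x ord0 i - y ord0 i|) -> continuous u.
Proof.
move=> uL x; apply/(@cvgrPdist_lt R R^o _ (nbhs x) (nbhs_filter x)) => e e0.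
pose D := (`|C| + 1) * (k%:R + 1); have D0 : 0 < D by rewrite mulr_gt0// ltr_wpDl.
have d0 : 0 < e / D by rewrite divr_gt0.
apply/nbhs_ballP; exists (e / D) => //= y [_ xy].
have h : \sum_i `|x ord0 i - y ord0 i| <= k%:R * (e / D).
  rewrite mulr_natl -[k in _ *+ k]card_ord -sumr_const ler_sum// => i _.
  by have := xy ord0 i; rewrite -ball_normE => /ltW.
have s0 : 0 <= \sum_i `|x ord0 i - y ord0 i| by rewrite sumr_ge0.
apply: le_lt_trans (uL x y) _.
apply: (@le_lt_trans _ _ ((`|C| + 1) * (k%:R * (e / D)))).
  apply: (@le_trans _ _ ((`|C| + 1) * \sum_i `|x ord0 i - y ord0 i|)).
    by rewrite ler_wpM2r// (le_trans (ler_norm C))// lerDl.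
  by rewrite ler_wpM2l// addr_ge0.
have -> : (`|C| + 1) * (k%:R * (e / D)) = (`|C| + 1) * k%:R * e / D by rewrite !mulrA.
rewrite ltr_pdivrMr// [ltRHS]mulrC ltr_pM2r// /D ltr_pM2l ?ltrDl//.
by rewrite ltr_wpDl.
Qed.

Lemma sum_diff_le k (c : 'I_k -> R) (x y : 'rV[R]_k) :
  `|\sum_i c i * x ord0 i - \sum_i c i * y ord0 i| <=
    (\sum_i `|c i|) * \sum_i `|x ord0 i - y ord0 i|.
Proof.
rewrite -sumrB (le_trans (ler_norm_sum _ _ _))// mulr_suml ler_sum// => i _.
rewrite -mulrBr normrM ler_wpM2l// (bigD1 i)//= lerDl sumr_ge0//.
Qed.

Lemma affine_continuous k (c : 'I_k -> R) (b : R) :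
  continuous (fun x : 'rV[R]_k => \sum_i c i * x ord0 i + b).
Proof.
apply: (lipschitz_continuous (C := \sum_i `|c i|)) => x y.
by rewrite opprD addrACA subrr addr0 sum_diff_le.
Qed.

Lemma deviation_continuous k (c : 'I_k -> R) :
  continuous (fun x : 'rV[R]_k => \sum_i `|x ord0 i - c i|).
Proof.
apply: (lipschitz_continuous (C := 1)) => x y; rewrite mul1r.
rewrite -sumrB (le_trans (ler_norm_sum _ _ _))// ler_sum// => i _.
by rewrite (le_trans (ler_dist_dist _ _))// opprB addrA subrK.
Qed.

Lemma max0_continuous : continuous (fun x : 'rV[R]_1 => Num.max 0 (x ord0 ord0)).
Proof.
apply: (lipschitz_continuous (C := 1)) => x y; rewrite mul1r big_ord1.
set a := x _ _; set b := y _ _.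
have h1 : a - b <= `|a - b| by exact: ler_norm.
have h2 : b - a <= `|a - b| by rewrite distrC ler_norm.
by have := normr_ge0 (a - b); case: (lerP 0 a) => ha; case: (lerP 0 b) => hb h0;
  rewrite ler_norml; apply/andP; split; lra.
Qed.

Definition faffine n k (c : 'I_k -> R) (b : R) (phis : 'I_k -> formula L n) :=
  FConn (@affine_continuous k c b) phis.

Definition fdev n k (phis : 'I_k -> formula L n) (c : 'I_k -> R) :=
  FConn (@deviation_continuous k c) phis.

(** Sentences express equalities to 0; the positive part turns inequalities into
such equalities. *)
Definition fpos n (phi : formula L n) := FConn max0_continuous (fun=> phi).

Definition faffine2 n (a : R) (phi : formula L n) (b : R) (psi : formula L n) (c : R) :=
  faffine (fun i : 'I_2 => if i == ord0 then a else b) c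
    (fun i => if i == ord0 then phi else psi).

Lemma eval_affine n k c b (phis : 'I_k -> formula L n) M (v : 'I_n -> M) :
  eval (faffine c b phis) v = \sum_i c i * eval (phis i) v + b.
Proof. by rewrite /=; congr (_ + _); apply: eq_bigr => i _; rewrite mxE. Qed.

Lemma eval_dev n k (phis : 'I_k -> formula L n) c M (v : 'I_n -> M) :
  eval (fdev phis c) v = \sum_i `|eval (phis i) v - c i|.
Proof. by rewrite /=; apply: eq_bigr => i _; rewrite mxE. Qed.

Lemma eval_pos n (phi : formula L n) M (v : 'I_n -> M) :
  eval (fpos phi) v = Num.max 0 (eval phi v).
Proof. by rewrite /= mxE. Qed.

Lemma eval_affine2 n a (phi : formula L n) b psi c M (v : 'I_n -> M) :
  eval (faffine2 a phi b psi c) v = a * eval phi v + b * eval psi v + c.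
Proof. by rewrite eval_affine !big_ord_recl big_ord0 addr0. Qed.

Lemma affine2_qf n a (phi : formula L n) b psi c :
  quantifier_free phi -> quantifier_free psi ->
  quantifier_free (faffine2 a phi b psi c).
Proof. by move=> q1 q2 /= i; case: ifP. Qed.

Section theory_of.
Variable C : structure L -> Prop.

Lemma theory_of_model M : C M -> model M (theory_of C).
Proof. by move=> CM phi; exact. Qed.

(** The universal closure of the positive part of phi is a sentence of the theory.  The
margin between r and r + 1 is the one over which the cutoff of a quantifier decreases
from 1 to 0. *)
Lemma theory_of_le n (phi : formula L n) (r : nat) :
  (forall M (v : 'I_n -> M), C M -> (forall i, gauge (v i) <= r.+1%:R) ->
     eval phi v <= 0) ->
  forall M (v : 'I_n -> M), model M (theory_of C) ->
    (forall i, gauge (v i) <= r%:R) -> eval phi v <= 0.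
Proof.
suff key m (psi : formula L m) : exists chi : formula L 0,
    (forall M, (forall v : 'I_m -> M, (forall i, gauge (v i) <= r.+1%:R) ->
       eval psi v = 0) -> eval chi (@vnil M) = 0) /\
    (forall M, (forall v : 'I_m -> M, 0 <= eval psi v) -> forall v : 'I_m -> M,
       (forall i, gauge (v i) <= r%:R) -> eval psi v <= eval chi (@vnil M)).
  move=> phi0 M v MT vr; have [chi [chi0 chi_ge]] := key _ (fpos phi).
  have := chi_ge M _ v vr; rewrite MT.
    rewrite eval_pos => h; apply: le_trans (h _) => [|w].
      by rewrite le_max lexx orbT.
    by rewrite eval_pos le_max lexx.
  move=> N CN; apply: chi0 => w wr; rewrite eval_pos max_l//; exact: phi0.
elim: m psi => [|m IH] psi.
  exists psi; split=> M h => [|v _]; first by apply: h => -[].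
  by rewrite (_ : v = @vnil M)//; apply/funext => -[].
have [chi [chi0 chi_ge]] := IH (FSup r psi); exists chi; split=> M h.
  apply: chi0 => v vr; apply/eqP; rewrite eq_le; apply/andP; split.
    apply: eval_sup_le => x; have [xr|/ltW xr] := lerP (gauge x) r.+1%:R.
      by rewrite h ?mulr0//; exact: vcons_gauge.
    by rewrite cutoff0// mul0r.
  have [xr|/ltW xr] := lerP (gauge (point : M)) r.+1%:R.
    apply: le_trans (le_eval_sup psi r v point).
    by rewrite h ?mulr0//; exact: vcons_gauge.
  apply: le_trans (le_eval_sup psi r v point).
  by rewrite cutoff0// mul0r.
move=> v vr; have hs (w : 'I_m -> M) : 0 <= eval (FSup r psi) w.
  apply: le_trans (le_eval_sup psi r w point).
  by apply: mulr_ge0; [have /andP[] := cutoff01 r (gauge (point : M))|exact: h].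
apply: le_trans (chi_ge M hs (fun i => v (fintype.lift ord0 i)) _); last by move=> i; exact: vr.
apply: le_trans (le_eval_sup psi r _ (v ord0)).
rewrite cutoff1 ?mul1r//; apply/eqP/eqP; rewrite le_eqVlt; apply/orP; left.
apply/eqP; congr (eval psi _); apply/funext => i; rewrite /vcons.
by case: (unliftP ord0 i) => [j|] ->.
Qed.

(** The quantified formula is phi - 1 rather than phi: points excluded by the cutoff then
contribute 0 and not a competing small value, so an infimum close to -1 is attained
within the gauge ball. *)
Lemma theory_of_ex n (phi : formula L n.+1) (s r : nat) :
  (forall M (v : 'I_n -> M), C M -> (forall i, gauge (v i) <= s.+1%:R) ->
     forall e, 0 < e -> exists x, gauge x <= r%:R /\ eval phi (vcons x v) <= e) ->
  forall M (v : 'I_n -> M), model M (theory_of C) ->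
    (forall i, gauge (v i) <= s%:R) ->
    forall e, 0 < e -> exists x, gauge x <= r.+1%:R /\ eval phi (vcons x v) <= e.
Proof.
move=> phiC M v MT vs e e0.
pose chi := FInf r (faffine2 1 phi 0 phi (-1)).
have chiE N (w : 'I_n.+1 -> N) : eval (faffine2 1 phi 0 phi (-1)) w = eval phi w - 1.
  by rewrite eval_affine2 mul1r mul0r addr0.
have := theory_of_le (phi := faffine2 1 chi 0 chi 1) (r := s) _ MT vs.
rewrite eval_affine2 mul1r mul0r addr0 => h.
pose e' := Num.min e (1 / 2); have e'0 : 0 < e' by rewrite lt_min e0 divr_gt0.
have [|x] := @eval_inf_lt _ _ M n (faffine2 1 phi 0 phi (-1)) r v (- 1 + e').
  apply: (@le_lt_trans _ _ (-1)); last by rewrite ltrDl.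
  rewrite -subr_le0 opprK; apply: h => N w CN ws.
  rewrite eval_affine2 mul1r mul0r addr0 -lerBrDr sub0r.
  apply/ler_addgt0Pr => d d0; have [x [xr xd]] := phiC N w CN ws d d0.
  apply: le_trans (eval_inf_le _ _ _ x) _.
  by rewrite cutoff1// mul1r chiE; lra.
rewrite chiE; have [c0 c1] := andP (cutoff01 r (gauge x)).
have e'2 : e' <= 1 / 2 by rewrite ge_min lexx orbT.
move=> lt; exists x; split.
  rewrite leNgt; apply/negP => /ltW xr; move: lt; rewrite cutoff0// mul0r.
  by lra.
have e'e : e' <= e by rewrite ge_min lexx.
apply: le_trans e'e; rewrite leNgt; apply/negP => gt.
have : cutoff r (gauge x) * (1 - eval phi (vcons x v)) <= 1 - e'.
  have [p|p] := lerP 0 (1 - eval phi (vcons x v)).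
    rewrite (@le_trans _ _ (1 - eval phi (vcons x v)))//; first by rewrite ler_piMl.
    by lra.
  rewrite (@le_trans _ _ 0)//; last by lra.
  by rewrite mulr_ge0_le0// ltW.
by rewrite mulrBr mulr1 in lt *; lra.
Qed.

End theory_of.

End Transfer.

(** * Presentations, and formulas as functions of types *)

Section Presentations.
Context (R : realType) (L : signature R).
Implicit Types (M N : structure L) (E F G H : completeNormedModType R).

(** The uniform forall-exists conditions satisfied by all the structures S E hold in M.
The margins s + 2 and r + 1 leave room for the unit losses of [theory_of_ex] and of a
perturbation of the parameters. *)
Definition ae_closed (S : completeNormedModType R -> structure L) M :=
  forall n (phi : formula L n.+1) (s r : nat), quantifier_free phi ->
  (forall E (v : 'I_n -> S E), (forall i, gauge (v i) <= s.+2%:R) ->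
     forall e, 0 < e -> exists x, gauge x <= r%:R /\ eval phi (vcons x v) <= e) ->
  forall v : 'I_n -> M, (forall i, gauge (v i) <= s%:R) ->
  forall e, 0 < e -> exists x, gauge x <= r.+1%:R /\ eval phi (vcons x v) <= e.

(** What whole spaces and unit balls have in common: [vec_of] sends a point of the
structure to the vector it stands for, and the trivial gauge marks the bounded case.
Unit balls define only multiples of integer combinations, whence the
perturbation in [combination_formula]. *)
Record presentation := Presentation {
  struct_of : completeNormedModType R -> structure L;
  vec_of : forall E, struct_of E -> E;
  vec_inj : forall E, injective (@vec_of E);
  mdist_vec : forall E (x y : struct_of E), mdist x y = `|vec_of x - vec_of y|;
  gauge_vec : forall E (x : struct_of E),
    gauge x = if trivial_gauge L then 0 else `|vec_of x|;
  vec_le1 : forall E (x : struct_of E), trivial_gauge L -> `|vec_of x| <= 1;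
  vec_surj : forall E (x : E), (trivial_gauge L -> `|x| <= 1) ->
    exists y : struct_of E, vec_of y = x;
  fcoef : forall f : fsym L, 'I_(far f) -> R;
  finterp_vec : forall E (f : fsym L) (x : 'I_(far f) -> struct_of E),
    vec_of (finterp x) = \sum_i fcoef i *: vec_of (x i);
  pcoef : forall P : psym L, 'I_(par P) -> R;
  pinterp_vec : forall E (P : psym L) (x : 'I_(par P) -> struct_of E),
    pinterp x = `|\sum_i pcoef i *: vec_of (x i)|;
  combination_formula : forall n (l : 'I_n -> R) e, 0 < e ->
    exists (psi : formula L n) (l' : 'I_n -> R), [/\ quantifier_free psi,
      forall i, `|l' i - l i| <= e
    & forall E (v : 'I_n -> struct_of E), eval psi v = `|\sum_i l' i *: vec_of (v i)|];
  ae_closed_banach : forall M, ae_closed struct_of M -> exists E, isomorphic M (struct_of E) }.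

Variable P : presentation.
Local Notation S := (struct_of P).
Local Notation T := (theory_of (fun M => exists E, M = S E)).
Local Notation vec := (@vec_of P _).

Lemma model_ae_closed M : model M T -> ae_closed S M.
Proof.
move=> MT n phi s r _ h v vs e e0; apply: (theory_of_ex _ MT vs e0).
move=> M1 w [E ME]; subst M1 => ws; apply: h => i.
by rewrite (le_trans (ws i))// ler_nat.
Qed.

(** Finitely many parameters are approximated within a single member of the chain; a
witness found there remains one for the original parameters by uniform continuity of
quantifier-free formulas. *)
Lemma chain_ae_closed (J : Type) (M : J -> structure L) (N : structure L)
    (g : forall j, M j -> N) : inhabited J ->
  (forall j, model (M j) T) -> (forall j, embedding (g j)) ->
  (forall i j, range (g i) `<=` range (g j) \/ range (g j) `<=` range (g i)) ->
  dense (\bigcup_(j in [set: J]) range (g j)) -> ae_closed S N.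
Proof.
move=> [j0] MT ge chain gd n phi s r qf h v vs e e0.
have e2 : 0 < e / 2 by rewrite divr_gt0.
pose b : R := Num.max s.+1%:R r.+1%:R.
have [d [d0 dP]] := qf_ucont b qf e2.
pose t := Num.min d 1; have t0 : 0 < t by rewrite lt_min d0 ltr01.
have near i : exists j (y : M j), mdist (v i) (g j y) < t.
  have [||y [/= yt [j _ [z _ zy]]]] := gd (ball (v i) t)^°.
  - by exists (v i); exact: nbhsx_ballx.
  - exact: open_interior.
  by exists j, z; rewrite zy; have := interior_subset yt; rewrite ballEmdist.
have /choice[k kP] := near.
have top m (f : 'I_m -> J) : exists j, forall i, range (g (f i)) `<=` range (g j).
  elim: m f => [|m IH] f; first by exists j0 => -[].
  have [j jP] := IH (f \o fintype.lift ord0).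
  have [fj|jf] := chain (f ord0) j.
    exists j => i; have [i'|] := unliftP ord0 i; first by move->; exact: jP.
    by move->.
  exists (f ord0) => i; have [i'|] := unliftP ord0 i; last by move->.
  by move->; apply: subset_trans jf; exact: jP.
have [j jP] := top _ k.
have /choice[w wP] i : exists y : M j, mdist (v i) (g j y) < t.
  have [y yt] := kP i; have [z _ zy] : range (g j) (g (k i) y) by apply: (jP i); exists y.
  by exists z; rewrite zy.
have [gd1 gg _ _] := ge j.
have ws i : gauge (w i) <= s.+1%:R.
  rewrite -gg -natr1 -lerBlDr (le_trans _ (vs i))// lerBlDl -lerBlDr.
  have := gauge_lip (g j (w i)) (v i).
  have := wP i; rewrite metric_sym lt_min => /andP[_ /ltW h1] h2.
  exact: le_trans (ler_norm _) (le_trans h2 h1).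
have [x [xr xe]] : exists x : M j, gauge x <= r.+1%:R /\ eval phi (vcons x w) <= e / 2.
  apply: (theory_of_ex _ (MT j) ws e2).
  by move=> M1 u [E ME]; subst M1 => us; exact: h.
exists (g j x); rewrite gg; split=> //.
have eq : eval phi (g j \o vcons x w) = eval phi (vcons x w).
  by apply: eval_embedding; [exact: ge|left].
have := dP N (vcons (g j x) v) (g j \o vcons x w); rewrite eq => h1.
rewrite -[eval _ _](subrK (eval phi (vcons x w))) (splitr e) lerD//.
apply: le_trans (ler_norm _) _; apply: h1.
- apply: vcons_gauge => [|i]; first by rewrite gg le_max xr orbT.
  by rewrite le_max (le_trans (vs i)) ?ler_nat.
- move=> i /=; rewrite gg; apply: vcons_gauge => [|i']; first by rewrite le_max xr orbT.
  by rewrite le_max ws.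
- move=> i; rewrite /vcons /=; case: (unlift ord0 i) => [i'|] /=.
    by have := wP i'; rewrite lt_min => /andP[].
  by rewrite mdistxx.
Qed.

Lemma vec_le (r : R) E (x : S E) : gauge x <= r -> `|vec x| <= Num.max r 1.
Proof.
rewrite gauge_vec le_max; case: ifPn => [tr _|_ ->//].
by rewrite vec_le1 ?orbT.
Qed.

Lemma gauge_le E (x : S E) : gauge x <= `|vec x|.
Proof. by rewrite gauge_vec; case: ifP. Qed.

Lemma gauge_close E F (x : S E) (y : S F) :
  `|gauge x - gauge y| <= `| `|vec x| - `|vec y| |.
Proof. by rewrite !gauge_vec; case: ifP => // _; rewrite subrr normr0. Qed.

Lemma comb_comb (V : lmodType R) (I J : finType) (a : I -> R) (c : I -> J -> R)
    (x : J -> V) :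
  \sum_i a i *: (\sum_j c i j *: x j) = \sum_j (\sum_i a i * c i j) *: x j.
Proof.
under eq_bigr do rewrite scaler_sumr.
rewrite exchange_big /=; apply: eq_bigr => j _.
by rewrite scaler_suml; apply: eq_bigr => i _; rewrite scalerA.
Qed.

Lemma term_coefs n (t : term L n) : exists c : 'I_n -> R, forall E (v : 'I_n -> S E),
  vec (teval t v) = \sum_i c i *: vec (v i).
Proof.
elim: t => [i|f ts IH].
  by exists (fun j => (j == i)%:R) => E v; rewrite comb1.
have /choice[c cP] := IH.
exists (fun i => \sum_k fcoef P k * c k i) => E v /=; rewrite finterp_vec.
transitivity (\sum_i fcoef P i *: \sum_k c i k *: vec (v k)).
  by apply: eq_bigr => i _; rewrite cP.
exact: comb_comb.
Qed.

(** In a unit ball, a vector of norm at most 1 + t is within t of its product with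
1 / (1 + t). *)
Lemma nearest_point E (b : E) (t : R) : 0 <= t ->
  (trivial_gauge L -> `|b| <= 1 + t) -> exists y : S E, `|b - vec y| <= t.
Proof.
move=> t0 bt; have [tr|tr] := boolP (trivial_gauge L); last first.
  have [|y <-] := @vec_surj P E b; first by rewrite (negPf tr).
  by exists y; rewrite subrr normr0.
have t1 : 0 < 1 + t by rewrite ltr_wpDr.
have [_|y yE] := @vec_surj P E ((1 + t)^-1 *: b).
  by rewrite normrZ normfV (gtr0_norm t1) ler_pdivrMl// mulr1 bt.
exists y; rewrite yE -[X in `|X - _|]scale1r -scalerBl normrZ.
have -> : 1 - (1 + t)^-1 = t / (1 + t).
  have t1n : 1 + t != 0 by rewrite gt_eqF.
  by apply: (mulIf t1n); rewrite mulrBl mul1r mulVf// divfK// addrC addKr.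
rewrite normrM normfV (gtr0_norm t1) (ger0_norm t0) -mulrA ler_piMr//.
by rewrite ler_pdivrMl// mulr1 bt.
Qed.

Lemma tpclose_vcons d n E F (v : 'I_n -> S E) (w : 'I_n -> S F) x y : 0 <= d ->
  tpclose d (oapp (fun i => vec (v i)) (vec x)) (oapp (fun i => vec (w i)) (vec y)) ->
  tpclose d (fun i => vec (vcons x v i)) (fun i => vec (vcons y w i)).
Proof.
move=> d0 h; have e X (u : 'I_n -> S X) z : (fun i => vec (vcons z u i)) =
    oapp (fun i => vec (u i)) (vec z) \o unlift ord0.
  by apply/funext => i; rewrite /vcons /=; case: (unlift ord0 i).
by rewrite !e; exact: tpclose_pull.
Qed.

(** The Gurarij property, for points of the structure rather than vectors; in the
bounded case the imitating vector may leave the unit ball by d + e / 2 and is moved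
back. *)
Lemma game_step n G H (v : 'I_n -> S G) (w : 'I_n -> S H) d x e : gurarii H ->
  0 <= d -> tpclose d (fun i => vec (v i)) (fun i => vec (w i)) -> 0 < e ->
  exists y : S H, tpclose (2 * d + e) (fun i => vec (vcons x v i))
                                      (fun i => vec (vcons y w i)).
Proof.
move=> gH d0 vw e0; have e2 : 0 < e / 2 by rewrite divr_gt0.
have [b bP] := gH _ _ _ _ (vec x) _ d0 (tpclose_sym vw) _ e2.
have de : 0 <= d + e / 2 by rewrite addr_ge0// ltW.
have [tr|y by_] := nearest_point (b := b) de.
  have := tpclose_norm None bP; rewrite /= ler_norml => /andP[_ h].
  by have := vec_le1 x tr; lra.
exists y; apply: tpclose_vcons; first by rewrite addr_ge0 ?mulr_ge0// ltW.
have -> : 2 * d + e = (d + e / 2) + (d + e / 2) by lra.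
apply: (tpclose_trans (tpclose_sym bP)); apply: tpclose_near => -[i|] //=.
by rewrite subrr normr0.
Qed.

Definition type_continuous n (phi : formula L n) (good : completeNormedModType R -> Prop) :=
  forall r e : R, 0 < e -> exists d, 0 < d /\ forall E F, good E -> good F ->
  forall (v : 'I_n -> S E) (w : 'I_n -> S F),
    (forall i, `|vec (v i)| <= r) -> (forall i, `|vec (w i)| <= r) ->
    tpclose d (fun i => vec (v i)) (fun i => vec (w i)) ->
    `|eval phi v - eval phi w| <= e.

(** A move of one player is answered by [game_step]; the values of the quantified body
and of the cutoff at the two moves are then close. *)
Lemma quantifier_step n (psi : formula L n.+1) r'
    (good : completeNormedModType R -> Prop) :
  (forall G, good G -> gurarii G) -> type_continuous psi good ->
  forall r e : R, 0 < e -> exists d, 0 < d /\ forall G H, good G -> good H ->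
  forall (v : 'I_n -> S G) (w : 'I_n -> S H),
    (forall i, `|vec (v i)| <= r) -> (forall i, `|vec (w i)| <= r) ->
    tpclose d (fun i => vec (v i)) (fun i => vec (w i)) ->
    forall x, exists y, `|cutoff r' (gauge x) * eval psi (vcons x v) -
                          cutoff r' (gauge y) * eval psi (vcons y w)| <= e.
Proof.
move=> gg IH r e e0; pose r2 : R := Num.max r r'.+3%:R.
have e2 : 0 < e / 2 by rewrite divr_gt0.
have [d1 [d10 d1P]] := IH r2 _ e2; have [B BP] := eval_bounded psi r2.
pose d := Num.min (Num.min d1 (e / 2 / (`|B| + 1))) 1.
have B1 : 0 < `|B| + 1 by rewrite ltr_wpDl.
have d0 : 0 < d by rewrite !lt_min d10 divr_gt0//= ltr01.
have dd1 : d <= d1 by rewrite !ge_min lexx.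
have d1' : d <= 1 by rewrite ge_min lexx orbT.
have dB : d * (`|B| + 1) <= e / 2.
  by rewrite -ler_pdivlMr// !ge_min lexx orbT.
exists (d / 4); split; first by rewrite divr_gt0.
move=> G H gG gH v w vr wr vw x; have d4 : 0 <= d / 4 by rewrite divr_ge0 ?(ltW d0).
have dh : 0 < d / 2 by rewrite divr_gt0.
have [y yP] := game_step x (gg _ gH) d4 vw dh; exists y.
have {}yP : tpclose d (fun i => vec (vcons x v i)) (fun i => vec (vcons y w i)).
  by apply: tpclose_le yP; lra.
have xy : `| `|vec x| - `|vec y| | <= d.
  have := tpclose_norm ord0 yP.
  by rewrite /vcons unlift_none.
have gxy := le_trans (gauge_close x y) xy.
have [xr|xr] := lerP (gauge x) r'.+2%:R; last first.
  rewrite cutoff0; last by rewrite (le_trans _ (ltW xr))// ler_nat.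
  rewrite cutoff0 ?mul0r ?subrr ?normr0 ?(ltW e0)//.
  by move: gxy xr; rewrite -natr1 ler_norml => /andP[_]; lra.
have x2 : `|vec x| <= r'.+2%:R.
  by have := vec_le xr; rewrite max_l// ler1n.
have y3 : `|vec y| <= r'.+3%:R.
  by rewrite -(natr1 r'.+2); move: xy; rewrite ler_norml => /andP[]; lra.
have x3 : `|vec x| <= r'.+3%:R by rewrite (le_trans x2)// ler_nat.
have vc X (u : 'I_n -> S X) z : (forall i, `|vec (u i)| <= r) ->
    `|vec z| <= r'.+3%:R -> forall i, `|vec (vcons z u i)| <= r2.
  move=> ur zr i; rewrite /vcons le_max; case: (unlift ord0 i) => [j|] /=.
    by rewrite ur.
  by rewrite zr orbT.
have hv := vc _ _ _ vr x3; have hw := vc _ _ _ wr y3.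
have ps := d1P _ _ gG gH _ _ hv hw (tpclose_le dd1 yP).
have pB : `|eval psi (vcons x v)| <= `|B|.
  apply: le_trans (ler_norm B); apply: BP => i; exact: le_trans (gauge_le _) (hv i).
have cc := le_trans (cutoff_lip r' (gauge x) (gauge y)) gxy.
have /andP[c0 c1] := cutoff01 r' (gauge y).
set cx := cutoff _ _ in cc *; set cy := cutoff _ _ in cc c0 c1 *.
set px := eval _ _ in ps pB *; set py := eval _ _ in ps *.
have -> : cx * px - cy * py = (cx - cy) * px + cy * (px - py) by ring.
rewrite (le_trans (ler_normD _ _))// !normrM (splitr e) lerD//.
  apply: le_trans dB; apply: ler_pM => //.
  by rewrite (le_trans pB)// lerDl.
by rewrite (ger0_norm c0) (le_trans _ ps)// ler_piMl.
Qed.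

(** In Gurarij spaces a formula is uniformly continuous, on bounded tuples, in the norms
of linear combinations.  Quantifier-free formulas have this continuity in all Banach
spaces, since terms are linear combinations and atomic formulas are norms of those. *)
Lemma formula_type_continuous n (phi : formula L n)
    (good : completeNormedModType R -> Prop) :
  quantifier_free phi \/ (forall E, good E -> gurarii E) -> type_continuous phi good.
Proof.
have comb n' E F (v : 'I_n' -> S E) (w : 'I_n' -> S F) (l : 'I_n' -> R) d e :
    tpclose d (fun i => vec (v i)) (fun i => vec (w i)) ->
    d * \sum_i `|l i| <= e ->
    `| `|\sum_i l i *: vec (v i)| - `|\sum_i l i *: vec (w i)| | <= e.
  by move=> vw; apply: le_trans; exact: vw.
have small k (c : 'I_k -> R) e : 0 < e -> exists d : R, 0 < d /\ d * \sum_i `|c i| <= e.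
  move=> e0; have s1 : 0 < \sum_i `|c i| + 1 by rewrite ltr_wpDl// sum_norm_ge0.
  exists (e / (\sum_i `|c i| + 1)); split; first by rewrite divr_gt0.
  by rewrite mulrAC ler_pdivrMr// ler_wpM2l ?(ltW e0)// lerDl.
elim: phi => {n} [n Q ts|n t u|n t|n k u uc phis IH|n r' psi IH|n r' psi IH] qg r e e0.
- have /choice[c cP] i := term_coefs (ts i).
  have [d [d0 dP]] := small _ (fun i => \sum_k pcoef P k * c k i) _ e0.
  exists d; split=> // E F _ _ v w _ _ vw /=.
  have ev X (z : 'I_n -> S X) : pinterp (fun i => teval (ts i) z) =
      `|\sum_i (\sum_k pcoef P k * c k i) *: vec (z i)|.
    rewrite pinterp_vec -comb_comb; congr `|_|.
    by apply: eq_bigr => i _; rewrite cP.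
  by rewrite !ev; exact: comb vw dP.
- have [c cP] := term_coefs t; have [c' c'P] := term_coefs u.
  have [d [d0 dP]] := small _ (fun i => c i - c' i) _ e0.
  exists d; split=> // E F _ _ v w _ _ vw /=.
  have ev X (z : 'I_n -> S X) : mdist (teval t z) (teval u z) =
      `|\sum_i (c i - c' i) *: vec (z i)|.
    rewrite mdist_vec cP c'P -sumrB; congr `|_|.
    by apply: eq_bigr => i _; rewrite scalerBl.
  by rewrite !ev; exact: comb vw dP.
- have [c cP] := term_coefs t; have [d [d0 dP]] := small _ c _ e0.
  exists d; split=> // E F _ _ v w _ _ vw /=.
  by rewrite (le_trans (gauge_close _ _))// !cP; exact: comb vw dP.
- have /choice[b bP] i := eval_bounded (phis i) r; have [B BP] := finite_upper_bound b.
  have [m [m0 mP]] := box_unif B uc e0.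
  have /choice[d dP] i : exists d, 0 < d /\ forall E F, good E -> good F ->
      forall (v : 'I_n -> S E) (w : 'I_n -> S F),
      (forall i, `|vec (v i)| <= r) -> (forall i, `|vec (w i)| <= r) ->
      tpclose d (fun i => vec (v i)) (fun i => vec (w i)) ->
      `|eval (phis i) v - eval (phis i) w| <= m.
    by apply: IH => //; case: qg => [/(_ i)|]; auto.
  have [d' [d'0 d'd]] := finite_lower_bound (fun i => proj1 (dP i)).
  exists d'; split=> // E F gE gF v w vr wr vw; apply: mP => i; rewrite !mxE.
    apply: le_trans (bP i _ v _) (BP i) => j; exact: le_trans (gauge_le _) (vr j).
  by apply: (proj2 (dP i)) => //; exact: tpclose_le vw.
- case: qg => // gg; have [d [d0 dP]] := quantifier_step r' gg (IH (or_intror gg)) r e0.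
  exists d; split=> // E F gE gF v w vr wr vw.
  have [B BP] := quantified_bounded psi r' v; have [C CP] := quantified_bounded psi r' w.
  apply: (sup_range_close (point : S E) (point : S F) (B := Num.max B C)).
  + by move=> x; rewrite le_max (le_trans (ler_norm _) (BP x)).
  + by move=> x; rewrite le_max (le_trans (ler_norm _) (CP x)) orbT.
  + by move=> x; exact: dP gE gF v w vr wr vw x.
  + move=> y; have [x xP] := dP _ _ gF gE w v wr vr (tpclose_sym vw) y.
    by exists x; rewrite distrC.
- case: qg => // gg; have [d [d0 dP]] := quantifier_step r' gg (IH (or_intror gg)) r e0.
  exists d; split=> // E F gE gF v w vr wr vw.
  have [B BP] := quantified_bounded psi r' v; have [C CP] := quantified_bounded psi r' w.
  rewrite /= !inf_rangeN -opprD normrN.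
  apply: (sup_range_close (point : S E) (point : S F) (B := Num.max B C)).
  + move=> x; have := BP x; rewrite -normrN => h.
    by rewrite le_max (le_trans (ler_norm _) h).
  + move=> x; have := CP x; rewrite -normrN => h.
    by rewrite le_max (le_trans (ler_norm _) h) orbT.
  + move=> x; have [y yP] := dP _ _ gE gF v w vr wr vw x.
    by exists y; rewrite -opprD normrN.
  + move=> y; have [x xP] := dP _ _ gF gE w v wr vr (tpclose_sym vw) y.
    by exists x; rewrite -opprD normrN distrC.
Qed.

Lemma inductive_banach : inductive_theory T.
Proof.
move=> J M N g j0 MT ge chain gd.
have [E /isomorphic_model iso] := ae_closed_banach (chain_ae_closed j0 MT ge chain gd).
by apply/iso; apply: theory_of_model; exists E.
Qed.

End Presentations.

(** * Models of the theory of Gurarij spaces *)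

Section ModelCompletion.
Context (R : realType) (L : signature R) (P : presentation L).
Implicit Types (M N : structure L) (E F G H : completeNormedModType R).
Local Notation S := (struct_of P).
Local Notation vec := (@vec_of R L P _).
Local Notation T := (theory_of (fun M => exists E, M = S E)).
Local Notation T' := (theory_of (fun M => exists G, M = S G /\ gurarii G)).

Lemma tpclose0 (J : finType) E F (a : J -> E) (c : J -> F) :
  (forall d, 0 < d -> tpclose d a c) -> tpclose 0 a c.
Proof.
move=> ac l; rewrite mul0r; apply/ler_addgt0Pr => e e0; rewrite add0r.
have s1 : 0 < \sum_j `|l j| + 1 by rewrite ltr_wpDl// sum_norm_ge0.
apply: le_trans (ac _ (divr_gt0 e0 s1) l) _.
by rewrite mulrAC ler_pdivrMr// ler_wpM2l ?(ltW e0)// lerDl.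
Qed.

(** The finite net of combinations, made of combinations that are definable. *)
Lemma net_formulas n (r d : R) : 0 < d -> exists k (psi : 'I_k -> formula L n)
    (l : 'I_k -> 'I_n -> R) (e : R),
  [/\ 0 < e, forall i, quantifier_free (psi i),
      forall i E (v : 'I_n -> S E), eval (psi i) v = `|\sum_j l i j *: vec (v j)|
    & forall E F (v : 'I_n -> E) (w : 'I_n -> F),
        (forall i, `|v i| <= r) -> (forall i, `|w i| <= r) ->
        (forall i, `| `|\sum_j l i j *: v j| - `|\sum_j l i j *: w j| | <= e) ->
        tpclose d v w].
Proof.
move=> d0; have [K [l0 [e [e0 lP]]]] := finite_net [the finType of 'I_n] r d0.
have /choice[psi psiP] k := @combination_formula _ _ P n (l0 k) e e0.
have /choice[l lpsi] := psiP.
exists #|K|, (fun i => psi (enum_val i)), (fun i => l (enum_val i)), e; split=> //.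
- by move=> i; have [] := lpsi (enum_val i).
- by move=> i; have [] := lpsi (enum_val i).
- move=> E F v w vr wr h; apply: (lP l) => // [k j|k].
    by have [] := lpsi k.
  by have := h (enum_rank k); rewrite enum_rankK.
Qed.

Lemma qf_tpclose n E F (v : 'I_n -> S E) (w : 'I_n -> S F) :
  (forall phi : formula L n, quantifier_free phi -> eval phi v = eval phi w) ->
  tpclose 0 (fun i => vec (v i)) (fun i => vec (w i)).
Proof.
move=> vw; have [B BP] := finite_upper_bound (fun i => `|vec (v i)|).
have [C CP] := finite_upper_bound (fun i => `|vec (w i)|).
apply: tpclose0 => d d0.
have [k [psi [l [e [e0 qf ev lP]]]]] := net_formulas n (Num.max B C) d0.
apply: lP => i.
- by rewrite le_max BP.
- by rewrite le_max CP orbT.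
- by rewrite -!ev vw// subrr normr0 ltW.
Qed.

Lemma scaled_point E (x : E) : exists (k : nat) (y : S E), x = k.+1%:R *: vec y.
Proof.
pose k := Num.truncn `|x|; have k0 : 0 < k.+1%:R :> R by rewrite ltr0n.
have [_|y yE] := @vec_surj _ _ P E (k.+1%:R^-1 *: x).
  rewrite normrZ normfV gtr0_norm// ler_pdivrMl// mulr1.
  by have /truncn_itv/andP[_ /ltW] := normr_ge0 x.
by exists k, y; rewrite yE scalerA divff ?scale1r// gt_eqF.
Qed.

Lemma lift_embedding E F (f : E -> F) (j : S E -> S F) : isom f ->
  (forall x, vec (j x) = f (vec x)) -> embedding j.
Proof.
move=> fi jE; have [fl fn] := fi; split=> [x y|x|g x|Q x].
- by rewrite !mdist_vec !jE isomB.
- by rewrite !gauge_vec jE fn.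
- apply: vec_inj; rewrite jE !finterp_vec lin_sum//.
  by apply: eq_bigr => i _; rewrite /= jE.
- rewrite !pinterp_vec -(isom_comb _ _ fi); congr `|_|.
  by apply: eq_bigr => i _; rewrite /= jE.
Qed.

Lemma isom_lifts E F (f : E -> F) : isom f ->
  exists j : S E -> S F, embedding j /\ forall x, vec (j x) = f (vec x).
Proof.
move=> fi; have /choice[j jE] (x : S E) : exists y : S F, vec y = f (vec x).
  by apply: vec_surj => tr; have [_ ->] := fi; exact: vec_le1.
by exists j; split=> //; exact: lift_embedding jE.
Qed.

(** An embedding preserves quantifier-free formulas, hence norms of combinations of
points of S E; integer multiples of those points exhaust E. *)
Lemma embedding_extends E F (j : S E -> S F) : embedding j ->
  exists f : E -> F, isom f /\ forall x, vec (j x) = f (vec x).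
Proof.
move=> je.
pose a (k : nat * S E) := k.1%:R *: vec k.2.
pose b (k : nat * S E) := k.1%:R *: vec (j k.2).
have [n u|x e e0|f [fi fa _]] := @extend_isometry R E F _ a b.
- move=> l; rewrite mul0r.
  have := qf_tpclose (v := fun i => (u i).2) (w := j \o (fun i => (u i).2)).
  move=> /(_ _ (fun i => l i * (u i).1%:R)); rewrite mul0r => h.
  have aE : \sum_i l i *: a (u i) = \sum_i (l i * (u i).1%:R) *: vec (u i).2.
    by apply: eq_bigr => i _; rewrite scalerA.
  have bE : \sum_i l i *: b (u i) = \sum_i (l i * (u i).1%:R) *: vec (j (u i).2).
    by apply: eq_bigr => i _; rewrite scalerA.
  rewrite aE bE; apply: h => phi qf.
  by rewrite (eval_embedding _ je)//; left.
- have [k [y ->]] := scaled_point x; exists (k.+1, y).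
  by rewrite subrr normr0.
exists f; split=> // x; have := fa (1%N, x).
by rewrite /a /b !scale1r.
Qed.

Lemma gurarii_theory_model M : model M T' -> model M T.
Proof.
by move=> MT phi Tphi; apply: MT => N [G [NG _]]; apply: Tphi; exists G.
Qed.

(** For fixed data a, c, z, scaled into the unit ball, the extension property follows from
one forall-exists condition that holds in every Gurarij space: for all u there is x such
that Phi(x, u) is at most a multiple of Th(u) plus eta / 2.  Here Th measures how far the
norms of combinations of u are from those of c, and Phi does the same for (x, u) and
(z, c).  If u imitates c then so does some x for z; otherwise Th is at least zeta and the
multiple was chosen to exceed any value of Phi. *)
Lemma model_gurarii G : model (S G) T' -> gurarii G.
Proof.
move=> GT; apply: gurarii_exact => J a F c z ac e e0.
have [s [s0 [as_ cs zs]]] : exists s : R, 0 < s /\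
    [/\ forall j, `|s *: a j| <= 1, forall j, `|s *: c j| <= 1 & `|s *: z| <= 1].
  have [A AP] := finite_upper_bound (fun j => `|a j|).
  have [C CP] := finite_upper_bound (fun j => `|c j|).
  pose D := `|A| + `|C| + `|z| + 1; have D0 : 0 < D by rewrite ltr_wpDl// !addr_ge0.
  have h X (x : X : completeNormedModType R) : `|x| <= D -> `|D^-1 *: x| <= 1.
    by move=> xD; rewrite normrZ normfV gtr0_norm// ler_pdivrMl// mulr1.
  have := ler_norm A; have := ler_norm C; have := normr_ge0 A; have := normr_ge0 C.
  have := normr_ge0 z => ? ? ? ? ?.
  exists D^-1; split; first by rewrite invr_gt0.
  by split=> [j|j|]; apply: h; rewrite /D; [have := AP j|have := CP j|]; lra.
pose n := #|J|.
have /choice[v vE] (i : 'I_n) : exists y : S G, vec y = s *: a (enum_val i).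
  by apply: vec_surj => _; exact: as_.
have /choice[w wE] (i : 'I_n) : exists y : S F, vec y = s *: c (enum_val i).
  by apply: vec_surj => _; exact: cs.
have [y0 y0E] : exists y : S F, vec y = s *: z by apply: vec_surj.
have v1 i : `|vec (v i)| <= 1 by rewrite vE.
have w1 i : `|vec (w i)| <= 1 by rewrite wE.
have y01 : `|vec y0| <= 1 by rewrite y0E.
have vw : tpclose 0 (fun i => vec (v i)) (fun i => vec (w i)).
  have -> : (fun i => vec (v i)) = (fun j => s *: a j) \o enum_val by apply/funext.
  have -> : (fun i => vec (w i)) = (fun j => s *: c j) \o enum_val by apply/funext.
  apply: tpclose_pull => //; apply: (@tpclose_scale _ _ s^-1); first by rewrite invr_gt0.
  have sK (X : completeNormedModType R) (u : J -> X) : (fun j => s^-1 *: (s *: u j)) = u.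
    by apply/funext => j; rewrite scalerA mulVf ?scale1r// gt_eqF.
  by rewrite mulr0 !sK.
have se : 0 < s * e by rewrite mulr_gt0.
have [K [psi [l [eta [eta0 qpsi psiE psiP]]]]] := net_formulas n.+1 3%:R se.
pose Phi := fdev psi (fun k => eval (psi k) (vcons y0 w)).
have qPhi : quantifier_free Phi by exact: qpsi.
have Phi0 : eval Phi (vcons y0 w) = 0.
  by rewrite eval_dev big1// => k _; rewrite subrr normr0.
have eta2 : 0 < eta / 2 by rewrite divr_gt0.
have [d1 [d10 d1P]] := formula_type_continuous P (good := xpredT) (or_introl qPhi) 3%:R eta2.
pose d := Num.min d1 1; have d0 : 0 < d by rewrite lt_min d10 ltr01.
have d4 : 0 < d / 4 by rewrite divr_gt0.
have d2 : 0 < d / 2 by rewrite divr_gt0.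
have [K' [th [l' [zeta [zeta0 qth thE thP]]]]] := net_formulas n 2%:R d4.
pose Th := fdev th (fun k => eval (th k) w).
have [B BP] := eval_bounded Phi 2%:R.
pose phi := faffine2 1 Phi (- (`|B| / zeta)) (frename Th (fintype.lift ord0)) (- (eta / 2)).
have liftE X (u : 'I_n -> X) x : vcons x u \o fintype.lift ord0 = u.
  by apply/funext => i; rewrite /vcons /= liftK.
have phiE M (x : M) u : eval phi (vcons x u) =
    eval Phi (vcons x u) - `|B| / zeta * eval Th u - eta / 2.
  by rewrite eval_affine2 eval_rename liftE mul1r mulNr.
have Th_ge0 M (u : 'I_n -> M) : 0 <= eval Th u by rewrite eval_dev sumr_ge0.
have Bz : 0 <= `|B| / zeta by rewrite divr_ge0// ltW.
have [||y [y3 yP]] := @theory_of_ex _ _ _ n phi 1 2 _ (S G) v GT _ _ eta2.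
- move=> M u [H [MH gH]] u2 t t0; subst M.
  have un i : `|vec (u i)| <= 2%:R by have := vec_le (u2 i); rewrite max_l ?ler1n.
  have [near|far] := pselect (forall k, `|eval (th k) u - eval (th k) w| <= zeta).
    have uw : tpclose (d / 4) (fun i => vec (w i)) (fun i => vec (u i)).
      apply: thP => [i|i|k]; [by rewrite (le_trans (w1 i)) ?ler1n|exact: un|].
      by rewrite -!thE distrC.
    have [x xP] := game_step y0 gH (ltW d4) uw d2.
    have {}xP : tpclose d (fun i => vec (vcons y0 w i)) (fun i => vec (vcons x u i)).
      by apply: tpclose_le xP; lra.
    have x2 : `|vec x| <= 2%:R.
      have := tpclose_norm ord0 xP; rewrite /vcons unlift_none /= ler_norml => /andP[+ _].
      have : d <= 1 by rewrite ge_min lexx orbT.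
      by lra.
    exists x; split; first exact: le_trans (gauge_le _) x2.
    rewrite phiE.
    have := d1P F H isT isT (vcons y0 w) (vcons x u) _ _ (tpclose_le _ xP).
    rewrite Phi0 sub0r normrN => h.
    have {}h : `|eval Phi (vcons x u)| <= eta / 2.
      apply: h => [i|i|]; last by rewrite ge_min lexx.
      - rewrite /vcons; case: (unlift ord0 i) => [i'|] /=.
          by rewrite (le_trans (w1 i')) ?ler1n.
        by rewrite (le_trans y01) ?ler1n.
      - rewrite /vcons; case: (unlift ord0 i) => [i'|] /=.
          by rewrite (le_trans (un i')) ?ler_nat.
        by rewrite (le_trans x2) ?ler_nat.
    have := mulr_ge0 Bz (Th_ge0 _ u); have := le_trans (ler_norm _) h.
    by lra.
  have [x xE] : exists x : S H, vec x = 0 by apply: vec_surj; rewrite normr0.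
  have x2 : gauge x <= 2%:R by rewrite (le_trans (gauge_le x))// xE normr0.
  exists x; split=> //; rewrite phiE.
  have : eval Phi (vcons x u) <= `|B|.
    rewrite (le_trans (ler_norm _))// (le_trans _ (ler_norm B))//.
    by apply: BP; exact: vcons_gauge.
  have : `|B| <= `|B| / zeta * eval Th u.
    rewrite mulrAC ler_pdivlMr// ler_wpM2l// eval_dev.
    move/existsNP: far => [k /negP]; rewrite -ltNge => /ltW /le_trans; apply.
    by rewrite (bigD1 k)//= lerDl sumr_ge0.
  by lra.
- by move=> i; rewrite (le_trans (gauge_le _)).
have Th0 : eval Th v = 0.
  rewrite eval_dev big1// => k _; rewrite !thE; apply/eqP.
  by have := vw (l' k); rewrite mul0r normr_le0 normr_eq0.
rewrite phiE Th0 mulr0 subr0 in yP.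
have yn : `|vec y| <= 3%:R by have := vec_le y3; rewrite max_l ?ler1n.
have yw : tpclose (s * e) (fun i => vec (vcons y v i)) (fun i => vec (vcons y0 w i)).
  have vc X (u : 'I_n -> S X) x : (forall i, `|vec (u i)| <= 1) ->
      `|vec x| <= 3%:R -> forall i, `|vec (vcons x u i)| <= 3%:R.
    move=> u1 x3 i; rewrite /vcons; case: (unlift ord0 i) => [i'|] //=.
    by rewrite (le_trans (u1 i')) ?ler1n.
  apply: psiP; [exact: vc|apply: vc => //; by rewrite (le_trans y01) ?ler1n|].
  move=> k; rewrite -!psiE.
  have : eval Phi (vcons y v) <= eta by lra.
  by rewrite eval_dev; apply: le_trans; rewrite (bigD1 k)//= lerDl sumr_ge0.
pose f (j : option J) : 'I_n.+1 :=
  if j is Some j' then fintype.lift ord0 (enum_rank j') else ord0.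
have := tpclose_pull f (ltW se) yw => h.
exists (s^-1 *: vec y); apply: (tpclose_scale s0).
have <- : (fun i => vec (vcons y v i)) \o f =
    (fun j => s *: oapp a (s^-1 *: vec y) j).
  apply/funext => -[j|] /=; rewrite /vcons ?liftK ?unlift_none /=.
    by rewrite vE enum_rankK.
  by rewrite scalerA divff ?scale1r// gt_eqF.
have <- // : (fun i => vec (vcons y0 w i)) \o f = (fun j => s *: oapp c z j).
apply/funext => -[j|] /=; rewrite /vcons ?liftK ?unlift_none //=.
by rewrite wE enum_rankK.
Qed.

Lemma model_gurarii_iso M : model M T' -> exists G, gurarii G /\ isomorphic M (S G).
Proof.
move=> MT'; have MT := gurarii_theory_model MT'.
have [G iso] := ae_closed_banach (model_ae_closed MT).
by exists G; split=> //; apply/model_gurarii/(isomorphic_model _ iso).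
Qed.

Lemma gurarii_model G : gurarii G -> model (S G) T'.
Proof. by move=> gG; apply: theory_of_model; exists G. Qed.

End ModelCompletion.

(** * Quantifier elimination, completeness and categoricity *)

Section GurariiTheory.
Context (R : realType) (L : signature R) (P : presentation L).
Implicit Types (M N : structure L) (E F G H : completeNormedModType R).
Local Notation S := (struct_of P).
Local Notation vec := (@vec_of R L P _).
Local Notation T := (theory_of (fun M => exists E, M = S E)).
Local Notation T' := (theory_of (fun M => exists G, M = S G /\ gurarii G)).

(** The value of phi is a function of the tuple t of values of the net formulas, up to e
and only on tuples that occur in a Gurarij space.  It is extended to a Lipschitz, hence
continuous, function u of all real tuples by the infimum of phi(w) + C |t - t(w)| over
all w; C is large enough for far-away w not to matter. *)
Lemma quantifier_elimination_gurarii : quantifier_elimination T'.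
Proof.
move=> n phi r e e0.
have gg : quantifier_free phi \/ (forall E, gurarii E -> gurarii E) by right.
pose r1 := Num.max r 1.
have [d [d0 dP]] := formula_type_continuous P gg r1 e0.
have [K [psi [l [eta [eta0 qpsi psiE psiP]]]]] := net_formulas P n r1 d0.
have [B BP] := eval_bounded phi r.
pose C := (`|B| + `|B|) / eta; have C0 : 0 <= C by rewrite divr_ge0 ?addr_ge0// ltW.
pose tup G (w : 'I_n -> S G) : 'rV[R]_K := \row_k eval (psi k) w.
pose val_at (t : 'rV[R]_K) G (w : 'I_n -> S G) :=
  eval phi w + C * \sum_k `|t ord0 k - eval (psi k) w|.
pose A t := [set x | exists G (w : 'I_n -> S G),
  [/\ gurarii G, forall i, gauge (w i) <= r & x = val_at t G w]].
pose u t := inf (A t).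
have Alb t : lbound (A t) (- `|B|).
  move=> _ [G [w [gG wr ->]]].
  have := BP _ w wr; rewrite ler_norml => /andP[h _].
  apply: (@le_trans _ _ (eval phi w)).
    by apply: le_trans h; rewrite lerN2 ler_norm.
  by rewrite lerDl mulr_ge0// sumr_ge0.
have uL t t' : u t <= u t' + C * \sum_k `|t ord0 k - t' ord0 k|.
  have [[x0 A0]|A0] := pselect (A t' !=set0); last first.
    have A0' s : A s = set0.
      rewrite -subset0 => x [G [w [gG wr _]]]; apply: A0.
      by exists (val_at t' G w), G, w.
    by rewrite /u !A0' lerDl mulr_ge0// sumr_ge0.
  rewrite -lerBlDr; apply: lb_le_inf; first by exists x0.
  move=> _ [G [w [gG wr ->]]]; rewrite lerBlDr.
  apply: (@le_trans _ _ (val_at t G w)).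
    by apply: ge_inf; [exists (- `|B|)|exists G, w].
  rewrite /val_at -addrA lerD2l -mulrDr ler_wpM2l// -big_split ler_sum// => k _ /=.
  by rewrite addrC ler_distD.
have uc : continuous u.
  apply: (lipschitz_continuous (C := C)) => t t'.
  have sw : \sum_k `|t' ord0 k - t ord0 k| = \sum_k `|t ord0 k - t' ord0 k|.
    by apply: eq_bigr => k _; exact: distrC.
  have := uL t t'; have := uL t' t; rewrite sw ler_norml => h1 h2.
  by apply/andP; split; lra.
exists (FConn uc psi); split=> // M v MT vr.
have [G [gG [h [he hT]]]] := model_gurarii_iso MT.
have hg := he; case: hg => _ hg _ _.
have hE (chi : formula L n) : eval chi v = eval chi (h \o v).
  by rewrite (eval_embedding _ he)//; right.
rewrite !hE; set w := h \o v.
have wr i : gauge (w i) <= r by rewrite hg.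
have tE : eval (FConn uc psi) w = u (tup G w) by [].
rewrite tE; have wA : A (tup G w) (eval phi w).
  exists G, w; split=> //; rewrite /val_at big1 ?mulr0 ?addr0// => k _.
  by rewrite mxE subrr normr0.
have up : u (tup G w) <= eval phi w by apply: ge_inf wA; exists (- `|B|).
suff lo : eval phi w - e <= u (tup G w).
  by rewrite ger0_norm ?subr_ge0// lerBlDr addrC -lerBlDr.
apply: lb_le_inf; first by exists (eval phi w).
move=> _ [H [z [gH zr ->]]].
have [near|far] := pselect (forall k, `|eval (psi k) w - eval (psi k) z| <= eta).
  have wz : tpclose d (fun i => vec (w i)) (fun i => vec (z i)).
    apply: psiP => [i|i|k]; [exact: vec_le|exact: vec_le|].
    by rewrite -!psiE.
  have := dP G H gG gH w z (fun i => vec_le (wr i)) (fun i => vec_le (zr i)) wz.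
  rewrite ler_norml => /andP[_ h1].
  have : 0 <= C * \sum_k `|tup G w ord0 k - eval (psi k) z|.
    by rewrite mulr_ge0// sumr_ge0.
  by rewrite /val_at; lra.
have : `|B| + `|B| <= C * \sum_k `|tup G w ord0 k - eval (psi k) z|.
  rewrite mulrAC ler_pdivlMr// ler_wpM2l ?addr_ge0//.
  move/existsNP: far => [k /negP]; rewrite -ltNge => /ltW /le_trans; apply.
  by rewrite (bigD1 k)//= mxE lerDl sumr_ge0.
have := BP _ w wr; have := BP _ z zr; rewrite /val_at !ler_norml => /andP[h1 _] /andP[_ h2].
by have := ler_norm B; lra.
Qed.

Lemma model_completion_gurarii : model_completion T T'.
Proof.
split; last exact: quantifier_elimination_gurarii.
split=> M MT; last first.
  by exists M, id; split=> //; exact: gurarii_theory_model.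
have [E [h [he _]]] := ae_closed_banach (model_ae_closed MT).
have [G [i [ii gG]]] := gurarii_embedding E.
have [j [je _]] := isom_lifts P ii.
exists (S G), (j \o h); split; first exact: gurarii_model.
exact: embedding_comp he je.
Qed.

(** The exact case of [formula_type_continuous]. *)
Lemma elementarily_equivalent n (phi : formula L n) G H (v : 'I_n -> S G)
    (w : 'I_n -> S H) : gurarii G -> gurarii H ->
  tpclose 0 (fun i => vec (v i)) (fun i => vec (w i)) ->
  eval phi v = eval phi w.
Proof.
move=> gG gH vw; apply/eqP; rewrite -subr_eq0 -normr_le0.
have gg : quantifier_free phi \/ (forall E, gurarii E -> gurarii E) by right.
apply/ler_addgt0Pr => e e0; rewrite add0r.
have [B BP] := finite_upper_bound (fun i => `|vec (v i)|).
have [C CP] := finite_upper_bound (fun i => `|vec (w i)|).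
have [d [d0 dP]] := formula_type_continuous P gg (Num.max B C) e0.
apply: dP => // [i|i|]; [by rewrite le_max BP|by rewrite le_max CP orbT|].
exact: tpclose_le (ltW d0) vw.
Qed.

Lemma complete_theory_gurarii : complete_theory T'.
Proof.
split.
  have [G [_ [_ gG]]] := gurarii_embedding (linf R unit).
  by exists (S G); exact: gurarii_model.
move=> M N phi MT NT.
have [G [gG [h [he hT]]]] := model_gurarii_iso MT.
have [H [gH [k [ke kT]]]] := model_gurarii_iso NT.
have -> : eval phi (@vnil M) = eval phi (h \o @vnil M).
  by rewrite (eval_embedding _ he)//; right.
have -> : eval phi (@vnil N) = eval phi (k \o @vnil N).
  by rewrite (eval_embedding _ ke)//; right.
apply: elementarily_equivalent => // l.
by rewrite !big_ord0 !normr0 subrr normr0 mul0r.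
Qed.

(** Only the points of the structure have a dense sequence; its integer multiples are
dense in G. *)
Lemma dense_sequence M G (h : M -> S G) (D : set M) : embedding h -> range h = setT ->
  countable D -> dense D ->
  exists g : nat -> G, forall x e, 0 < e -> exists k, `|x - g k| < e.
Proof.
move=> [hd _ _ _] hT cD dD.
have Dne : D !=set0.
  by have [|x [_ Dx]] := dD setT _ openT; [exists point|exists x].
have [s sD] : exists s : nat -> M, D `<=` range s.
  have /countable_injP[f finj] := cD; have [x0 Dx0] := Dne.
  exists (fun k => if pselect (exists x, D x /\ f x = k) is left h1
                   then sval (cid h1) else x0).
  move=> x Dx; exists (f x) => //; case: pselect => [h1|[]]; last by exists x.
  by case: (cid h1) => y /= [Dy]; apply: finj; rewrite inE.
exists (fun k => let p := odflt (0%N, 0%N) (unpickle k : option (nat * nat)) in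
  p.1%:R *: vec (h (s p.2))) => x e e0.
have [k [y xE]] := scaled_point P x; have k0 : 0 < k.+1%:R :> R by rewrite ltr0n.
have ek : 0 < e / k.+1%:R by rewrite divr_gt0.
have [z _ zy] : range h y by rewrite hT.
have [||t [/= zt Dt]] := dD (ball z (e / k.+1%:R))^°.
- by exists z; exact: nbhsx_ballx.
- exact: open_interior.
have [m _ mt] := sD _ Dt.
exists (pickle (k.+1, m)); rewrite pickleK /= xE -scalerBr normrZ (gtr0_norm k0).
rewrite -ltr_pdivlMl// mulrC mt -zy -mdist_vec hd.
by have := interior_subset zt; rewrite ballEmdist.
Qed.

Lemma aleph0_categorical_gurarii : aleph0_categorical T'.
Proof.
split; last first.
  move=> M N MT NT [[D cD dD] _] [[D' cD' dD'] _].
  have [G [gG [h [he hT]]]] := model_gurarii_iso MT.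
  have [H [gH [k [ke kT]]]] := model_gurarii_iso NT.
  have [g gd] := dense_sequence he hT cD dD.
  have [g' gd'] := dense_sequence ke kT cD' dD'.
  have [f [fi fT]] := gurarii_unique gG gH gd gd'.
  have [j [je jE]] := isom_lifts P fi.
  have [k0 [k' [_ k'e k0k' _]]] := isomorphic_sym (ex_intro _ k (conj ke kT)).
  exists (k' \o (j \o h)); split.
    exact: embedding_comp (embedding_comp he je) k'e.
  apply/seteqP; split=> // y _.
  have [x _ xy] : range f (vec (k0 y)) by rewrite fT.
  have [z zx] : exists z : S G, vec z = x.
    apply: vec_surj => tr; have [_ fn] := fi; rewrite -fn xy; exact: vec_le1.
  have [u _ uz] : range h z by rewrite hT.
  exists u => //=; rewrite uz -[RHS]k0k'; congr k'.
  by apply: vec_inj; rewrite jE zx.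
have [G0 [_ [_ gG0]]] := gurarii_embedding (linf R unit).
have [G [d [gG dd]]] := gurarii_separable_subspace gG0.
exists (S G); split; first exact: gurarii_model.
split.
  (* In the bounded case the dense sequence of G is first moved into the unit ball. *)
  pose t k := if trivial_gauge L then Num.max 0 (`|d k| - 1) else 0.
  have /choice[y yP] k : exists y : S G, `|d k - vec y| <= t k.
    apply: nearest_point => [|tr]; rewrite /t; first by case: ifP => // _; rewrite le_max lexx.
    by rewrite tr -lerBlDl le_max lexx orbT.
  exists (range y); first by apply: card_le_trans (card_image_le _ _) _; exact: countableP.
  move=> O [x Ox] Oo; have /nbhs_ballP[e /= e0 eO] : nbhs x O by exact: open_nbhs_nbhs.
  have e2 : 0 < e / 2 by rewrite divr_gt0.
  have [k xk] := dd (vec x) _ e2; exists (y k); split; last by exists k.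
  apply: eO; rewrite ballEmdist /= mdist_vec.
  rewrite (le_lt_trans (ler_distD (d k) _ _))// (splitr e) ltr_leD//.
  apply: le_trans (yP k) _; rewrite /t; case: ifP => [tr|_]; last exact: ltW.
  rewrite ge_max (ltW e2)/= lerBlDl.
  have := vec_le1 x tr; have := ler_distD 0 (d k) (vec x).
  have := ler_norm (`|d k| - `|vec x|); have := ler_dist_dist (d k) (vec x).
  by rewrite [`|d k - _|]distrC; lra.
move=> D fD dD; have [b b0] := gurarii_nontrivial gG.
(* A finite dense set would be everything, but there are infinitely many multiples of b. *)
have cD : closed D.
  exact: (accessible_finite_set_closed.1 (hausdorff_accessible (@metric_hausdorff _ _))).
have DT : D = setT.
  apply/seteqP; split=> // x _; rewrite (closure_id D).1//.
  move=> O /nbhs_interior Ox; have [||y [Oy Dy]] := dD O^°.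
  - by exists x; exact: nbhs_singleton.
  - exact: open_interior.
  by exists y; split=> //; exact: interior_subset.
have nb : 0 < `|b| by rewrite normr_gt0.
have /choice[x xE] (k : nat) : exists x : S G, vec x = (k.+1%:R * `|b|)^-1 *: b.
  apply: vec_surj => _; have kb : 0 < k.+1%:R * `|b| by rewrite mulr_gt0// ltr0n.
  by rewrite normrZ normfV gtr0_norm// ler_pdivrMl// mulr1 ler_peMl// ler1n.
apply: infinite_nat; have <- : x @^-1` D = [set: nat] by rewrite DT.
apply: finite_preimage fD => i j _ _ /(congr1 (@vec_of _ _ P _)); rewrite !xE.
move=> /(congr1 (fun z => z - (j.+1%:R * `|b|)^-1 *: b)).
rewrite subrr -scalerBl => /eqP; rewrite scaler_eq0 (negPf b0) orbF subr_eq0.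
rewrite (inj_eq invr_inj) (inj_eq (mulIf (lt0r_neq0 nb))) eqr_nat.
by move=> /eqP[].
Qed.

End GurariiTheory.

(** * Continuity for pointwise convergence *)

Section PointwiseTopology.
Context (R : realType).

Lemma ptws_eval_continuous (U : Type) (u : U) :
  continuous (fun f : {ptws U -> R} => f u : R).
Proof.
move=> f A Afu.
have ff : nbhs f --> (f : {ptws U -> R}) by [].
have FF : Filter (nbhs f) := nbhs_filter f.
move: ff; rewrite /prod_topology => /(@cvg_sup _ _ _ _ _ FF)/(_ u); apply.
exact: (@initial_continuous _ _ (fun g : U -> R => g u) f A Afu).
Qed.

(** For subspaces of product spaces continuity is checked one coordinate of the target at
a time, against finitely many coordinates of the source. *)
Lemma pointwise_continuous (U V : Type) (A : set {ptws U -> R})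
    (B : set {ptws V -> R}) (h : A -> B) :
  (forall (a0 : A) v e, 0 < e -> exists k (c : 'I_k -> U) d, 0 < d /\ forall a : A,
     (forall i, `|\val a (c i) - \val a0 (c i)| <= d) ->
     `|\val (h a) v - \val (h a0) v| <= e) -> continuous h.
Proof.
move=> hP; apply: continuous_comp_initial => a0.
have FF : Filter (nbhs a0) := nbhs_filter a0.
apply/(@cvg_sup _ _ _ _ _ _) => v W [? /= [[O oO <-]] Oh sub].
apply: filterS sub _.
have /nbhs_ballP[e /= e0 eO] : nbhs (\val (h a0) v) O by exact: open_nbhs_nbhs.
have e2 : 0 < e / 2 by rewrite divr_gt0.
have [k [c [d [d0 dP]]]] := hP a0 v _ e2.
have near i : nbhs a0 [set a : A | `|\val a (c i) - \val a0 (c i)| <= d].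
  have : nbhs (\val a0 (c i) : R) (ball (\val a0 (c i) : R) d) by exact: nbhsx_ballx.
  move=> /(@ptws_eval_continuous U (c i)) /(@initial_continuous _ _ (@set_val _ A)) h1.
  by apply: (@filterS _ (nbhs a0) FF _ _ _ h1) => a /=; rewrite -ball_normE /= distrC => /ltW.
have : nbhs a0 [set a : A | forall i, `|\val a (c i) - \val a0 (c i)| <= d].
  exact: (@filter_forall A 'I_k (fun i a => `|\val a (c i) - \val a0 (c i)| <= d) (nbhs a0) FF near).
move=> h2; apply: (@filterS _ (nbhs a0) FF _ _ _ h2) => a /= /dP h1; apply: eO; rewrite -ball_normE /= distrC.
by apply: le_lt_trans h1 _; rewrite ltr_pdivrMr// ltr_pMr// ltr1n.
Qed.

End PointwiseTopology.

(** * Type spaces are spaces of semi-norms *)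

Section TypeSpaces.
Context (R : realType) (L : signature R) (P : presentation L).
Implicit Types (M N : structure L) (E F G H : completeNormedModType R).
Local Notation S := (struct_of P).
Local Notation vec := (@vec_of R L P _).
Local Notation T' := (theory_of (fun M => exists G, M = S G /\ gurarii G)).

Lemma freegUZ (K : choiceType) (c : R) (z : K) :
  << c *g z >> = c *: << z >> :> {freeg K / R}.
Proof. by apply/eqP/freeg_eqP => z'; rewrite coeffZ !coeffU mul1r. Qed.

Section evaluation.
Variables (E F : completeNormedModType R) (I : choiceType).

Definition adjoin_eval (f : E -> F) (a : I -> F) (x : adjoin E I) : F :=
  f x.1 + fglift a x.2.

Lemma fglift0 (a : I -> F) : fglift a 0 = 0.
Proof. by rewrite -(subrr 0) lift_is_additive subrr. Qed.

Lemma fgliftD (a : I -> F) D D' : fglift a (D + D') = fglift a D + fglift a D'.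
Proof.
have fgliftB := lift_is_additive a.
by rewrite -[D' in LHS]opprK fgliftB -[- D']sub0r fgliftB fglift0 sub0r opprK.
Qed.

Lemma fglift_sum (a : I -> F) (J : Type) (r : seq J) (D : J -> {freeg I / R}) :
  fglift a (\sum_(j <- r) D j) = \sum_(j <- r) fglift a (D j).
Proof. exact: (big_morph _ (fgliftD a) (fglift0 a)). Qed.

Lemma fgliftZ (a : I -> F) c D : fglift a (c *: D) = c *: fglift a D.
Proof.
have fgliftE (D' : {freeg I / R}) :
    fglift a D' = \sum_(z <- dom D') coeff z D' *: a z.
  by rewrite -{1}[D']freeg_sumE fglift_sum; apply: eq_bigr => z _; rewrite liftU.
rewrite [in RHS]fgliftE scaler_sumr -[c *: D]/(fgscale c D) fglift_sum.
by apply: eq_bigr => z _; rewrite liftU scalerA.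
Qed.

Lemma adjoin_eval_lin (f : E -> F) (a : I -> F) : lin f -> lin (adjoin_eval f a).
Proof.
by move=> fl c x y; rewrite /adjoin_eval /= fl fgliftD fgliftZ scalerDr addrACA.
Qed.

Lemma norm_typeE (f : E -> F) (a : I -> F) (x : adjoin E I) :
  norm_type f a x = `|adjoin_eval f a x|.
Proof. by []. Qed.

End evaluation.

Section space.
Variables (E : completeNormedModType R) (I : choiceType).

Definition parameter (s : I + S E) : adjoin E I :=
  match s with inl k => (0, << k >>) | inr b => (vec b, 0) end.

Lemma adjoin_eval_parameter F (f : E -> F) (a : I -> S F) (j : S E -> S F) s :
  lin f -> (forall x, vec (j x) = f (vec x)) ->
  adjoin_eval f (fun k => vec (a k)) (parameter s) =
  vec (match s with inl k => a k | inr b => j b end).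
Proof.
move=> fl jE; rewrite /adjoin_eval; case: s => [k|b] /=.
  by rewrite (lin0 fl) add0r liftU scale1r.
by rewrite fglift0 addr0 jE.
Qed.

(** Every vector of E(I) is a combination of parameters, that is of variables and points of
the structure S E; so a semi-norm on E(I) is determined by its values on the
combinations that formulas with parameters can speak of. *)
Lemma adjoin_combination (x : adjoin E I) : exists n (l : 'I_n -> R) (s : 'I_n -> I + S E),
  x = \sum_i l i *: parameter (s i).
Proof.
case: x => x D; have [k [y ->]] := scaled_point P x.
pose t := in_tuple (dom D).
exists (size (dom D)).+1, (vcons k.+1%:R (fun i => coeff (tnth t i) D)),
  (vcons (inr y) (fun i => inl (tnth t i))).
rewrite big_ord_recl /vcons unlift_none /=.
under eq_bigr => i _ do rewrite liftK /=.
have -> : \sum_(i < size (dom D)) coeff (tnth t i) D *: ((0, << tnth t i >>) : adjoin E I) =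
    (0, D).
  have -> : (0, D) = (0, \sum_(i < size (dom D)) coeff (tnth t i) D *: << tnth t i >>)
      :> adjoin E I.
    congr pair; rewrite -[LHS]freeg_sumE big_tnth.
    by apply: eq_bigr => i _; rewrite freegUZ.
  elim/big_ind2 : _ => // [x1 x2 y1 y2 -> ->|i _].
    by congr pair; rewrite /= addr0.
  by congr pair; rewrite /= scaler0.
by congr pair; rewrite /= ?addr0// scaler0 add0r.
Qed.

(** The type p and the semi-norm xi come from the same tuple.  Matching them by this
relation makes the two directions of the correspondence symmetric. *)
Definition realizes (p : {ptws pformula L (S E) I -> R}) (xi : {ptws adjoin E I -> R}) :=
  exists F (f : E -> F) (j : S E -> S F) (a : I -> S F),
    [/\ gurarii F, isom f, forall x, vec (j x) = f (vec x),
        p = elementary_type j a & xi = norm_type f (fun k => vec (a k))].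

(** The form in which a realization is used: the tuple v that a formula with parameters
speaks of, its norms of combinations on one side and its type on the other. *)
Lemma realized_tuple p xi : realizes p xi -> exists F, gurarii F /\
  forall n (s : 'I_n -> I + S E), exists v : 'I_n -> S F,
    (forall l : 'I_n -> R, `|\sum_i l i *: vec (v i)| = xi (\sum_i l i *: parameter (s i))) /\
    forall phi : formula L n, p (existT _ n (phi, s)) = eval phi v.
Proof.
move=> [F [f [j [a [gF [fl fn] jE -> ->]]]]]; exists F; split=> // n s.
exists (fun i => match s i with inl k => a k | inr b => j b end); split=> // l.
rewrite norm_typeE (lin_sum _ _ (adjoin_eval_lin _ fl)); congr `|_|.
by apply: eq_bigr => i _; rewrite (adjoin_eval_parameter a (s i) fl jE).
Qed.

Lemma realizes_inj p p' xi : realizes p xi -> realizes p' xi -> p = p'.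
Proof.
move=> /realized_tuple[F [gF h]] /realized_tuple[F' [gF' h']].
apply/funext => -[n [phi s]]; have [v [vl ->]] := h n s; have [w [wl ->]] := h' n s.
apply: elementarily_equivalent => // l.
by rewrite vl wl subrr normr0 mul0r.
Qed.

(** The norms are limits of values of quantifier-free formulas. *)
Lemma realizes_fun p xi xi' : realizes p xi -> realizes p xi' -> xi = xi'.
Proof.
move=> /realized_tuple[F [gF h]] /realized_tuple[F' [gF' h']].
apply/funext => x; have [n [l [s ->]]] := adjoin_combination x.
have [v [<- vp]] := h n s; have [w [<- wp]] := h' n s.
have := qf_tpclose (v := v) (w := w); move=> /(_ _ l).
rewrite mul0r normr_le0 subr_eq0 => vw; apply/eqP/vw => phi _.
by rewrite -vp -wp.
Qed.

(** The model is a Gurarij space, and the embedding of the structure of E extends to an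
isometry of E. *)
Lemma type_realized p : type_space T' (S E) I p -> exists xi, realizes p xi.
Proof.
move=> [N [j [a [NT je ->]]]]; have [F [gF [h [he hT]]]] := model_gurarii_iso NT.
have [f [fi fE]] := embedding_extends (embedding_comp je he).
exists (norm_type f (fun k => vec (h (a k)))), F, f, (h \o j), (h \o a).
split=> //; apply/funext => -[n [phi s]]; rewrite /elementary_type /=.
rewrite -(eval_embedding (h := h) _ he); last by right.
by congr eval; apply/funext => i /=; case: (s i).
Qed.

Lemma realizes_type p xi : realizes p xi -> type_space T' (S E) I p.
Proof.
move=> [F [f [j [a [gF fi jE -> _]]]]]; exists (S F), j, a; split=> //.
  exact: gurarii_model.
exact: lift_embedding jE.
Qed.

Definition admissible_seminorm (xi : {ptws adjoin E I -> R}) :=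
  seminorm_space E I xi /\ (trivial_gauge L -> forall i : I, xi (0, << i >>) <= 1).

Lemma realizes_seminorm p xi : realizes p xi -> admissible_seminorm xi.
Proof.
move=> [F [f [j [a [gF [fl fn] jE _ ->]]]]].
have al := adjoin_eval_lin (fun k => vec (a k)) fl.
split=> [|tr k]; first split=> [x y|c x|b].
- by rewrite !norm_typeE (linD al) ler_normD.
- by rewrite !norm_typeE (linZ al) normrZ.
- by rewrite norm_typeE /adjoin_eval /= fglift0 addr0 fn.
- rewrite norm_typeE /adjoin_eval /= (lin0 fl) add0r liftU scale1r.
  exact: vec_le1.
Qed.

(** The space E(I) modulo xi contains E isometrically; it is embedded in a Gurarij space,
where the images of the variables have the required type. *)
Lemma seminorm_realized xi : admissible_seminorm xi -> exists p, realizes p xi.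
Proof.
move=> [[xiD xiZ xiE] xi1].
have xis : @seminorm R (adjoin E I) xi by split.
have [W [h [hl hN]]] := seminorm_realization xis.
have [F [i [[il iN] gF]]] := gurarii_embedding W.
pose f x := i (h (x, 0)).
have fl : lin f.
  move=> c x y; rewrite /f -il -hl; congr (i (h (_, _))).
  by rewrite /= scaler0 addr0.
have fi : isom f by split=> // x; rewrite /f iN hN xiE.
have [j [_ jE]] := isom_lifts P fi.
have /choice[a aE] k : exists y : S F, vec y = i (h (0, << k >>)).
  by apply: vec_surj => tr; rewrite iN hN xi1.
exists (elementary_type j a), F, f, j, a; split=> //.
apply/funext => x; rewrite norm_typeE.
suff -> : adjoin_eval f (fun k => vec (a k)) x = i (h x) by rewrite iN hN.
have al := adjoin_eval_lin (fun k => vec (a k)) fl.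
have [n [l [s ->]]] := adjoin_combination x.
rewrite (lin_sum _ _ al) (lin_sum _ _ hl) (lin_sum _ _ il).
apply: eq_bigr => m _; congr (_ *: _).
rewrite (adjoin_eval_parameter a (s m) fl jE); case: (s m) => [k|b] /=.
  exact: aE.
exact: jE.
Qed.

(** Near p0 the net formulas have nearly the same values, and the gauges of the tuple are
bounded; hence so are all norms of combinations. *)
Lemma realizes_seminorm_continuous p0 xi0 x e : realizes p0 xi0 -> 0 < e ->
  exists k (c : 'I_k -> pformula L (S E) I) d, 0 < d /\
  forall p xi, realizes p xi -> (forall i, `|p (c i) - p0 (c i)| <= d) ->
    `|xi x - xi0 x| <= e.
Proof.
move=> r0 e0; have [n [l [s ->]]] := adjoin_combination x.
have [F [gF h]] := realized_tuple r0; have [v [vl vp]] := h n s.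
have [B BP] := finite_upper_bound (fun i => gauge (v i)).
pose r := Num.max (B + 1) 1.
have s1 : 0 < \sum_i `|l i| + 1 by rewrite ltr_wpDl// sum_norm_ge0.
have d0 : 0 < e / (\sum_i `|l i| + 1) by rewrite divr_gt0.
have [k [psi [m [t [t0 qpsi psiE psiP]]]]] := net_formulas P n r d0.
pose c (i : 'I_(k + n)) : pformula L (S E) I :=
  match fintype.split i with
  | inl i => existT _ n (psi i, s)
  | inr i => existT _ n (FGauge (TVar i), s) end.
exists (k + n)%N, c, (Num.min t 1); split; first by rewrite lt_min t0 ltr01.
move=> p xi /realized_tuple[H [gH h']] hp; have [w [<- wp]] := h' n s.
rewrite -vl.
have wr i : `|vec (w i)| <= r.
  apply: vec_le; have := hp (rshift k i).
  rewrite /c (unsplitK (inr i)) wp vp /= le_min => /andP[_].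
  by rewrite ler_norml => /andP[_]; have := BP i; lra.
have vr i : `|vec (v i)| <= r by apply: vec_le; have := BP i; lra.
have := psiP _ _ _ _ wr vr _ l.
move=> /(_ _)/le_trans; apply.
  move=> i; have := hp (lshift n i); rewrite /c (unsplitK (inl i)) wp vp le_min.
  by rewrite !psiE => /andP[].
by rewrite mulrAC ler_pdivrMr// ler_wpM2l ?(ltW e0)// lerDl.
Qed.

(** This is [formula_type_continuous], read on semi-norms through the finite net. *)
Lemma realizes_type_continuous p0 xi0 c e : realizes p0 xi0 -> 0 < e ->
  exists k (x : 'I_k -> adjoin E I) d, 0 < d /\
  forall p xi, realizes p xi -> (forall i, `|xi (x i) - xi0 (x i)| <= d) ->
    `|p c - p0 c| <= e.
Proof.
case: c => n [phi s] r0 e0.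
have [F [gF h]] := realized_tuple r0; have [v [vl vp]] := h n s.
have [B BP] := finite_upper_bound (fun i => `|vec (v i)|).
have gg : quantifier_free phi \/ (forall E, gurarii E -> gurarii E) by right.
have [d [d0 dP]] := formula_type_continuous P gg (B + 1) e0.
have [k [psi [m [t [t0 qpsi psiE psiP]]]]] := net_formulas P n (B + 1) d0.
pose x (i : 'I_(k + n)) : adjoin E I :=
  match fintype.split i with
  | inl i => \sum_j m i j *: parameter (s j)
  | inr i => \sum_j (j == i)%:R *: parameter (s j) end.
exists (k + n)%N, x, (Num.min t 1); split; first by rewrite lt_min t0 ltr01.
move=> p xi /realized_tuple[H [gH h']] hp; have [w [wl wp]] := h' n s.
rewrite wp vp.
have wr i : `|vec (w i)| <= B + 1.
  have := hp (rshift k i); rewrite /x (unsplitK (inr i)) -wl -vl !comb1 le_min.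
  by move=> /andP[_]; rewrite ler_norml => /andP[_]; have := BP i; lra.
have vr i : `|vec (v i)| <= B + 1 by have := BP i; lra.
apply: dP => //; apply: psiP => // i.
have := hp (lshift n i); rewrite /x (unsplitK (inl i)) -wl -vl le_min.
by move=> /andP[].
Qed.

Theorem type_space_homeomorphism (X : set {ptws adjoin E I -> R}) :
  X = admissible_seminorm ->
  exists h : type_space T' (S E) I -> X, homeomorphism h /\
  forall F (f : E -> F) (j : S E -> S F) (a : I -> S F) (p : type_space T' (S E) I),
    model (S F) T' -> isom f -> (forall x, vec (j x) = f (vec x)) ->
    \val p = elementary_type j a -> \val (h p) = norm_type f (fun k => vec (a k)).
Proof.
move=> ->; pose Y : set {ptws adjoin E I -> R} := admissible_seminorm.
have hP (p : type_space T' (S E) I) : {xi : Y | realizes (\val p) (\val xi)}.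
  apply: cid; have [xi pxi] := type_realized (set_valP p).
  by exists (SigSub (mem_set (realizes_seminorm pxi : Y xi))).
have gP (xi : Y) : {p : type_space T' (S E) I | realizes (\val p) (\val xi)}.
  apply: cid; have [p pxi] := seminorm_realized (set_valP xi).
  by exists (SigSub (mem_set (realizes_type pxi))).
pose h p := sval (hP p); pose g xi := sval (gP xi).
have hR p : realizes (\val p) (\val (h p)) by exact: (svalP (hP p)).
have gR xi : realizes (\val (g xi)) (\val xi) by exact: (svalP (gP xi)).
exists h; split.
  split.
    apply: pointwise_continuous => p0 x e e0.
    have [k [c [d [d0 dP]]]] := realizes_seminorm_continuous x (hR p0) e0.
    by exists k, c, d; split=> // p; apply: dP; exact: hR.
  exists g; split.
  - apply: pointwise_continuous => xi0 c e e0.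
    have [k [x [d [d0 dP]]]] := realizes_type_continuous c (gR xi0) e0.
    by exists k, x, d; split=> // xi; apply: dP; exact: gR.
  - by move=> p; apply: val_inj; exact: (realizes_inj (gR (h p)) (hR p)).
  - by move=> xi; apply: val_inj; exact: (realizes_fun (hR (g xi)) (gR xi)).
move=> F f j a p FT fi jE pE; apply: realizes_fun (hR p) _.
by exists F, f, j, a; split=> //; exact: (model_gurarii FT).
Qed.

End space.

End TypeSpaces.

(** * The theorem for a presentation *)

Section Package.
Context (R : realType) (L : signature R) (P : presentation L).
Local Notation S := (struct_of P).

(** The set X is a variable equal to the admissible semi-norms because those have a
different description for whole spaces and for unit balls. *)
Theorem presented_class_theorem :
  let T := theory_of (fun M : structure L => exists E, M = S E) in
  inductive_theory T /\
  exists T' : theory L, [/\ model_completion T T', complete_theory T',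
    aleph0_categorical T'
  & forall (E : completeNormedModType R) (I : choiceType)
      (X : set {ptws adjoin E I -> R}),
    X = @admissible_seminorm R L E I ->
    exists h : type_space T' (S E) I -> X, homeomorphism h /\
    forall (F : completeNormedModType R) (f : E -> F) (j : S E -> S F)
        (a : I -> S F) (p : type_space T' (S E) I),
      model (S F) T' -> isom f -> (forall x, vec_of (j x) = f (vec_of x)) ->
      \val p = elementary_type j a ->
      \val (h p) = norm_type f (fun k => vec_of (a k))].
Proof.
split; first exact: inductive_banach.
exists (theory_of (fun M => exists G, M = S G /\ gurarii G)); split.
- exact: model_completion_gurarii.
- exact: complete_theory_gurarii.
- exact: aleph0_categorical_gurarii.
- by move=> E I X; exact: type_space_homeomorphism.
Qed.

End Package.

(** * Whole spaces *)

Section UniversalConsequences.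
Context (R : realType) (L : signature R).
Variables (S : completeNormedModType R -> structure L) (z : forall E, S E).
Hypothesis z0 : forall E, gauge (z E) = 0.
Variable M : structure L.
Hypothesis MS : ae_closed S M.

(** A universal condition is a forall-exists condition with a dummy variable, for which the
points z E serve as witnesses. *)
Lemma ae_closed_le n (phi : formula L n) : quantifier_free phi ->
  (forall E (v : 'I_n -> S E), eval phi v <= 0) ->
  forall v : 'I_n -> M, eval phi v <= 0.
Proof.
move=> qphi phi0 v; have [s vs] := common_gauge_bound v.
have liftE N (u : 'I_n -> N) (x : N) : vcons x u \o fintype.lift ord0 = u.
  by apply/funext => i; rewrite /vcons /= liftK.
apply/ler_addgt0Pr => e e0; rewrite add0r.
have [||x [_]] := MS (phi := frename phi (fintype.lift ord0)) (s := s) (r := 0) _ _ vs e0.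
- exact: rename_qf.
- move=> E w _ t t0; exists (z E); rewrite z0 eval_rename liftE lexx; split=> //.
  exact: le_trans (phi0 E w) (ltW t0).
by rewrite eval_rename liftE.
Qed.

Lemma ae_closed_eval_eq n (phi psi : formula L n) :
  quantifier_free phi -> quantifier_free psi ->
  (forall E (v : 'I_n -> S E), eval phi v = eval psi v) ->
  forall v : 'I_n -> M, eval phi v = eval psi v.
Proof.
move=> qphi qpsi E v.
have h a b : (forall E (v : 'I_n -> S E), eval a v = eval b v) ->
    quantifier_free a -> quantifier_free b -> eval a v <= eval b v.
  move=> ab qa qb; have := ae_closed_le (phi := faffine2 1 a (-1) b 0) _ _ v.
  rewrite eval_affine2 mul1r mulN1r addr0 subr_le0; apply; first exact: affine2_qf.
  by move=> E' w; rewrite eval_affine2 mul1r mulN1r addr0 subr_le0 ab.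
by apply/eqP; rewrite eq_le !h.
Qed.

Lemma ae_closed_teval_eq n (t u : term L n) :
  (forall E (v : 'I_n -> S E), teval t v = teval u v) ->
  forall v : 'I_n -> M, teval t v = teval u v.
Proof.
move=> tu v; apply: mdist_positivity; apply/eqP; rewrite eq_le mdist_ge0 andbT.
by apply: (@ae_closed_le n (FDist t u)) => // E w /=; rewrite tu mdistxx.
Qed.

End UniversalConsequences.

Section WholeSpaces.
Context (R : realType).
Local Notation L := (banach_signature R).
Local Notation S := (@banach_structure R).
Implicit Types E F : completeNormedModType R.

Definition pair_fun (X : Type) (x y : X) (i : 'I_2) : X := if i == ord0 then x else y.

Lemma pair_funE (X : Type) (x : 'I_2 -> X) : x = pair_fun (x ord0) (x ord_max).
Proof.
apply/funext => i; rewrite /pair_fun; case: eqP => [->//|i0]; congr x.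
by apply/val_inj; case: i i0 => -[|[|]] //= i0 h; case: h; exact: val_inj.
Qed.

Definition tzero n : term L n := @TApp R L n (BZero R) (fun i => TVar (False_rect _ (notF (ltn_ord i)))).
Definition tadd n (t u : term L n) : term L n := @TApp R L n (BAdd R) (pair_fun t u).
Definition tscale n (c : R) (t : term L n) : term L n := @TApp R L n (BScale c) (fun=> t).

Definition tcomb n (l : 'I_n -> R) : term L n :=
  foldr (fun i t => tadd (tscale (l i) (TVar i)) t) (tzero n) (enum 'I_n).

Lemma teval_tcomb E n (l : 'I_n -> R) (v : 'I_n -> S E) :
  teval (tcomb l) v = \sum_i l i *: (v i : E) :> E.
Proof.
rewrite -big_enum /tcomb; elim: (enum 'I_n) => [|i s IH]; first by rewrite big_nil.
by rewrite big_cons -IH.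
Qed.

Definition banach_coef (f : fsym L) : 'I_(far f) -> R :=
  match f with BZero => fun=> 0 | BAdd => fun=> 1 | BScale c => fun=> c end.

Lemma banach_finterp_coef E (f : fsym L) (x : 'I_(far f) -> S E) :
  finterp x = \sum_i banach_coef i *: (x i : E) :> E.
Proof.
case: f x => [||c] x /=; first by rewrite big_ord0.
  by rewrite !big_ord_recl big_ord0 !scale1r addr0; congr (_ + x _); exact: val_inj.
by rewrite big_ord1.
Qed.

Section ae_closed_whole.
Variable M : structure L.
Hypothesis MS : ae_closed S M.

Let S0 : forall E, gauge (0 : S E) = 0. Proof. by move=> E; exact: normr0. Qed.
Let teq n t u := @ae_closed_teval_eq R L S (fun E => (0 : E) : S E) S0 M MS n t u.
Let feq n phi psi := @ae_closed_eval_eq R L S (fun E => (0 : E) : S E) S0 M MS n phi psi.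
Let fle n phi := @ae_closed_le R L S (fun E => (0 : E) : S E) S0 M MS n phi.

Let zero : M := teval (tzero 0) (@vnil M).
Let add (x y : M) : M := @finterp _ _ M (BAdd R) (pair_fun x y).
Let scale c (x : M) : M := @finterp _ _ M (BScale c) (fun=> x).
Let opp := scale (-1).

Let v3 (x y z : M) (i : 'I_3) : M := nth x [:: x; y; z] i.
Let X : term L 3 := TVar (@Ordinal 3 0 isT).
Let Y : term L 3 := TVar (@Ordinal 3 1 isT).
Let Z : term L 3 := TVar (@Ordinal 3 2 isT).

Let zeroE n (v : 'I_n -> M) : teval (tzero n) v = zero.
Proof. by rewrite /zero /=; congr finterp; apply/funext => -[]. Qed.
Let addE n (t u : term L n) v : teval (tadd t u) v = add (teval t v) (teval u v).
Proof.
rewrite /add /=; congr finterp; apply/funext => i.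
by rewrite /pair_fun; case: ifP.
Qed.
Let scaleE n c (t : term L n) v : teval (tscale c t) v = scale c (teval t v).
Proof. by []. Qed.

Let addA : associative add.
Proof.
move=> x y z; have := @teq 3 (tadd X (tadd Y Z)) (tadd (tadd X Y) Z) _ (v3 x y z).
by rewrite !addE; apply => E v /=; exact: addrA.
Qed.
Let addC : commutative add.
Proof.
move=> x y; have := @teq 3 (tadd X Y) (tadd Y X) _ (v3 x y x).
by rewrite !addE; apply => E v /=; exact: addrC.
Qed.
Let add0 : left_id zero add.
Proof.
move=> x; have := @teq 3 (tadd (tzero 3) X) X _ (v3 x x x).
by rewrite !addE zeroE; apply => E v /=; exact: add0r.
Qed.
Let addN : left_inverse zero opp add.
Proof.
move=> x; have := @teq 3 (tadd (tscale (-1) X) X) (tzero 3) _ (v3 x x x).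
rewrite !addE zeroE; apply => E v /=.
by rewrite -[LHS]/(-1 *: (v (@Ordinal 3 0 isT) : E) + v (@Ordinal 3 0 isT)) scaleN1r addNr.
Qed.
Let scaleA a b x : scale a (scale b x) = scale (a * b) x.
Proof.
have := @teq 3 (tscale a (tscale b X)) (tscale (a * b) X) _ (v3 x x x).
by apply => E v /=; exact: scalerA.
Qed.
Let scale1 : left_id 1 scale.
Proof.
move=> x; have := @teq 3 (tscale 1 X) X _ (v3 x x x).
by apply => E v /=; exact: scale1r.
Qed.
Let scaleDr : right_distributive scale add.
Proof.
move=> a x y; have := @teq 3 (tscale a (tadd X Y)) (tadd (tscale a X) (tscale a Y)) _ (v3 x y x).
by rewrite addE !scaleE addE; apply => E v /=; exact: scalerDr.
Qed.
Let scaleDl x : {morph scale^~ x : a b / a + b >-> add a b}.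
Proof.
move=> a b; have := @teq 3 (tscale (a + b) X) (tadd (tscale a X) (tscale b X)) _ (v3 x x x).
by rewrite addE; apply => E v /=; exact: scalerDl.
Qed.

Let Vz : zmodType := HB.pack (carrier M : Type)
  (Choice.class (carrier M)) (GRing.isZmodule.Build (carrier M) addA addC add0 addN).
Let V : lmodType R := HB.pack (Vz : Type) (GRing.Zmodule.class Vz)
  (GRing.Zmodule_isLmodule.Build R Vz scaleA scale1 scaleDr scaleDl).

Let gauge_teval n (t : term L n) (v : 'I_n -> M) :
  eval (FGauge t) v = gauge (teval t v).
Proof. by []. Qed.

Let gaugeD x y : gauge (add x y) <= gauge x + gauge y.
Proof.
have qf : quantifier_free (faffine2 1 (FGauge (tadd X Y)) (-1)
    (faffine2 1 (FGauge X) 1 (FGauge Y) 0) 0) by do 2!apply: affine2_qf => //.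
have := @fle 3 _ qf _ (v3 x y x).
rewrite !eval_affine2 !mul1r mulN1r !addr0 subr_le0 gauge_teval addE.
apply=> E v; rewrite !eval_affine2 !mul1r mulN1r !addr0 subr_le0.
exact: ler_normD.
Qed.

Let gaugeZ c x : gauge (scale c x) = `|c| * gauge x.
Proof.
have qf : quantifier_free (faffine2 `|c| (FGauge X) 0 (FGauge X) 0) by exact: affine2_qf.
have := @feq 3 (FGauge (tscale c X)) _ I qf _ (v3 x x x).
rewrite eval_affine2 mul0r !addr0; apply=> E v.
by rewrite eval_affine2 mul0r !addr0; exact: normrZ.
Qed.

Let mdistE x y : mdist x y = gauge (add x (opp y)).
Proof.
have := @feq 3 (FDist X Y) (FGauge (tadd X (tscale (-1) Y))) I I _ (v3 x y x).
rewrite gauge_teval addE.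
apply=> E v; rewrite /= /banach_finterp /=.
by rewrite /mdist /= scaleN1r.
Qed.

Let nrm (x : V) : R := gauge (x : M).

Let nrm_seminorm : seminorm nrm.
Proof. by split=> *; [exact: gaugeD|exact: gaugeZ]. Qed.

Let nrm_eq0 (x : V) : nrm x = 0 -> x = 0.
Proof.
move=> x0; apply: (@mdist_positivity R M); rewrite mdistE.
by rewrite -[gauge _]/(nrm (x - 0)) subr0.
Qed.

Let mdist_nrm (x y : V) : mdist (x : M) y = nrm (x - y).
Proof.
rewrite mdistE -[gauge _]/(nrm (x + (-1) *: y)).
by rewrite scaleN1r.
Qed.

Let nrm_complete (F : set_system V) : ProperFilter F ->
  (forall e, 0 < e -> exists x, F [set y | nrm (x - y) < e]) ->
  exists l, forall e, 0 < e -> F [set y | nrm (l - y) < e].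
Proof.
move=> FF Fc; have : cvg (F : set_system M).
  apply/cauchy_cvgP/cauchyP => e e0; have [x Fx] := Fc _ e0; exists (x : M).
  by apply: (@filterS _ F _ _ _ _ Fx) => y; rewrite ballEmdist /= mdist_nrm.
move=> /cvg_ex[l /cvg_ballP Fl]; exists (l : V) => e e0.
by apply: (@filterS _ F _ _ _ _ (Fl _ e0)) => y; rewrite ballEmdist /= mdist_nrm.
Qed.

(** The axioms of a normed space are equations and inequalities between terms and gauges, so
M is itself a normed space; it is complete as a metric structure. *)
Lemma ae_closed_whole : exists E, isomorphic M (S E).
Proof.
exists (mk_banach nrm_seminorm nrm_eq0 nrm_complete).
exists (fun x : M => x : V); split; last first.
  by apply/seteqP; split=> // x _; exists x.
split=> [x y|x|f x|[]].
- by rewrite mdist_nrm.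
- by [].
- case: f x => [||c] x.
  + by rewrite -[RHS]/zero /zero /=; congr finterp; apply/funext => -[].
  + by rewrite [x in LHS]pair_funE.
  + have -> : x = (fun=> x ord0) by apply/funext => i; rewrite (ord1 i).
    by [].
Qed.

End ae_closed_whole.

Lemma banach_combination n (l : 'I_n -> R) e : 0 < e ->
  exists (psi : formula L n) (l' : 'I_n -> R), [/\ quantifier_free psi,
    forall i, `|l' i - l i| <= e
  & forall E (v : 'I_n -> S E), eval psi v = `|\sum_i l' i *: (v i : E)|].
Proof.
move=> e0; exists (FGauge (tcomb l)), l; split=> // [i|E v].
  by rewrite subrr normr0 ltW.
by rewrite -teval_tcomb.
Qed.

Definition whole_presentation : presentation L.
Proof.
refine (@Presentation R L S (fun E x => x) _ _ _ _ _ banach_coef _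
  (fun P => match P with end) _ _ _).
- by move=> E x y.
- by move=> E x y.
- by move=> E x.
- by move=> E x.
- by move=> E x _; exists x.
- exact: banach_finterp_coef.
- by move=> E [].
- exact: banach_combination.
- exact: ae_closed_whole.
Defined.

End WholeSpaces.

(** * Unit balls *)

Section UnitBalls.
Context (R : realType).
Local Notation L := (ball_signature R).
Local Notation S := (@ball_structure R).
Implicit Types E F : completeNormedModType R.

Definition uval E (x : S E) : E := \val (x : unit_ball E).

Lemma uval_le1 E (x : S E) : `|uval x| <= 1.
Proof. exact: (valP (x : unit_ball E)). Qed.

Lemma uval_surj E (x : E) : `|x| <= 1 -> exists y : S E, uval y = x.
Proof. by move=> x1; exists (exist _ x x1 : unit_ball E). Qed.

Definition uzero n : term L n :=
  @TApp R L n UZero (fun i => TVar (False_rect _ (notF (ltn_ord i)))).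
Definition uopp n (t : term L n) : term L n := @TApp R L n UOpp (fun=> t).
Definition umid n (t u : term L n) : term L n := @TApp R L n UMid (pair_fun t u).
Definition unorm n (t : term L n) : formula L n := @FPred R L n tt (fun=> t).

Lemma uval_mid E n (t u : term L n) (v : 'I_n -> S E) :
  uval (teval (umid t u) v) = 2^-1 *: (uval (teval t v) + uval (teval u v)).
Proof. by []. Qed.

(** The factor is unavoidable, because the only operation that adds is the midpoint. *)
Definition representable n (c : 'I_n -> R) := exists (t : term L n) m,
  forall E (v : 'I_n -> S E),
    uval (teval t v) = 2^-1 ^+ m *: \sum_i c i *: uval (v i).

Lemma representable_half n (t : term L n) m : exists u : term L n,
  forall E (v : 'I_n -> S E), uval (teval u v) = 2^-1 ^+ m *: uval (teval t v).
Proof.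
elim: m => [|m [u uE]]; first by exists t => E v; rewrite expr0 scale1r.
exists (umid u (uzero n)) => E v; rewrite uval_mid [uval (teval (uzero n) v)]/= addr0 uE.
by rewrite scalerA exprS.
Qed.

Lemma representableD n (c d : 'I_n -> R) : representable c -> representable d ->
  representable (fun i => c i + d i).
Proof.
move=> [t [m tE]] [u [k uE]].
have [t' t'E] := representable_half t k; have [u' u'E] := representable_half u m.
exists (umid t' u'), (k + m).+1 => E v.
rewrite uval_mid t'E u'E tE uE !scalerA [2^-1 ^+ m * _]mulrC -scalerDr scalerA.
rewrite exprS exprD -big_split; congr (_ *: _); apply: eq_bigr => i _ /=.
by rewrite scalerDl.
Qed.

Lemma representable0 n : representable (fun _ : 'I_n => 0).
Proof.
exists (uzero n), 0%N => E v; rewrite big1 ?scaler0// => i _.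
by rewrite scale0r.
Qed.

Lemma representable_int n (z : 'I_n -> int) : representable (fun i => (z i)%:~R).
Proof.
have unit i : representable (fun j : 'I_n => (j == i)%:R).
  by exists (TVar i), 0%N => E v; rewrite comb1 scale1r.
have opp c : representable c -> representable (fun i : 'I_n => - c i).
  move=> [t [m tE]]; exists (uopp t), m => E v.
  rewrite -[LHS]/(- uval (teval t v)) tE -scalerN; congr (_ *: _).
  by rewrite -sumrN; apply: eq_bigr => i _; rewrite scaleNr.
have mul i (k : nat) : representable (fun j : 'I_n => (j == i)%:R * k%:R).
  elim: k => [|k IH].
    have -> : (fun j : 'I_n => (j == i)%:R * 0%:R) = (fun=> 0) :> ('I_n -> R).
      by apply/funext => j; rewrite mulr0.
    exact: representable0.
  have -> : (fun j : 'I_n => (j == i)%:R * k.+1%:R) =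
      (fun j => (j == i)%:R * k%:R + (j == i)%:R) :> ('I_n -> R).
    by apply/funext => j; rewrite -natr1 mulrDr mulr1.
  exact: representableD.
have mulz i : representable (fun j : 'I_n => (j == i)%:R * (z i)%:~R).
  case: (z i) => k; first exact: mul.
  have -> : (fun j : 'I_n => (j == i)%:R * (Negz k)%:~R) =
      (fun j => - ((j == i)%:R * k.+1%:R)) :> ('I_n -> R).
    by apply/funext => j; rewrite NegzE mulrNz mulrN.
  exact/opp/mul.
have -> : (fun i => (z i)%:~R) =
    (fun j => \sum_(i <- index_enum 'I_n) (j == i)%:R * (z i)%:~R) :> ('I_n -> R).
  apply/funext => j; rewrite (bigD1 j)//= eqxx mul1r big1 ?addr0// => i.
  by rewrite eq_sym => /negPf->; rewrite mul0r.
elim: (index_enum 'I_n) => [|i s IH].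
  have -> : (fun j => \sum_(i <- [::]) (j == i)%:R * (z i)%:~R) = (fun=> 0) :> ('I_n -> R).
    by apply/funext => j; rewrite big_nil.
  exact: representable0.
have -> : (fun j => \sum_(i0 <- i :: s) (j == i0)%:R * (z i0)%:~R) =
    (fun j => (j == i)%:R * (z i)%:~R + \sum_(i <- s) (j == i)%:R * (z i)%:~R)
    :> ('I_n -> R).
  by apply/funext => j; rewrite big_cons.
exact: representableD.
Qed.

(** The coefficients are rounded to multiples of 1 / N, and the power of 2 is compensated by
a connective. *)
Lemma ball_combination n (l : 'I_n -> R) e : 0 < e ->
  exists (psi : formula L n) (l' : 'I_n -> R), [/\ quantifier_free psi,
    forall i, `|l' i - l i| <= e
  & forall E (v : 'I_n -> S E), eval psi v = `|\sum_i l' i *: uval (v i)|].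
Proof.
move=> e0; pose N : R := (Num.truncn e^-1).+1%:R.
have N0 : 0 < N by rewrite ltr0n.
have Ne : N^-1 <= e.
  have /truncn_itv/andP[_ h] : 0 <= e^-1 by rewrite invr_ge0 ltW.
  by rewrite invf_ple ?posrE// ltW.
pose z i := Num.floor (l i * N).
have [t [m tE]] := representable_int z.
pose s : R := (2 ^+ m) / N; have s0 : 0 < s by rewrite divr_gt0// exprn_gt0.
exists (faffine2 s (unorm t) 0 (unorm t) 0), (fun i => (z i)%:~R / N); split.
- exact: affine2_qf.
- move=> i; have /andP[h1 h2] := floor_itv (l i * N).
  apply: le_trans Ne; rewrite -[l i](mulfK (lt0r_neq0 N0)) -mulrBl normrM.
  rewrite normfV (gtr0_norm N0) ler_piMl ?invr_ge0 ?(ltW N0)// ler_norml.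
  by rewrite intrD in h2; apply/andP; split; lra.
- move=> E v; rewrite eval_affine2 mul0r !addr0.
  rewrite -[eval (unorm t) v]/(`|uval (teval t v)|) tE normrZ mulrA.
  have -> : \sum_i (z i)%:~R / N *: uval (v i) = N^-1 *: \sum_i (z i)%:~R *: uval (v i).
    by rewrite scaler_sumr; apply: eq_bigr => i _; rewrite scalerA mulrC.
  rewrite normrZ; congr (_ * _); have p0 : 0 < 2 ^+ m :> R by rewrite exprn_gt0.
  rewrite exprVn !normfV (gtr0_norm p0) (gtr0_norm N0) /s mulrAC divff ?mul1r//.
  by rewrite gt_eqF.
Qed.

Section ae_closed_ball.
Variable M : structure L.
Hypothesis MS : ae_closed S M.

Let u0 : forall E, S E := fun E => exist _ 0 (norm_ball0 E) : unit_ball E.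
Let S0 : forall E, gauge (u0 E) = 0. Proof. by []. Qed.
Let teq n t u := @ae_closed_teval_eq R L S u0 S0 M MS n t u.
Let feq n phi psi := @ae_closed_eval_eq R L S u0 S0 M MS n phi psi.
Let fle n phi := @ae_closed_le R L S u0 S0 M MS n phi.

Let zero : M := teval (uzero 0) (@vnil M).
Let mid (x y : M) : M := @finterp _ _ M UMid (pair_fun x y).
Let opp (x : M) : M := @finterp _ _ M UOpp (fun=> x).
Let nrm (x : M) : R := @pinterp _ _ M tt (fun=> x).

Let v2 (x y : M) (i : 'I_2) : M := nth x [:: x; y] i.
Let X : term L 2 := TVar (@Ordinal 2 0 isT).
Let Y : term L 2 := TVar (@Ordinal 2 1 isT).

Let zeroE n (v : 'I_n -> M) : teval (uzero n) v = zero.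
Proof. by rewrite /zero /=; congr finterp; apply/funext => -[]. Qed.
Let midE n (t u : term L n) v : teval (umid t u) v = mid (teval t v) (teval u v).
Proof.
rewrite /mid /=; congr finterp; apply/funext => i.
by rewrite /pair_fun; case: ifP.
Qed.
Let distE n (t u : term L n) (v : 'I_n -> M) :
  eval (FDist t u) v = mdist (teval t v) (teval u v).
Proof. by []. Qed.
Let distSE E n (t u : term L n) (v : 'I_n -> S E) :
  eval (FDist t u) v = `|uval (teval t v) - uval (teval u v)|.
Proof. by []. Qed.
Let normSE E n (t : term L n) (v : 'I_n -> S E) :
  eval (unorm t) v = `|uval (teval t v)|.
Proof. by []. Qed.

Let mid_opp x : mid x (opp x) = zero.
Proof.
have := @teq 2 (umid X (uopp X)) (uzero 2) _ (v2 x x); rewrite midE zeroE.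
apply=> E v; apply: val_inj; rewrite -/(uval _) uval_mid.
by rewrite -[uval (teval (uopp X) v)]/(- uval (teval X v)) subrr scaler0.
Qed.

Let nrmE x : nrm x = mdist zero x.
Proof.
have := @feq 2 (unorm X) (FDist (uzero 2) X) I I _ (v2 x x).
rewrite distE zeroE; apply=> E v.
by rewrite distSE normSE [uval (teval (uzero 2) v)]/= sub0r normrN.
Qed.

Let mdistE x y : mdist x y = 2 * mdist zero (mid x (opp y)).
Proof.
have qf : quantifier_free (faffine2 2 (FDist (uzero 2) (umid X (uopp Y))) 0 (FDist X Y) 0).
  exact: affine2_qf.
have := @feq 2 (FDist X Y) _ I qf _ (v2 x y).
rewrite eval_affine2 mul0r !addr0 !distE zeroE midE; apply=> E v.
rewrite eval_affine2 mul0r !addr0 !distSE uval_mid.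
rewrite -[uval (teval (uopp Y) v)]/(- uval (teval Y v)).
rewrite [uval (teval (uzero 2) v)]/= sub0r normrN normrZ gtr0_norm ?invr_gt0//.
by rewrite mulrA divff ?pnatr_eq0 ?mul1r.
Qed.

Let nrm_le1 x : mdist zero x <= 1.
Proof.
rewrite -nrmE -subr_le0.
have qf : quantifier_free (faffine2 1 (unorm X) 0 (unorm X) (-1)) by exact: affine2_qf.
have := @fle 2 _ qf _ (v2 x x); rewrite eval_affine2 mul1r mul0r addr0; apply=> E v.
by rewrite eval_affine2 mul1r mul0r addr0 normSE subr_le0 uval_le1.
Qed.

(** The one axiom of unit balls that is not universal: a point of norm at most 1 / 2 is half
of a point.  The formula phi subtracts from the error of the new point the excess over
1 / 2 of the norm of the given one, so that the condition holds without a bound on the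
latter. *)
Let doubling x : mdist zero x <= 2^-1 ->
  forall e, 0 < e -> exists y, mdist (mid y zero) x <= e.
Proof.
move=> x2 e e0.
pose phi : formula L 2 := faffine2 1 (FDist (umid X (uzero 2)) Y) (-1)
  (fpos (faffine2 1 (unorm Y) 0 (unorm Y) (- 2^-1))) 0.
have phiE (N : structure L) (v : 'I_2 -> N) : eval phi v = eval (FDist (umid X (uzero 2)) Y) v -
    Num.max 0 (eval (unorm Y) v - 2^-1).
  by rewrite eval_affine2 mul1r addr0 eval_pos mulN1r eval_affine2 mul1r mul0r addr0.
have qphi : quantifier_free phi.
  by apply: affine2_qf => // _; exact: affine2_qf.
have vE (N : Type) (a b : N) : vcons a (fun _ : 'I_1 => b) = fun i : 'I_2 => nth a [:: a; b] i.
  apply/funext => -[[|[|//]] h]; rewrite /vcons.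
    by rewrite (_ : Ordinal h = ord0) ?unlift_none//; exact: val_inj.
  rewrite (_ : Ordinal h = fintype.lift ord0 ord0) ?liftK//; exact: val_inj.
have [||y [_]] := @MS 1 phi 0 0 qphi _ (fun=> x) _ e e0.
- move=> E v _ t t0; pose a := uval (v ord0).
  have [y yE] : exists y : S E, `|2^-1 *: uval y - a| <= Num.max 0 (`|a| - 2^-1).
    have [a2|a2] := lerP `|a| 2^-1.
      have [|y yE] := @uval_surj E (2 *: a).
        by rewrite normrZ gtr0_norm// -ler_pdivlMl// mulr1.
      by exists y; rewrite yE scalerA mulVf ?pnatr_eq0// scale1r subrr normr0 le_max lexx.
    have a0 : 0 < `|a| by apply: lt_trans a2; rewrite invr_gt0.
    have [|y yE] := @uval_surj E (`|a|^-1 *: a).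
      by rewrite normrZ normfV normr_id mulVf ?gt_eqF.
    exists y; rewrite yE scalerA -[X in _ - X]scale1r -scalerBl normrZ.
    rewrite le_max; apply/orP; right.
    have -> : `|2^-1 / `|a| - 1| = 1 - 2^-1 / `|a|.
      by rewrite distrC ger0_norm// subr_ge0 ler_pdivrMr// mul1r ltW.
    by rewrite mulrBl mul1r divfK ?gt_eqF.
  exists y; split=> //; rewrite phiE (_ : v = fun=> v ord0); last first.
    by apply/funext => i; rewrite (ord1 i).
  rewrite vE distSE normSE uval_mid -/a.
  rewrite [uval (teval (uzero 2) _)]/= addr0; apply: (@le_trans _ _ 0); last exact: ltW.
  by rewrite subr_le0; exact: yE.
- by move=> i; rewrite gauge_triv.
rewrite phiE vE distE midE zeroE => h; exists y; apply: le_trans h.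
rewrite lerBrDr gerDl ge_max lexx /= subr_le0.
by move: x2; rewrite -nrmE.
Qed.

(** The map w into a unit ball preserves, up to e, midpoints and norms of the entries of s.
Universal conditions provide such maps for all s and e, and the embedding of M in a
Banach space is read off from their limit. *)
Definition approximant (s : seq M) (e : R) E (w : M -> S E) :=
  (forall x y z, x \in s -> y \in s -> z \in s ->
     `| `|2^-1 *: (uval (w x) + uval (w y)) - uval (w z)| - mdist (mid x y) z| <= e) /\
  (forall x, x \in s -> `| `|uval (w x)| - mdist zero x| <= e).

(** If no tuple of a unit ball came close, a universal condition would forbid the tuple s
in M. *)
Lemma approximant_ex s e : 0 < e -> exists E (w : M -> S E), approximant s e w.
Proof.
move=> e0; pose n := size s.
pose K := ('I_n * 'I_n * 'I_n + 'I_n)%type.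
pose atom (k : K) : formula L n := match k with
  | inl (i, j, k) => FDist (umid (TVar i) (TVar j)) (TVar k)
  | inr i => FDist (uzero n) (TVar i) end.
pose v (i : 'I_n) : M := nth zero s i.
pose Psi := fdev (fun k : 'I_#|{: K}| => atom (enum_val k)) (fun k => eval (atom (enum_val k)) v).
have qPsi : quantifier_free Psi by move=> k /=; case: (enum_val k) => [[[]]|].
have Psi0 : eval Psi v = 0 by rewrite eval_dev big1// => k _; rewrite subrr normr0.
have [E [w wP]] : exists E (w : 'I_n -> S E), eval Psi w < e.
  apply: contrapT => /forallNP h.
  have qf : quantifier_free (faffine2 (-1) Psi 0 Psi e) by exact: affine2_qf.
  have := @fle n _ qf _ v; rewrite eval_affine2 Psi0 mulr0 mul0r !add0r leNgt e0 => /(_ _)/notF; apply.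
  move=> E w; rewrite eval_affine2 mulN1r mul0r addr0 addrC subr_le0 leNgt.
  by apply/negP => lt; apply: (h E); exists w.
have atomP k : `|eval (atom k) w - eval (atom k) v| <= e.
  apply: le_trans (ltW wP); rewrite eval_dev (bigD1 (enum_rank k))//= enum_rankK.
  by rewrite lerDl sumr_ge0.
exists E, (fun x => if insub (index x s) is Some i then w i else u0 E).
have iP x : x \in s -> exists i : 'I_n, insub (index x s) = Some i /\ v i = x.
  move=> xs; have xn : (index x s < n)%N by rewrite index_mem.
  by exists (Ordinal xn); rewrite insubT /v nth_index.
split=> [x y z /iP[i [-> <-]] /iP[j [-> <-]] /iP[k [-> <-]]|x /iP[i [-> <-]]].
  by have := atomP (inl (i, j, k));
  rewrite -[atom _]/(FDist (umid (TVar i) (TVar j)) (TVar k)) distSE distE midE.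
have := atomP (inr i); rewrite -[atom _]/(FDist (uzero n) (TVar i)) distSE distE zeroE.
by rewrite [uval (teval (uzero n) w)]/= sub0r normrN.
Qed.

Let wlift (D : {freeg M / R}) E (w : M -> S E) : E := fglift (fun x => uval (w x)) D.

(** The infimum of these c is the limsup, along the approximants, of the norm of the
combination D of points of M. *)
Definition eventually_le (D : {freeg M / R}) (c : R) := exists s e, 0 < e /\
  forall E (w : M -> S E), approximant s e w -> `|wlift D w| <= c.

Lemma approximantW (s s' : seq M) (e e' : R) E (w : M -> S E) :
  {subset s <= s'} -> e' <= e -> approximant s' e' w -> approximant s e w.
Proof.
move=> ss ee [h1 h2]; split=> [x y z xs ys zs|x xs].
  by apply: le_trans (h1 x y z _ _ _) ee; exact: ss.
by apply: le_trans (h2 x _) ee; exact: ss.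
Qed.

Lemma eventually_le_ge0 D c : eventually_le D c -> 0 <= c.
Proof.
move=> [s [e [e0 h]]]; have [E [w wP]] := approximant_ex s e0.
exact: le_trans (normr_ge0 _) (h E w wP).
Qed.

Lemma eventually_leD D D' c c' : eventually_le D c -> eventually_le D' c' ->
  eventually_le (D + D') (c + c').
Proof.
move=> [s [e [e0 h]]] [s' [e' [e'0 h']]].
exists (s ++ s'), (Num.min e e'); split; first by rewrite lt_min e0.
move=> E w wP; rewrite /wlift fgliftD (le_trans (ler_normD _ _))// lerD//.
  apply: h; apply: approximantW wP; last by rewrite ge_min lexx.
  by move=> x; rewrite mem_cat => ->.
apply: h'; apply: approximantW wP; last by rewrite ge_min lexx orbT.
by move=> x; rewrite mem_cat orbC => ->.
Qed.

Lemma eventually_leZ D a c : eventually_le D c -> eventually_le (a *: D) (`|a| * c).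
Proof.
move=> [s [e [e0 h]]]; exists s, e; split=> // E w wP.
by rewrite /wlift fgliftZ normrZ ler_wpM2l// h.
Qed.

Lemma eventually_le_gen x e : 0 < e -> eventually_le << x >> (mdist zero x + e).
Proof.
move=> e0; exists [:: x], e; split=> // E w [_ /(_ x)].
rewrite inE eqxx => /(_ isT); rewrite ler_norml => /andP[_ h].
by rewrite /wlift liftU scale1r; lra.
Qed.

Lemma eventually_le_ex D : exists c, eventually_le D c.
Proof.
have e0 c : eventually_le 0 c <-> 0 <= c.
  split=> [|c0]; first exact: eventually_le_ge0.
  by exists [::], 1; split=> // E w _; rewrite /wlift fglift0 normr0.
rewrite -[D]freeg_sumE; elim: (dom D) => [|x s [c IH]].
  by exists 0; rewrite big_nil e0.
rewrite big_cons freegUZ; eexists; apply: eventually_leD IH.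
exact/eventually_leZ/(eventually_le_gen x ltr01).
Qed.

(** This limsup is a semi-norm on formal combinations of points of M; the quotient by it is
the space in which M embeds. *)
Let p (D : {freeg M / R}) := inf [set c | eventually_le D c].

Let p_le D c : eventually_le D c -> p D <= c.
Proof.
move=> h; apply: ge_inf => //; exists 0 => b; exact: eventually_le_ge0.
Qed.

Let p_ge D b : (forall c, eventually_le D c -> b <= c) -> b <= p D.
Proof. by move=> h; apply: lb_le_inf => //; exact: eventually_le_ex. Qed.

Let p_seminorm : seminorm p.
Proof.
apply: seminorm_of_le => [D D'|a D].
  rewrite -lerBlDr; apply: p_ge => c h; rewrite lerBlDr -lerBlDl.
  apply: p_ge => c' h'; rewrite lerBlDl; exact/p_le/eventually_leD.
have [->|a0] := eqVneq a 0.
  have [c h] := eventually_le_ex D.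
  by rewrite (le_trans (p_le (eventually_leZ 0 h)))// normr0 !mul0r.
have a1 : 0 < `|a| by rewrite normr_gt0.
rewrite -ler_pdivrMl//; apply: p_ge => c h; rewrite ler_pdivrMl//.
exact/p_le/eventually_leZ.
Qed.

Let p_gen x : p << x >> = mdist zero x.
Proof.
apply/eqP; rewrite eq_le; apply/andP; split.
  by apply/ler_addgt0Pr => e e0; exact/p_le/eventually_le_gen.
apply: p_ge => c [s [e [e0 h]]]; apply/ler_addgt0Pr => d d0.
have m0 : 0 < Num.min e d by rewrite lt_min e0.
have [E [w wP]] := approximant_ex (x :: s) m0.
have := h E w _; rewrite /wlift liftU scale1r => h1.
have {}h1 : `|uval (w x)| <= c.
  apply: h1; apply: approximantW wP; last by rewrite ge_min lexx.
  by move=> y ys; rewrite inE ys orbT.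
have [_ /(_ x)] := wP; rewrite inE eqxx => /(_ isT); rewrite ler_norml => /andP[h2 _].
have : Num.min e d <= d by rewrite ge_min lexx orbT.
by lra.
Qed.

Let p_mid x y : p (<< mid x y >> - 2^-1 *: (<< x >> + << y >>)) = 0.
Proof.
apply/eqP; rewrite eq_le (seminorm_ge0 p_seminorm) andbT.
apply/ler_addgt0Pr => e e0; rewrite add0r; apply: p_le.
exists [:: x; y; mid x y], e; split=> // E w [/(_ x y (mid x y)) + _].
rewrite !inE !eqxx !orbT => /(_ isT isT isT).
rewrite mdistxx subr0 normr_id distrC; apply: le_trans.
by rewrite /wlift -scaleNr fgliftD fgliftZ fgliftD !liftU !scale1r scaleNr.
Qed.

Lemma midpoint_embedding : exists (W : completeNormedModType R) (j : M -> W),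
  (forall x, `|j x| = mdist zero x) /\
  forall x y, j (mid x y) = 2^-1 *: (j x + j y).
Proof.
have [W [f [fl fN]]] := seminorm_realization p_seminorm.
exists W, (fun x => f << x >>); split=> [x|x y]; first by rewrite fN p_gen.
apply/eqP; rewrite -subr_eq0 -normr_eq0 -(linD fl) -(linZ fl) -(linB fl) fN.
by rewrite p_mid.
Qed.

Section embedded_ball.
Variables (W : completeNormedModType R) (j : M -> W).
Hypothesis jN : forall x, `|j x| = mdist zero x.
Hypothesis j_mid : forall x y, j (mid x y) = 2^-1 *: (j x + j y).

Let C := range j.

Let j0 : j zero = 0.
Proof. by apply/normr0_eq0; rewrite jN mdistxx. Qed.

Let j_opp x : j (opp x) = - j x.
Proof.
have := j_mid x (opp x); rewrite mid_opp j0 => /esym/eqP.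
rewrite scaler_eq0 invr_eq0 pnatr_eq0 /= addrC addr_eq0.
by move=> /eqP.
Qed.

Let j_dist x y : `|j x - j y| = mdist x y.
Proof.
rewrite mdistE -jN j_mid j_opp normrZ gtr0_norm ?invr_gt0//.
by rewrite mulrA divff ?pnatr_eq0// mul1r.
Qed.

Let C_mid a b : C a -> C b -> C (2^-1 *: (a + b)).
Proof. by move=> [x _ <-] [y _ <-]; exists (mid x y). Qed.

Let C_opp a : C a -> C (- a).
Proof. by move=> [x _ <-]; exists (opp x). Qed.

Let C0 : C 0. Proof. by exists zero. Qed.

(** M is complete and j is isometric. *)
Let C_closed a : (forall e, 0 < e -> exists2 b, C b & `|a - b| < e) -> C a.
Proof.
move=> Ca; have p0 k : 0 < (2^-1 : R) ^+ k by rewrite exprn_gt0 ?invr_gt0.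
have /choice[x xP] k : exists x, `|a - j x| < (2^-1) ^+ k.
  by have [_ [x _ <-] h] := Ca _ (p0 k); exists x.
have : cvg (x @ \oo : set_system M).
  apply/cauchy_cvgP/cauchyP => e e0; have e2 : 0 < e / 2 by rewrite divr_gt0.
  have [N NP] := small_pow2 e2; exists (x N); exists N => // k /= Nk.
  rewrite ballEmdist /= -j_dist (le_lt_trans (ler_distD a _ _))// (splitr e).
  by rewrite distrC ltrD// (lt_trans (xP _))// NP.
move=> /cvg_ex[l /cvg_ballP xl]; exists l => //; apply/eqP.
rewrite -subr_eq0 -normr_le0; apply/ler_addgt0Pr => e e0; rewrite add0r.
have e2 : 0 < e / 2 by rewrite divr_gt0.
have [N NP] := small_pow2 e2; have [K _ KP] := xl _ e2.
have := KP (maxn N K) (leq_maxr _ _); rewrite ballEmdist /= -j_dist => h.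
rewrite (le_trans (ler_distD (j (x (maxn N K))) _ _))// (splitr e) lerD ?ltW//.
by rewrite distrC (lt_trans (xP _))// NP// leq_maxl.
Qed.

(** Dyadic multiples are obtained by iterating midpoints, the others by closedness. *)
Let C_scale a t : C a -> `|t| <= 1 -> C (t *: a).
Proof.
move=> Ca; suff pos u : 0 <= u <= 1 -> C (u *: a).
  move=> t1; have [tp|tn] := lerP 0 t.
    by apply: pos; rewrite tp -(ger0_norm tp).
  rewrite -[t]opprK scaleNr; apply: C_opp; apply: pos.
  by rewrite oppr_ge0 (ltW tn) -(ltr0_norm tn).
move: u => {}t t01; have dyadic k s : 0 <= s <= 1 -> exists t', [/\ 0 <= t' <= 1,
    `|s - t'| <= 2^-1 ^+ k & C (t' *: a)].
  elim: k s => [|k IH] s /andP[s0 s1].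
    by exists 0; rewrite scale0r subr0 expr0 ger0_norm// lexx ler01.
  have [s2|s2] := lerP s 2^-1.
    have [|t' [/andP[h1 h2] h3 h4]] := IH (2 * s).
      rewrite mulr_ge0//= -ler_pdivlMl// mulr1//.
    exists (2^-1 * t'); split.
    - by apply/andP; split; lra.
    - by rewrite exprS; move: h3; rewrite !ler_norml => /andP[? ?]; apply/andP; split; lra.
    - by rewrite -scalerA -[t' *: a]addr0; exact: C_mid.
  have [|t' [/andP[h1 h2] h3 h4]] := IH (2 * s - 1); first by apply/andP; split; lra.
  exists (2^-1 * (t' + 1)); split.
  - by apply/andP; split; lra.
  - by rewrite exprS; move: h3; rewrite !ler_norml => /andP[? ?]; apply/andP; split; lra.
  - by rewrite -scalerA scalerDl scale1r; exact: C_mid.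
apply: C_closed => e e0; have c0 : 0 < e / (`|a| + 1) by rewrite divr_gt0// ltr_wpDl.
have [N NP] := small_pow2 c0; have [t' [_ h1 h2]] := dyadic N _ t01.
exists (t' *: a) => //; rewrite -scalerBl normrZ.
have := NP N (leqnn N); rewrite ltr_pdivlMr ?ltr_wpDl//; apply: le_lt_trans.
by apply: ler_pM => //; rewrite lerDl.
Qed.

(** This is where [doubling] enters: it makes the range of j reach the unit sphere. *)
Let C_double a : C a -> `|a| <= 2^-1 -> C (2 *: a).
Proof.
move=> [x _ <-]; rewrite jN => x2; apply: C_closed => e e0.
have e3 : 0 < e / 3 by rewrite divr_gt0.
have [y yx] := doubling x2 e3; exists (j y); first by exists y.
move: yx; rewrite -j_dist j_mid j0 addr0 => h.
have -> : 2 *: j x - j y = - 2 *: (2^-1 *: j y - j x).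
  by rewrite scaleNr scalerBr scalerA divff ?pnatr_eq0// scale1r opprB.
by rewrite normrZ normrN gtr0_norm//; lra.
Qed.

(** The linear span of the range of j: a convex symmetric set spans by scaling. *)
Let ray : set W := [set a | exists r b, C b /\ a = r *: b].

(** A vector of the span is scaled into the range of j by a power of 2 and then doubled back
as long as its norm allows. *)
Let ray_ball a : ray a -> `|a| <= 1 -> C a.
Proof.
move=> [r [b [Cb aE]]]; have [n rn] : exists n : nat, `|r| <= 2 ^+ n.
  exists (Num.truncn `|r|); rewrite -natrX.
  have /truncn_itv/andP[_ /ltW /le_trans] := normr_ge0 r; apply.
  by rewrite ler_nat ltn_expl.
have p0 k : 0 < (2 : R) ^+ k by rewrite exprn_gt0.
have : C ((2 ^+ n)^-1 *: a).
  rewrite aE scalerA; apply: C_scale => //.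
  by rewrite normrM normfV (gtr0_norm (p0 n)) ler_pdivrMl// mulr1.
elim: n {rn} => [|n IH] Ca a1; first by move: Ca; rewrite expr0 invr1 scale1r.
apply: IH => //.
have -> : (2 ^+ n)^-1 *: a = 2 *: ((2 ^+ n.+1)^-1 *: a).
  by rewrite scalerA exprS invfM mulrA divff ?pnatr_eq0// mul1r.
apply: C_double => //; rewrite normrZ normfV (gtr0_norm (p0 _)) exprS invfM -mulrA.
rewrite ler_piMr ?invr_ge0// ler_pdivrMl// mulr1 (le_trans a1)//.
by rewrite exprn_ege1// ler1n.
Qed.

(** The span of the range of j is a closed subspace, hence a Banach space, whose unit ball is
that range. *)
Lemma embedded_ball_iso : exists E, isomorphic M (S E).
Proof.
have rayZ c a : ray a -> ray (c *: a).
  by move=> [r [b [Cb ->]]]; exists (c * r), b; rewrite scalerA.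
have rayD a b : ray a -> ray b -> ray (a + b).
  move=> [r [a' [Ca ->]]] [s [b' [Cb ->]]].
  pose T := `|r| + `|s| + 1; have T0 : 0 < T by rewrite ltr_wpDl// addr_ge0.
  have Tn : T != 0 by rewrite gt_eqF.
  exists (2 * T), (2^-1 *: ((r / T) *: a' + (s / T) *: b')); split.
    apply: C_mid; apply: C_scale => //; rewrite normrM normfV (gtr0_norm T0);
    by rewrite ler_pdivrMr// mul1r /T; have := normr_ge0 r; have := normr_ge0 s; lra.
  rewrite scalerA mulrAC divff ?pnatr_eq0// mul1r scalerDr !scalerA.
  by rewrite ![T * _]mulrC !divfK.
have [|||E [i [il iN iR]]] := @closed_subspace R W ray.
- by move=> c a b ra rb; apply: rayD => //; exact: rayZ.
- by exists 0, 0; rewrite scale0r.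
- move=> a ha; pose r := `|a| + 1; have r0 : 0 < r by rewrite ltr_wpDl.
  have rn : r != 0 by rewrite gt_eqF.
  exists r, (r^-1 *: a); split; last by rewrite scalerA divff// scale1r.
  apply: C_closed => e e0; have m0 : 0 < Num.min (r * e) 1.
    by rewrite lt_min mulr_gt0//= ltr01.
  have [b rb ab] := ha _ m0; exists (r^-1 *: b); last first.
    rewrite -scalerBr normrZ normfV (gtr0_norm r0) ltr_pdivrMl//.
    by apply: lt_le_trans ab _; rewrite ge_min lexx.
  apply: ray_ball; first exact: rayZ.
  rewrite normrZ normfV (gtr0_norm r0) ler_pdivrMl// mulr1 /r.
  have /le_trans := ler_distD a b 0; rewrite !subr0.
  have ab1 : `|a - b| < 1 by apply: lt_le_trans ab _; rewrite ge_min lexx orbT.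
  by rewrite distrC in ab1; move=> /(_ _ (lexx _)); lra.
have ii : isom i by [].
have /choice[h hP] x : exists y : S E, i (uval y) = j x.
  have [y _ yx] : range i (j x).
    by rewrite iR; exists 1, (j x); rewrite scale1r; split=> //; exists x.
  have [|z zy] := @uval_surj E y; first by rewrite -iN yx jN nrm_le1.
  by exists z; rewrite zy.
have i_inj a b : i a = i b -> a = b.
  by move=> ab; apply/eqP; rewrite -subr_eq0 -normr_eq0 -(isomB _ _ ii) ab subrr normr0.
exists E, h; split; last first.
  apply/seteqP; split=> // y _.
  have [x _ xy] : C (i (uval y)).
    apply: ray_ball; last by rewrite iN uval_le1.
    by rewrite -iR; exists (uval y).
  by exists x => //; apply: val_inj; apply: i_inj; rewrite -/(uval _) hP xy.
split=> [x y|x|f x|[] x].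
- by rewrite -j_dist -!hP isomB.
- by rewrite !gauge_triv.
- case: f x => x; apply: val_inj; apply: i_inj; rewrite -/(uval _) hP.
  + have -> : finterp x = zero by rewrite /zero /=; congr finterp; apply/funext => -[].
    by rewrite j0 -[LHS](lin0 il).
  + have -> : finterp x = opp (x ord0).
      by rewrite /opp; congr finterp; apply/funext => k; rewrite (ord1 k).
    by rewrite j_opp -hP -[RHS]/(i (- uval (h (x ord0)))) -[in RHS]scaleN1r (linZ il) scaleN1r.
  + have -> : finterp x = mid (x ord0) (x ord_max) by rewrite {1}[x]pair_funE.
    rewrite j_mid -!hP -(linD il) -(linZ il); congr (i _).
- have -> : x = (fun=> x ord0) by apply/funext => k; rewrite (ord1 k).
  by rewrite -[RHS]/(nrm (x ord0)) nrmE -jN -hP iN.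
Qed.

End embedded_ball.

Lemma ae_closed_ball : exists E, isomorphic M (S E).
Proof.
have [W [j [jN j_mid]]] := midpoint_embedding.
exact: embedded_ball_iso jN j_mid.
Qed.

End ae_closed_ball.

Definition ball_coef (f : Defs.fsym L) : 'I_(far f) -> R :=
  match f with UZero => fun=> 0 | UOpp => fun=> -1 | UMid => fun=> 2^-1 end.

Lemma ball_finterp_coef E (f : Defs.fsym L) (x : 'I_(far f) -> S E) :
  uval (finterp x) = \sum_i ball_coef i *: uval (x i).
Proof.
case: f x => x /=; first by rewrite big_ord0.
  by rewrite big_ord1 scaleN1r.
rewrite !big_ord_recl big_ord0 addr0 -scalerDr; congr (_ *: (_ + uval (x _))).
exact: val_inj.
Qed.

Definition ball_presentation : presentation L.
Proof.
refine (@Presentation R L S (fun E x => uval x) _ _ _ _ _ ball_coef _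
  (fun _ _ => 1) _ _ _).
- by move=> E x y; exact: val_inj.
- by [].
- by [].
- by move=> E x _; exact: uval_le1.
- by move=> E x x1; apply: uval_surj; exact: x1.
- exact: ball_finterp_coef.
- by move=> E Q x; rewrite big_ord1 scale1r.
- exact: ball_combination.
- exact: ae_closed_ball.
Defined.

End UnitBalls.

(** * The model completion and the types of Banach spaces *)

Section SeminormSpaces.
Context (R : realType) (E : completeNormedModType R) (I : choiceType).

Lemma admissible_whole :
  seminorm_space E I = @admissible_seminorm R (banach_signature R) E I.
Proof.
apply/seteqP; split=> [xi h|xi []//].
by split.
Qed.

Lemma admissible_ball :
  seminorm_space_le1 E I = @admissible_seminorm R (ball_signature R) E I.
Proof.
apply/seteqP; split=> [xi [h h1]|xi [h h1]]; split=> //; exact: h1.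
Qed.

End SeminormSpaces.

Theorem proposition1p21 (R : realType) :
  (* whole Banach spaces, in unbounded continuous logic *)
  (let T := theory_of (fun M : structure (banach_signature R) =>
              exists E : completeNormedModType R, M = banach_structure E) in
   inductive_theory T /\
   exists T' : theory (banach_signature R),
     [/\ model_completion T T', complete_theory T', aleph0_categorical T'
       & forall (E : completeNormedModType R) (I : choiceType),
           exists h : type_space T' (banach_structure E) I ->
                      seminorm_space E I,
             homeomorphism h /\
             forall (F : completeNormedModType R) (j : {linear E -> F})
                 (a : I -> F) (p : type_space T' (banach_structure E) I),
               model (banach_structure F) T' ->
               (forall x, `|j x| = `|x|) ->
               \val p = elementary_type (A := banach_structure E)
                          (N := banach_structure F) j a ->
               \val (h p) = norm_type j a]) /\
  (* unit balls, in continuous first-order logic *)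
  (let T := theory_of (fun M : structure (ball_signature R) =>
              exists E : completeNormedModType R, M = ball_structure E) in
   inductive_theory T /\
   exists T' : theory (ball_signature R),
     [/\ model_completion T T', complete_theory T', aleph0_categorical T'
       & forall (E : completeNormedModType R) (I : choiceType),
           exists h : type_space T' (ball_structure E) I ->
                      seminorm_space_le1 E I,
             homeomorphism h /\
             forall (F : completeNormedModType R) (j : {linear E -> F})
                 (jB : unit_ball E -> unit_ball F) (a : I -> unit_ball F)
                 (p : type_space T' (ball_structure E) I),
               model (ball_structure F) T' ->
               (forall x, `|j x| = `|x|) ->
               (forall x, \val (jB x) = j (\val x)) ->
               \val p = elementary_type (A := ball_structure E)
                          (N := ball_structure F) jB a ->
               \val (h p) = norm_type j (fun i => \val (a i))]).
Proof.
split.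
  have [Tind [T' [mc ct cat types]]] := presented_class_theorem (whole_presentation R).
  split=> //; exists T'; split=> // E I.
  have [h [hh hP]] := types E I _ (admissible_whole E I).
  exists h; split=> // F j a p FT jN; apply: hP => //.
  by split=> // c x y; rewrite linearP.
have [Tind [T' [mc ct cat types]]] := presented_class_theorem (ball_presentation R).
split=> //; exists T'; split=> // E I.
have [h [hh hP]] := types E I _ (admissible_ball E I).
exists h; split=> // F j jB a p FT jN jE; apply: hP => //.
by split=> // c x y; rewrite linearP.
Qed.
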